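(* Fix $\vartheta>0$. Then there is an open set $\mathcal{D}_3\subset\mathbb{C}$ with $\mathbb{R}\subset\mathcal{D}_3$ such that $$ \lim_{n\to\infty}\frac{\mathbb{E}\, e^{zX^{(3)}_{n,\vartheta n}}}{e^{n\varphi_3(z;\vartheta)}}=\sqrt{\frac{\vartheta}{\vartheta L_3(z;\vartheta)+\vartheta-1}},\qquad z\in\mathcal{D}_3, $$ where $$ L_3(z;\vartheta):=\frac1\vartheta+W_0\big(\vartheta^{-1}(e^{-z}-1)e^{-1/\vartheta}\big),\qquad \varphi_3(z;\vartheta):=(\vartheta-1)\log\vartheta-1+(\vartheta-1)\log L_3(z;\vartheta)+\vartheta\big(z+L_3(z;\vartheta)\big), $$ and the limit is taken along those $n\in\mathbb{N}$ for which $X^{(3)}_{n,\vartheta n}$ is defined, i.e. $\vartheta n\in\mathbb{N}$ or $\vartheta n>n-1$ (nothing is claimed if there are only finitely many such $n$). Moreover, the convergence is locally uniform on $\mathcal{D}_3$ with speed $O(1/n)$, i.e. for every compact $K\subset\mathcal{D}_3$ the supremum over $z\in K$ of the absolute difference of the two sides is $O(1/n)$.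
   Context: Let $\genfrac{\{}{\}}{0pt}{}{n}{k}$ be the Stirling numbers of the second kind. For $n\in\mathbb{N}$ and $\theta$ either a positive integer or a real number with $\theta>n-1$, the random variable $X^{(3)}_{n,\theta}$ has the Stirling–Sibuya distribution $\mathbb{P}[X^{(3)}_{n,\theta}=k]=\genfrac{\{}{\}}{0pt}{}{n}{k}\frac{\theta(\theta-1)\cdots(\theta-k+1)}{\theta^n}$, $k\in\{1,\dots,n\}$. (For integer $\theta$ it is the number of occupied boxes when $n$ balls are allocated independently and uniformly among $\theta$ boxes.) $W_0$ is the principal branch of the Lambert $W$-function: the analytic function on $\mathbb{C}\setminus(-\infty,-1/e]$ with $W_0(z)e^{W_0(z)}=z$ whose restriction to $(-1/e,\infty)$ is the inverse of $w\mapsto we^w$, $w\in(-1,\infty)$. Logarithms and square roots are principal branches (the set $\mathcal{D}_3$ being such that all expressions are defined on it). *)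

(* Defs.v *)
From Stdlib Require Import Reals List ClassicalEpsilon.
From Coquelicot Require Import Coquelicot.
Open Scope R_scope.

(** * Elementary complex functions, with principal branches *)

Definition Cexp (z : C) : C :=
  (exp (Re z) * cos (Im z), exp (Re z) * sin (Im z)).

(** For [z <> 0], the argument of [z] in the interval (-PI, PI]. *)
Definition Carg (z : C) : R :=
  if Rle_dec 0 (Im z) then acos (Re z / Cmod z) else - acos (Re z / Cmod z).

(** Meaningful for [z <> 0] only. *)
Definition Clog (z : C) : C := (ln (Cmod z), Carg z).

(** Meaningful for [z <> 0] only. *)
Definition Csqrt (z : C) : C := Cexp (Clog z / 2)%C.

(** [C_minus_ray a z] : [z] lies in the plane slit along (-oo, a]. *)
Definition C_minus_ray (a : R) (z : C) : Prop := ~ (Im z = 0 /\ Re z <= a).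

Definition compact_C (K : C -> Prop) : Prop :=
  forall (I : Type) (U : I -> C -> Prop),
    (forall i, open (U i)) ->
    (forall z, K z -> exists i, U i z) ->
    exists l : list I, forall z, K z -> exists i, In i l /\ U i z.

(** * The principal branch of the Lambert W function *)

(** Analyticity on the (open) slit plane is complex differentiability at each
    of its points.  Since [w |-> w * exp w] maps (-1, +oo) onto (-1/e, +oo),
    the last clause says that the restriction of [W] to (-1/e, +oo) is the
    inverse of this map. *)
Definition is_LambertW0 (W : C -> C) : Prop :=
  (forall z, C_minus_ray (- exp (-1)) z ->
     @ex_derive C_AbsRing C_NormedModule W z) /\
  (forall z, C_minus_ray (- exp (-1)) z -> (W z * Cexp (W z))%C = z) /\
  (forall w : R, -1 < w -> W (RtoC (w * exp w)) = RtoC w).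

(** These properties determine the function on the slit plane; its values on
    the cut are arbitrary. *)
Definition LambertW0 : C -> C :=
  epsilon (inhabits (fun z : C => z)) is_LambertW0.

(** * The Stirling-Sibuya distribution *)

(** Stirling numbers of the second kind. *)
Fixpoint stirling2 (n k : nat) : nat :=
  match n, k with
  | O, O => 1
  | O, S _ => 0
  | S _, O => 0
  | S n', S k' => S k' * stirling2 n' (S k') + stirling2 n' k'
  end.

(** theta (theta - 1) ... (theta - k + 1) *)
Fixpoint falling (theta : R) (k : nat) : R :=
  match k with
  | O => 1
  | S k' => falling theta k' * (theta - INR k')
  end.

Definition SS_defined (n : nat) (theta : R) : Prop :=
  (1 <= n)%nat /\
  ((exists m : nat, (1 <= m)%nat /\ theta = INR m) \/ theta > INR n - 1).

(** The probability of [k], for [1 <= k <= n]. *)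
Definition SS_pmf (n : nat) (theta : R) (k : nat) : R :=
  INR (stirling2 n k) * falling theta k / theta ^ n.

(** The expectation of [g X], where [X] has the Stirling-Sibuya distribution
    with parameters [n] and [theta]. *)
Definition SS_expect (n : nat) (theta : R) (g : nat -> C) : C :=
  @sum_n_m C_AbelianMonoid (fun k => (RtoC (SS_pmf n theta k) * g k)%C) 1 n.

(** The expectation of [exp (z X)]. *)
Definition SS_mgf (n : nat) (theta : R) (z : C) : C :=
  SS_expect n theta (fun k => Cexp (z * RtoC (INR k))%C).

(** * The limiting functions *)

Definition W_arg (vth : R) (z : C) : C :=
  (/ RtoC vth * (Cexp (- z) - 1) * RtoC (exp (- / vth)))%C.

Definition L3 (vth : R) (z : C) : C :=
  (/ RtoC vth + LambertW0 (W_arg vth z))%C.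

Definition phi3 (vth : R) (z : C) : C :=
  (RtoC ((vth - 1) * ln vth) - 1 + RtoC (vth - 1) * Clog (L3 vth z)
   + RtoC vth * (z + L3 vth z))%C.

Definition radicand3 (vth : R) (z : C) : C :=
  (RtoC vth / (RtoC vth * L3 vth z + RtoC vth - 1))%C.

(** Every expression in the limit relation is defined at [z], and the branches
    of W, log and the square root are evaluated off their cuts. *)
Definition defined3 (vth : R) (z : C) : Prop :=
  C_minus_ray (- exp (-1)) (W_arg vth z) /\
  C_minus_ray 0 (L3 vth z) /\
  (RtoC vth * L3 vth z + RtoC vth - 1)%C <> 0 /\
  C_minus_ray 0 (radicand3 vth z).

Definition ratio3 (vth : R) (n : nat) (z : C) : C :=
  (SS_mgf n (vth * INR n) z / Cexp (RtoC (INR n) * phi3 vth z))%C.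

(* Main.v *)
(* Write [L = L3 z] and [f x = 1 + exp z (exp x - 1)].  Up to the factor [theta ^ n], the
   expectation is [n!] times the [x ^ n]-coefficient of [f ^ theta], [theta = vth n], that is, an
   integral of [f ^ theta / x ^ (n + 1)] along a loop around 0, and [L] is the saddle point of
   [vth log f - log x].  It is evaluated by Laplace's method along circles through [L] whose shape
   depends on the real point near which [z] lies.

   If [vth < 1], then [theta] is an integer for large [n] and the circle [|x| = |L|] works.  If
   [vth >= 1], then [theta] may be any real number and the loop must not enclose a zero of [f]; for
   [vth L >= 1] (that is, [z <= 0] when [z] is real) the same circle still works, and otherwise the
   circle of Apollonius on which [|x - x0| / |x|] is constant does, [x0] being the real zero of [f].

   Stirling's formula and the Gaussian integral are not needed: for [vth = 1] and [z = 0] the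
   expectation is exactly 1, so that the normalising constant is the inverse of the same integral
   for these values.  The set [D3] is a union of discs centred at the real points.

   The function [W0] is constructed by showing that [w exp w] is a bijection from its range onto
   the slit plane, by means of polar coordinates, and by inverting it locally. *)
Require Import Defs.
From Stdlib Require Import Reals Ranalysis5 Factorial Lra Lia Classical ClassicalEpsilon.
From Coquelicot Require Import Coquelicot.
Open Scope R_scope.

(** With [x = L * contour s t], the ratio is [kappa n] times an integral of
    [rel_occ ^ (vth n) / contour ^ n], which up to the branch of the power depends on [z] only
    through [L]. It is therefore enough to have estimates that are uniform for complex [L] near a
    real [L0]; the strict inequalities known for [L0] survive a small perturbation by compactness.
    Two conditions shape the choice of the loop. The saddle must dominate:
    [|f(x) / f(L)| ^ vth < |x / L|] elsewhere on the loop. And a non-integral power is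
    [exp (theta * Clog f)], so [f] must avoid the cut on everything swept while the loop shrinks to
    0. For [vth L0 < 1] both rest on [f] being proportional to [exp (x - x0) - 1]: on the circle of
    Apollonius this gives [|f(x) / f(L)| < |x / L|], which suffices because [|x / L| <= 1] and
    [vth >= 1]. The rate: the integral has order [n^(-1/2)], the terms of the expansion in [t] and
    [t^3] are odd and cancel, and the rest is [O(n^(-3/2))]. *)

(** * The complex exponential and inequalities for the modulus *)

Lemma Ceq (a b : C) : Re a = Re b -> Im a = Im b -> a = b.
Proof. destruct a, b; simpl; intros; subst; reflexivity. Qed.

Lemma Cexp_plus (a b : C) : Cexp (a + b) = (Cexp a * Cexp b)%C.
Proof.
  apply Ceq; unfold Cexp, Re, Im; simpl; rewrite exp_plus, ?cos_plus, ?sin_plus; ring.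
Qed.

Lemma Cexp_RtoC (x : R) : Cexp (RtoC x) = RtoC (exp x).
Proof. apply Ceq; unfold Cexp, Re, Im; simpl; rewrite ?cos_0, ?sin_0; ring. Qed.

Lemma Cexp_0 : Cexp 0 = 1.
Proof. rewrite Cexp_RtoC, exp_0. reflexivity. Qed.

Lemma Cmod_Cexp (w : C) : Cmod (Cexp w) = exp (Re w).
Proof.
  unfold Cmod, Cexp; simpl.
  replace (_ + _) with (exp (Re w) ^ 2 * (Rsqr (sin (Im w)) + Rsqr (cos (Im w))))
    by (unfold Rsqr; ring).
  rewrite sin2_cos2, Rmult_1_r.
  apply sqrt_pow2, Rlt_le, exp_pos.
Qed.

Lemma Cexp_neq_0 (w : C) : Cexp w <> 0.
Proof. apply Cmod_gt_0. rewrite Cmod_Cexp. apply exp_pos. Qed.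

Lemma Cexp_opp (w : C) : Cexp (- w) = (/ Cexp w)%C.
Proof.
  assert (H : (Cexp (- w) * Cexp w)%C = 1).
  { rewrite <- Cexp_plus. replace (- w + w)%C with (RtoC 0) by ring. apply Cexp_0. }
  rewrite <- (Cmult_1_r (Cexp (- w))), <- (Cinv_r (Cexp w)) by apply Cexp_neq_0.
  rewrite Cmult_assoc, H. ring.
Qed.

Lemma Cexp_pow (w : C) (n : nat) : Cexp (RtoC (INR n) * w) = (Cexp w ^ n)%C.
Proof.
  induction n as [|n IH].
  - simpl. rewrite Cmult_0_l. apply Cexp_0.
  - rewrite Cpow_S, <- IH, <- Cexp_plus. f_equal. rewrite S_INR, RtoC_plus. ring.
Qed.

Lemma Cmod_sqr (z : C) : Cmod z * Cmod z = Re z * Re z + Im z * Im z.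
Proof. generalize (Cmod2_alt z). simpl. lra. Qed.

Lemma Re_le_Cmod (z : C) : Re z <= Cmod z.
Proof. eapply Rle_trans; [apply Rle_abs | apply re_le_Cmod]. Qed.

Lemma Rabs_Im_le_Cmod (z : C) : Rabs (Im z) <= Cmod z.
Proof. eapply Rle_trans; [|apply Rmax_Cmod]. apply Rmax_r. Qed.

Lemma Cmod_le_Re_Im (z : C) : Cmod z <= Rabs (Re z) + Rabs (Im z).
Proof.
  apply Rsqr_incr_0_var;
    [| generalize (Rabs_pos (Re z)) (Rabs_pos (Im z)); lra].
  unfold Rsqr. rewrite Cmod_sqr.
  generalize (Rabs_pos (Re z)) (Rabs_pos (Im z)).
  rewrite <- (Rabs_right (Re z * Re z + Im z * Im z))
    by (generalize (Rle_0_sqr (Re z)) (Rle_0_sqr (Im z)); unfold Rsqr; lra).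
  generalize (Rabs_triang (Re z * Re z) (Im z * Im z)).
  rewrite !Rabs_mult. nra.
Qed.

Lemma Cmod_minus_sym (a b : C) : Cmod (a - b) = Cmod (b - a).
Proof. rewrite <- Cmod_opp. f_equal. ring. Qed.

Lemma Cmod_triangle_le (a b : C) (x y : R) : Cmod a <= x -> Cmod b <= y -> Cmod (a + b) <= x + y.
Proof. generalize (Cmod_triangle a b). lra. Qed.

Lemma Cmod_minus_le (a b : C) : Cmod (a - b) <= Cmod a + Cmod b.
Proof. unfold Cminus. rewrite <- (Cmod_opp b). apply Cmod_triangle. Qed.

Lemma Cmod_reverse (a b : C) : Cmod a - Cmod b <= Cmod (a - b).
Proof.
  generalize (Cmod_triangle (a - b) b). replace (a - b + b)%C with a by ring. lra.
Qed.

Lemma Cmod_RtoC_pos (x : R) : 0 <= x -> Cmod (RtoC x) = x.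
Proof. intros. rewrite Cmod_R. now apply Rabs_right, Rle_ge. Qed.

(** * Continuity and derivatives of complex-valued functions *)

Lemma continuous_derivable (h : R -> R) (t : R) : ex_derive h t -> continuous h t.
Proof. apply (ex_derive_continuous (K := R_AbsRing) (V := R_NormedModule)). Qed.

Lemma continuity_pt_derivable (h : R -> R) (t d : R) : is_derive h t d -> continuity_pt h t.
Proof. intros H. apply continuity_pt_filterlim, continuous_derivable. now exists d. Qed.

(** Continuity and derivatives are taken componentwise, so that real-variable results and [RInt]
    apply to each part. The domain is arbitrary because the same rules are used on [R], on [C] and
    on products of parameters. *)
Definition ccont {U : UniformSpace} (f : U -> C) (u : U) : Prop :=
  continuous (fun v => Re (f v)) u /\ continuous (fun v => Im (f v)) u.

Definition cderiv (f : R -> C) (t : R) (d : C) : Prop :=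
  is_derive (fun s => Re (f s)) t (Re d) /\ is_derive (fun s => Im (f s)) t (Im d).

Section Continuity.
Context {U : UniformSpace}.
Implicit Types (f g : U -> C) (u : U).

Lemma ccont_const (c : C) u : ccont (fun _ => c) u.
Proof. split; apply continuous_const. Qed.

Lemma ccont_RtoC (h : U -> R) u : continuous h u -> ccont (fun v => RtoC (h v)) u.
Proof. intros H; split; simpl; [exact H | apply continuous_const]. Qed.

Lemma ccont_plus f g u : ccont f u -> ccont g u -> ccont (fun v => f v + g v)%C u.
Proof. intros [? ?] [? ?]; split; simpl; apply (continuous_plus (V := R_NormedModule)); assumption. Qed.

Lemma ccont_opp f u : ccont f u -> ccont (fun v => - f v)%C u.
Proof. intros [? ?]; split; simpl; apply (continuous_opp (V := R_NormedModule)); assumption. Qed.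

Lemma ccont_minus f g u : ccont f u -> ccont g u -> ccont (fun v => f v - g v)%C u.
Proof. intros; apply ccont_plus; [|apply ccont_opp]; assumption. Qed.

Lemma ccont_mult f g u : ccont f u -> ccont g u -> ccont (fun v => f v * g v)%C u.
Proof.
  intros [? ?] [? ?]; split; simpl.
  - apply (continuous_minus (V := R_NormedModule)); apply (continuous_mult (K := R_AbsRing)); assumption.
  - apply (continuous_plus (V := R_NormedModule)); apply (continuous_mult (K := R_AbsRing)); assumption.
Qed.

Lemma ccont_pow f u (n : nat) : ccont f u -> ccont (fun v => f v ^ n)%C u.
Proof.
  intros H; induction n; simpl; [apply ccont_const | apply ccont_mult; assumption].
Qed.

Lemma ccont_Cexp f u : ccont f u -> ccont (fun v => Cexp (f v)) u.
Proof.
  intros [? ?]; split; simpl; apply (continuous_mult (K := R_AbsRing)).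
  1, 3: apply (continuous_comp (fun v => Re (f v)) exp); [assumption | apply continuous_exp].
  - apply (continuous_comp (fun v => Im (f v)) cos); [assumption | apply continuous_cos].
  - apply (continuous_comp (fun v => Im (f v)) sin); [assumption | apply continuous_sin].
Qed.

Lemma ccont_Cmod f u : ccont f u -> continuous (fun v => Cmod (f v)) u.
Proof.
  intros [H1 H2].
  apply continuous_ext with
    (f := fun v => sqrt (Re (f v) * Re (f v) + Im (f v) * Im (f v))).
  { intros v. unfold Cmod, Re, Im. simpl. f_equal. ring. }
  apply continuous_comp; [|apply continuous_sqrt].
  apply (continuous_plus (V := R_NormedModule)); apply (continuous_mult (K := R_AbsRing)); assumption.
Qed.

Lemma Cinv_alt (z : C) : (/ z)%C =
  (Re z / (Re z * Re z + Im z * Im z), - Im z / (Re z * Re z + Im z * Im z)).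
Proof. apply Ceq; unfold Cinv, Re, Im; simpl; f_equal; f_equal; ring. Qed.

Lemma Re_Im_neq_0 (z : C) : z <> 0 -> Re z * Re z + Im z * Im z <> 0.
Proof.
  intros Hz H. apply Hz. apply Cmod_eq_0. 
  generalize (Cmod_sqr z). rewrite H. intros.
  apply Rmult_integral in H0. tauto.
Qed.

Lemma ccont_inv f u : ccont f u -> f u <> 0 -> ccont (fun v => / f v)%C u.
Proof.
  intros [H1 H2] H0. apply Re_Im_neq_0 in H0.
  assert (Hd : continuous (fun v => / (Re (f v) * Re (f v) + Im (f v) * Im (f v))) u).
  { apply (continuous_comp (fun v => Re (f v) * Re (f v) + Im (f v) * Im (f v)) Rinv).
    - apply (continuous_plus (V := R_NormedModule)); apply (continuous_mult (K := R_AbsRing)); assumption.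
    - now apply continuous_Rinv. }
  split.
  - apply continuous_ext with (f := fun v => Re (f v) * / (Re (f v) * Re (f v) + Im (f v) * Im (f v))).
    { intros v; rewrite Cinv_alt; reflexivity. }
    apply (continuous_mult (K := R_AbsRing)); assumption.
  - apply continuous_ext with (f := fun v => (- Im (f v)) * / (Re (f v) * Re (f v) + Im (f v) * Im (f v))).
    { intros v; rewrite Cinv_alt; reflexivity. }
    apply (continuous_mult (K := R_AbsRing)); [apply (continuous_opp (V := R_NormedModule)) |]; assumption.
Qed.

Lemma ccont_div f g u : ccont f u -> ccont g u -> g u <> 0 -> ccont (fun v => f v / g v)%C u.
Proof. intros; apply ccont_mult; [|apply ccont_inv]; assumption. Qed.

Lemma ccont_ext_loc f g u : locally u (fun v => f v = g v) -> ccont f u -> ccont g u.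
Proof.
  intros H [H1 H2]; split; [eapply continuous_ext_loc; [|exact H1] | eapply continuous_ext_loc; [|exact H2]];
    (eapply filter_imp; [|exact H]; intros v ->; reflexivity).
Qed.

Lemma ccont_near f u (e : R) : 0 < e -> ccont f u -> locally u (fun v => Cmod (f v - f u) < e).
Proof.
  intros He H.
  assert (Hc : continuous (fun v => Cmod (f v - f u)) u).
  { apply ccont_Cmod, ccont_minus; [assumption | apply ccont_const]. }
  apply (Hc (fun x => x < e)).
  replace (f u - f u)%C with (RtoC 0) by ring. rewrite Cmod_0.
  now apply (open_lt e).
Qed.

Lemma ccont_intro f u :
  (forall e, 0 < e -> locally u (fun v => Cmod (f v - f u) < e)) -> ccont f u.
Proof.
  intros H; split; apply filterlim_locally; intros e;
    (eapply filter_imp; [|exact (H e (cond_pos e))]); intros v Hv;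
    (eapply Rle_lt_trans; [|exact Hv]).
  - apply (re_le_Cmod (f v - f u)).
  - apply (Rabs_Im_le_Cmod (f v - f u)).
Qed.

End Continuity.

Lemma ccont_id (u : C_UniformSpace) : ccont (fun v : C_UniformSpace => v) u.
Proof. split; [apply continuous_fst | apply continuous_snd]. Qed.

Section Derivatives.
Implicit Types (f g : R -> C) (t : R).

Lemma cderiv_cont f t d : cderiv f t d -> ccont f t.
Proof.
  intros [H1 H2]; split; apply continuous_derivable;
    eexists; eassumption.
Qed.

Lemma cderiv_eq f t d d' : cderiv f t d -> d = d' -> cderiv f t d'.
Proof. intros H <-; exact H. Qed.

Lemma cderiv_const (c : C) t : cderiv (fun _ => c) t 0.
Proof. split; simpl; apply (is_derive_const (V := R_NormedModule)). Qed.

Lemma cderiv_RtoC (h : R -> R) t d : is_derive h t d -> cderiv (fun s => RtoC (h s)) t (RtoC d).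
Proof. intros H; split; simpl; [exact H | apply (is_derive_const (V := R_NormedModule))]. Qed.

Lemma cderiv_id t : cderiv RtoC t 1.
Proof. apply cderiv_RtoC, (is_derive_id (K := R_AbsRing)). Qed.

Lemma cderiv_plus f g t df dg :
  cderiv f t df -> cderiv g t dg -> cderiv (fun s => f s + g s)%C t (df + dg)%C.
Proof. intros [? ?] [? ?]; split; simpl; apply (is_derive_plus (V := R_NormedModule)); assumption. Qed.

Lemma cderiv_opp f t df : cderiv f t df -> cderiv (fun s => - f s)%C t (- df)%C.
Proof. intros [? ?]; split; simpl; apply (is_derive_opp (V := R_NormedModule)); assumption. Qed.

Lemma cderiv_minus f g t df dg :
  cderiv f t df -> cderiv g t dg -> cderiv (fun s => f s - g s)%C t (df - dg)%C.
Proof. intros; apply cderiv_plus; [|apply cderiv_opp]; assumption. Qed.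

Lemma cderiv_mult f g t df dg :
  cderiv f t df -> cderiv g t dg ->
  cderiv (fun s => f s * g s)%C t (df * g t + f t * dg)%C.
Proof.
  intros [Hf1 Hf2] [Hg1 Hg2]; split.
  - eapply (is_derive_ext (fun s => Re (f s) * Re (g s) - Im (f s) * Im (g s))); [reflexivity|].
    replace (Re _) with ((Re df * Re (g t) + Re (f t) * Re dg) - (Im df * Im (g t) + Im (f t) * Im dg))
      by (unfold Re, Im; simpl; ring).
    apply (is_derive_minus (V := R_NormedModule));
      apply (is_derive_mult (K := R_AbsRing)); try assumption; apply Rmult_comm.
  - eapply (is_derive_ext (fun s => Re (f s) * Im (g s) + Im (f s) * Re (g s))); [reflexivity|].
    replace (Im _) with ((Re df * Im (g t) + Re (f t) * Im dg) + (Im df * Re (g t) + Im (f t) * Re dg))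
      by (unfold Re, Im; simpl; ring).
    apply (is_derive_plus (V := R_NormedModule));
      apply (is_derive_mult (K := R_AbsRing)); try assumption; apply Rmult_comm.
Qed.

Lemma cderiv_scal (c : C) f t df : cderiv f t df -> cderiv (fun s => c * f s)%C t (c * df)%C.
Proof.
  intros H. eapply cderiv_eq; [apply cderiv_mult; [apply cderiv_const | exact H]|]. cbv beta. ring.
Qed.

Lemma cderiv_Cexp f t df : cderiv f t df -> cderiv (fun s => Cexp (f s)) t (df * Cexp (f t))%C.
Proof.
  intros [Hf1 Hf2].
  (* Arbitrary real functions replace the two parts of [f], so that differentiation treats them as
     atoms. *)
  assert (E : forall p q : R -> R, forall dp dq, is_derive p t dp -> is_derive q t dq ->
    is_derive (fun s => exp (p s) * cos (q s)) t
      (dp * (exp (p t) * cos (q t)) - dq * (exp (p t) * sin (q t))) /\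
    is_derive (fun s => exp (p s) * sin (q s)) t
      (dp * (exp (p t) * sin (q t)) + dq * (exp (p t) * cos (q t)))).
  { intros p q dp dq Hp Hq.
    assert (Ep : Derive (fun x => p x) t = dp) by (apply is_derive_unique; exact Hp).
    assert (Eq : Derive (fun x => q x) t = dq) by (apply is_derive_unique; exact Hq).
    split; (auto_derive; [repeat split; eexists; eassumption|]);
    rewrite Ep, Eq; ring. }
  destruct (E _ _ _ _ Hf1 Hf2) as [E1 E2]. split.
  - exact E1.
  - replace (Im _) with (Re df * (exp (Re (f t)) * sin (Im (f t))) +
     Im df * (exp (Re (f t)) * cos (Im (f t)))) by (unfold Cexp, Re, Im; simpl; ring).
    exact E2.
Qed.

Lemma cderiv_inv f t df : cderiv f t df -> f t <> 0 ->
  cderiv (fun s => / f s)%C t (- df / (f t * f t))%C.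
Proof.
  intros [Hf1 Hf2] H0.
  apply Re_Im_neq_0 in H0.
  assert (E : forall p q : R -> R, forall dp dq, is_derive p t dp -> is_derive q t dq ->
    p t * p t + q t * q t <> 0 ->
    is_derive (fun s => p s / (p s * p s + q s * q s)) t
      (dp / (p t * p t + q t * q t) - p t * (2 * p t * dp + 2 * q t * dq) / (p t * p t + q t * q t) ^ 2) /\
    is_derive (fun s => - q s / (p s * p s + q s * q s)) t
      (- dq / (p t * p t + q t * q t) + q t * (2 * p t * dp + 2 * q t * dq) / (p t * p t + q t * q t) ^ 2)).
  { intros p q dp dq Hp Hq H.
    assert (Ep : Derive (fun x => p x) t = dp) by (apply is_derive_unique; exact Hp).
    assert (Eq : Derive (fun x => q x) t = dq) by (apply is_derive_unique; exact Hq).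
    split; (auto_derive; [repeat split; try (eexists; eassumption); assumption|]);
    rewrite Ep, Eq; field; assumption. }
  destruct (E _ _ _ _ Hf1 Hf2 H0) as [E1 E2].
  assert (E0 : (- df / (f t * f t))%C = (
    (Re df / (Re (f t) * Re (f t) + Im (f t) * Im (f t)) - Re (f t) * (2 * Re (f t) * Re df + 2 * Im (f t) * Im df) / (Re (f t) * Re (f t) + Im (f t) * Im (f t)) ^ 2),
     (- Im df / (Re (f t) * Re (f t) + Im (f t) * Im (f t)) + Im (f t) * (2 * Re (f t) * Re df + 2 * Im (f t) * Im df) / (Re (f t) * Re (f t) + Im (f t) * Im (f t)) ^ 2))).
  { unfold Cdiv. rewrite Cinv_alt.
    destruct df as [u v]; destruct (f t) as [a b]; unfold Re, Im in *; simpl in *.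
    assert ((a * a - b * b) * (a * a - b * b) + (a * b + b * a) * (a * b + b * a) <> 0).
    { replace (_ + _) with ((a*a+b*b)*(a*a+b*b)) by ring.
      intros Hz; apply Rmult_integral in Hz; tauto. }
    apply Ceq; unfold Re, Im; simpl; field; tauto. }
  rewrite E0. split.
  - apply (is_derive_ext (fun s => Re (f s) / (Re (f s) * Re (f s) + Im (f s) * Im (f s)))); [|exact E1].
    intros s; rewrite (Cinv_alt (f s)); reflexivity.
  - apply (is_derive_ext (fun s => - Im (f s) / (Re (f s) * Re (f s) + Im (f s) * Im (f s)))); [|exact E2].
    intros s; rewrite (Cinv_alt (f s)); reflexivity.
Qed.

Lemma cderiv_pow f t df (n : nat) : cderiv f t df ->
  cderiv (fun s => f s ^ n)%C t (RtoC (INR n) * f t ^ pred n * df)%C.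
Proof.
  intros H; induction n as [|n IH].
  - simpl. eapply cderiv_eq; [apply cderiv_const|]. ring.
  - eapply cderiv_eq; [apply (cderiv_mult f (fun s => f s ^ n)%C); [exact H | exact IH]|].
    destruct n; [simpl; ring|]. rewrite (S_INR (S n)), RtoC_plus. simpl pred.
    rewrite !Cpow_S. ring.
Qed.

End Derivatives.

(* Projecting [f] on the direction of [f 1 - f 0] reduces the claim to the
   monotonicity of a real function. *)
Lemma Cmod_increment_le (f : R -> C) (df : R -> C) (g dg : R -> R) :
  (forall t, 0 <= t <= 1 -> cderiv f t (df t)) ->
  (forall t, 0 <= t <= 1 -> is_derive g t (dg t)) ->
  (forall t, 0 <= t <= 1 -> Cmod (df t) <= dg t) ->
  Cmod (f 1 - f 0) <= g 1 - g 0.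
Proof.
  intros Hf Hg Hle.
  set (D := (f 1 - f 0)%C).
  set (h := fun t => Cmod D * g t - (Re D * Re (f t) + Im D * Im (f t))).
  assert (Hh : forall t, 0 <= t <= 1 ->
    is_derive h t (Cmod D * dg t - (Re D * Re (df t) + Im D * Im (df t)))).
  { intros t Ht. destruct (Hf t Ht) as [H1 H2].
    apply (is_derive_minus (V := R_NormedModule)).
    - apply is_derive_scal, Hg, Ht.
    - apply (is_derive_plus (V := R_NormedModule)); apply is_derive_scal; assumption. }
  destruct (MVT_gen h 0 1 (fun t => Cmod D * dg t - (Re D * Re (df t) + Im D * Im (df t))))
    as [c [Hc E]].
  { intros t Ht. rewrite Rmin_left, Rmax_right in Ht by lra. apply Hh; lra. }
  { intros t Ht. rewrite Rmin_left, Rmax_right in Ht by lra.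
    eapply continuity_pt_derivable, Hh; lra. }
  rewrite Rmin_left, Rmax_right in Hc by lra.
  pose proof (Hle c Hc) as Hlec.
  assert (Hp : Re D * Re (df c) + Im D * Im (df c) <= Cmod D * Cmod (df c)).
  { eapply Rle_trans; [apply Rle_abs|].
    apply Rsqr_incr_0_var; [|apply Rmult_le_pos; apply Cmod_ge_0].
    unfold Rsqr. rewrite <- Rabs_mult, Rabs_right
      by (apply Rle_ge; fold (Rsqr (Re D * Re (df c) + Im D * Im (df c))); apply Rle_0_sqr).
    replace (Cmod D * Cmod (df c) * (Cmod D * Cmod (df c)))
      with ((Cmod D * Cmod D) * (Cmod (df c) * Cmod (df c))) by ring.
    rewrite !Cmod_sqr.
    generalize (Rle_0_sqr (Re D * Im (df c) - Im D * Re (df c))). unfold Rsqr. lra. }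
  assert (ED : Re D * Re (f 1) + Im D * Im (f 1) - (Re D * Re (f 0) + Im D * Im (f 0))
    = Cmod D * Cmod D).
  { rewrite Cmod_sqr. unfold D at 5 6 7 8. unfold Cminus, Cplus, Copp, Re, Im. simpl. ring. }
  pose proof (Cmod_ge_0 D) as HD.
  unfold h in E.
  assert (0 <= Cmod D * (g 1 - g 0) - Cmod D * Cmod D) by nra.
  (* If the increment vanishes, [Cmod D] cannot be cancelled; the claim is then that [g] does not
     decrease, which follows from [dg >= 0]. *)
  destruct (Req_dec (Cmod D) 0) as [E0|E0].
  - rewrite E0.
    assert (Hm : exists c, 0 <= c <= 1 /\ g 1 - g 0 = dg c * (1 - 0)).
    { destruct (MVT_gen g 0 1 dg) as [c' [Hc' E']].
      { intros t Ht. rewrite Rmin_left, Rmax_right in Ht by lra. apply Hg; lra. }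
      { intros t Ht. rewrite Rmin_left, Rmax_right in Ht by lra.
        eapply continuity_pt_derivable, Hg; lra. }
      rewrite Rmin_left, Rmax_right in Hc' by lra. exists c'. split; assumption. }
    destruct Hm as [c' [Hc' ->]].
    assert (0 <= dg c').
    { eapply Rle_trans; [apply Cmod_ge_0 | apply (Hle c' Hc')]. }
    lra.
  - apply Rmult_le_reg_l with (Cmod D); lra.
Qed.

Lemma Cmod_increment_le_const (f df : R -> C) (B : R) :
  (forall t, 0 <= t <= 1 -> cderiv f t (df t)) ->
  (forall t, 0 <= t <= 1 -> Cmod (df t) <= B) ->
  Cmod (f 1 - f 0) <= B.
Proof.
  intros Hf HB.
  replace B with (B * 1 - B * 0) by ring.
  apply (Cmod_increment_le f df (fun t => B * t) (fun _ => B)); try assumption.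
  intros t _. auto_derive; [trivial | ring].
Qed.

Lemma cderiv_ray (w : C) (t : R) : cderiv (fun s => RtoC s * w)%C t w.
Proof.
  eapply cderiv_eq; [apply cderiv_mult; [apply cderiv_id | apply cderiv_const]|].
  cbv beta; ring.
Qed.

Lemma exp_ray_le (w : C) (t M : R) : 0 <= t <= 1 -> Re w <= M -> 0 <= M ->
  Cmod (Cexp (RtoC t * w)) <= exp M.
Proof.
  intros Ht Hw HM. rewrite Cmod_Cexp, re_scal_l. 
  destruct (Rle_lt_or_eq_dec (t * Re w) M) as [H|H]; [nra| |rewrite H; lra].
  now apply Rlt_le, exp_increasing.
Qed.

(** ** Taylor remainders of the exponential *)

(** The exponential factor depends on a bound for [Re w], not for [Cmod w]: on the imaginary axis it
    is 1, and in Laplace's method only the real part of the exponent is under control. *)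
Lemma Cexp_remainder_1 (w : C) (M : R) : Re w <= M -> 0 <= M ->
  Cmod (Cexp w - 1) <= Cmod w * exp M.
Proof.
  intros Hw HM.
  replace (Cexp w - 1)%C with (Cexp (RtoC 1 * w) - Cexp (RtoC 0 * w))%C
    by (rewrite Cmult_0_l, Cexp_0, Cmult_1_l; reflexivity).
  apply (Cmod_increment_le_const (fun t => Cexp (RtoC t * w)) (fun t => w * Cexp (RtoC t * w))%C).
  - intros t _. apply cderiv_Cexp, cderiv_ray.
  - intros t Ht. rewrite Cmod_mult. apply Rmult_le_compat_l; [apply Cmod_ge_0|].
    now apply exp_ray_le.
Qed.

(** Along the ray [t w] the derivative of a Taylor remainder is [w] times the preceding remainder,
    so each bound follows from the last by the mean value inequality. The factorials are given
    up. *)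
Lemma remainder_step (f g : R -> C) (w : C) (B : R) (k : nat) :
  (forall t, 0 <= t <= 1 -> cderiv f t (w * g t)%C) ->
  (forall t, 0 <= t <= 1 -> Cmod (g t) <= Cmod (RtoC t * w) ^ k * B) ->
  0 <= B ->
  Cmod (f 1 - f 0) <= Cmod w ^ S k * B.
Proof.
  intros H1 H2 HB.
  apply (Cmod_increment_le_const f (fun t => w * g t)%C); [exact H1|].
  intros t Ht. rewrite Cmod_mult. simpl. rewrite Rmult_assoc.
  apply Rmult_le_compat_l; [apply Cmod_ge_0|].
  eapply Rle_trans; [apply H2, Ht|].
  apply Rmult_le_compat_r; [exact HB|].
  apply pow_incr. split; [apply Cmod_ge_0|].
  rewrite Cmod_mult, Cmod_RtoC_pos by lra.
  generalize (Cmod_ge_0 w); nra.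
Qed.

Lemma Re_ray_le (w : C) (t M : R) : 0 <= t <= 1 -> Re w <= M -> 0 <= M -> Re (RtoC t * w) <= M.
Proof. intros. rewrite re_scal_l. nra. Qed.

Lemma Cexp_remainder_2 (w : C) (M : R) : Re w <= M -> 0 <= M ->
  Cmod (Cexp w - 1 - w) <= Cmod w ^ 2 * exp M.
Proof.
  intros Hw HM.
  pose (f := fun t => (Cexp (RtoC t * w) - 1 - RtoC t * w)%C).
  replace (Cexp w - 1 - w)%C with (f 1 - f 0)%C
    by (unfold f; rewrite !Cmult_0_l, Cexp_0, Cmult_1_l; ring).
  apply (remainder_step f (fun t => Cexp (RtoC t * w) - 1)%C).
  - intros t _. unfold f. eapply cderiv_eq;
      [apply cderiv_minus; [apply cderiv_minus; [apply cderiv_Cexp, cderiv_ray | apply cderiv_const] | apply cderiv_ray]|].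
    cbv beta; ring.
  - intros t Ht. rewrite pow_1. apply Cexp_remainder_1; [now apply Re_ray_le | exact HM].
  - apply Rlt_le, exp_pos.
Qed.

Lemma Cexp_remainder_3 (w : C) (M : R) : Re w <= M -> 0 <= M ->
  Cmod (Cexp w - 1 - w - w * w / 2) <= Cmod w ^ 3 * exp M.
Proof.
  intros Hw HM.
  pose (f := fun t => (Cexp (RtoC t * w) - 1 - RtoC t * w - (RtoC t * w) * (RtoC t * w) / 2)%C).
  replace (Cexp w - 1 - w - w * w / 2)%C with (f 1 - f 0)%C
    by (unfold f; rewrite !Cmult_0_l, Cexp_0, Cmult_1_l; unfold Cdiv; ring).
  apply (remainder_step f (fun t => Cexp (RtoC t * w) - 1 - RtoC t * w)%C).
  - intros t _. unfold f, Cdiv. eapply cderiv_eq.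
    + apply cderiv_minus; [apply cderiv_minus; [apply cderiv_minus; [apply cderiv_Cexp, cderiv_ray | apply cderiv_const] | apply cderiv_ray]|].
      apply cderiv_mult; [apply cderiv_mult; apply cderiv_ray | apply cderiv_const].
    + cbv beta. field. 
  - intros t Ht. apply Cexp_remainder_2; [now apply Re_ray_le | exact HM].
  - apply Rlt_le, exp_pos.
Qed.

Lemma Cexp_remainder_4 (w : C) (M : R) : Re w <= M -> 0 <= M ->
  Cmod (Cexp w - 1 - w - w * w / 2 - w * w * w / 6) <= Cmod w ^ 4 * exp M.
Proof.
  intros Hw HM.
  pose (f := fun t => (Cexp (RtoC t * w) - 1 - RtoC t * w - (RtoC t * w) * (RtoC t * w) / 2
    - (RtoC t * w) * (RtoC t * w) * (RtoC t * w) / 6)%C).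
  replace (Cexp w - 1 - w - w * w / 2 - w * w * w / 6)%C with (f 1 - f 0)%C
    by (unfold f; rewrite !Cmult_0_l, Cexp_0, Cmult_1_l; unfold Cdiv; ring).
  apply (remainder_step f (fun t => Cexp (RtoC t * w) - 1 - RtoC t * w - (RtoC t * w) * (RtoC t * w) / 2)%C).
  - intros t _. unfold f, Cdiv. eapply cderiv_eq.
    + apply cderiv_minus; [apply cderiv_minus; [apply cderiv_minus; [apply cderiv_minus; [apply cderiv_Cexp, cderiv_ray | apply cderiv_const] | apply cderiv_ray]|]|].
      * apply cderiv_mult; [apply cderiv_mult; apply cderiv_ray | apply cderiv_const].
      * apply cderiv_mult; [apply cderiv_mult; [apply cderiv_mult|]; apply cderiv_ray | apply cderiv_const].
    + cbv beta. field. 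
  - intros t Ht. apply Cexp_remainder_3; [now apply Re_ray_le | exact HM].
  - apply Rlt_le, exp_pos.
Qed.

(** * The principal logarithm and square root *)

Notation slit := (C_minus_ray 0).

(** Three open half-planes cover the slit plane, and on each of them [Carg] is an arctangent up to a
    constant; continuity and derivatives of [Clog] are checked on each. *)
Lemma slit_cases (z : C) : slit z -> 0 < Re z \/ 0 < Im z \/ Im z < 0.
Proof.
  intros H. destruct (Rtotal_order (Im z) 0) as [h|[h|h]]; auto.
  left. destruct (Rlt_dec 0 (Re z)); auto. exfalso; apply H; split; lra.
Qed.

Lemma slit_Re (z : C) : 0 < Re z -> slit z.
Proof. intros H [_ h]; lra. Qed.

Lemma slit_Im (z : C) : Im z <> 0 -> slit z.
Proof. intros H [h _]; lra. Qed.

Lemma slit_neq_0 (z : C) : slit z -> z <> 0.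
Proof. intros H ->. apply H. simpl; split; lra. Qed.

Lemma Re_div_Cmod_bounds (z : C) : z <> 0 -> -1 <= Re z / Cmod z <= 1.
Proof.
  intros Hz. apply Cmod_gt_0 in Hz. apply Rabs_le_between.
  rewrite Rabs_div, (Rabs_right (Cmod z)) by lra.
  apply Rle_div_l; [lra|]. generalize (re_le_Cmod z); lra.
Qed.

Lemma Clog_Cexp (w : C) : - PI < Im w <= PI -> Clog (Cexp w) = w.
Proof.
  intros Hw. unfold Clog. apply Ceq; simpl.
  - rewrite Cmod_Cexp. apply ln_exp.
  - unfold Carg. rewrite Cmod_Cexp. pose proof (exp_pos (Re w)).
    assert (E : Re (Cexp w) / exp (Re w) = cos (Im w)).
    { unfold Cexp. simpl. field. lra. }
    rewrite E. unfold Cexp at 1; simpl.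
    destruct (Rle_dec 0 (Im w)) as [h|h].
    + assert (0 <= sin (Im w)) by (apply sin_ge_0; lra).
      destruct (Rle_dec 0 _) as [h'|h']; [apply acos_cos; lra|].
      exfalso; apply h'; nra.
    + assert (sin (Im w) < 0) by (apply sin_lt_0_var; lra).
      destruct (Rle_dec 0 _) as [h'|h']; [exfalso; nra|].
      rewrite <- cos_neg, acos_cos by lra. ring.
Qed.

Lemma Carg_bounds (z : C) : z <> 0 -> - PI < Carg z <= PI.
Proof.
  intros Hz. pose proof (Re_div_Cmod_bounds z Hz) as Hb.
  pose proof (acos_bound (Re z / Cmod z)) as Ha. unfold Carg.
  destruct (Rle_dec 0 (Im z)) as [h|h]; split; try lra.
  - generalize PI_RGT_0; lra.
  - destruct (Req_dec (acos (Re z / Cmod z)) PI) as [E|E]; [|lra].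
    exfalso. assert (E' : cos (acos (Re z / Cmod z)) = -1) by (rewrite E; apply cos_PI).
    rewrite cos_acos in E' by assumption. apply Cmod_gt_0 in Hz.
    assert (Re z = - Cmod z).
    { replace (Re z) with (Re z / Cmod z * Cmod z) by (field; lra). rewrite E'; ring. }
    pose proof (Cmod_sqr z). nra.
Qed.

Lemma Cexp_Clog (z : C) : z <> 0 -> Cexp (Clog z) = z.
Proof.
  intros Hz. pose proof (Re_div_Cmod_bounds z Hz) as Hb.
  pose proof (proj1 (Cmod_gt_0 z) Hz) as H0.
  assert (Hs : sqrt (1 - Rsqr (Re z / Cmod z)) = Rabs (Im z) / Cmod z).
  { rewrite <- (sqrt_Rsqr (Rabs (Im z) / Cmod z))
      by (apply Rle_mult_inv_pos; [apply Rabs_pos | lra]).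
    f_equal. unfold Rsqr. apply Rmult_eq_reg_r with (Cmod z * Cmod z); [|nra].
    replace (Rabs (Im z) / Cmod z * (Rabs (Im z) / Cmod z) * (Cmod z * Cmod z))
      with (Rabs (Im z) * Rabs (Im z)) by (field; lra).
    rewrite <- Rabs_mult, Rabs_right by (apply Rle_ge, (Rle_0_sqr (Im z))).
    replace ((1 - Re z / Cmod z * (Re z / Cmod z)) * (Cmod z * Cmod z))
      with (Cmod z * Cmod z - Re z * Re z) by (field; lra).
    rewrite Cmod_sqr. ring. }
  unfold Clog, Cexp; simpl. rewrite exp_ln by exact H0.
  assert (cos (Carg z) = Re z / Cmod z /\ sin (Carg z) = Im z / Cmod z) as [-> ->].
  { unfold Carg. destruct (Rle_dec 0 (Im z)) as [h|h].
    - rewrite cos_acos, sin_acos, Hs, Rabs_right by lra. auto.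
    - rewrite cos_neg, sin_neg, cos_acos, sin_acos, Hs, Rabs_left by lra. 
      split; [reflexivity | field; lra]. }
  apply Ceq; simpl; field; lra.
Qed.

Lemma Carg_slit_bounds (z : C) : slit z -> - PI < Carg z < PI.
Proof.
  intros Hz. pose proof (slit_neq_0 z Hz) as H0. pose proof (Carg_bounds z H0) as [h1 h2].
  split; [exact h1|]. destruct h2 as [h2|h2]; [exact h2|exfalso].
  apply Hz. rewrite <- (Cexp_Clog z H0). unfold Cexp, Clog; simpl.
  rewrite h2, sin_PI, cos_PI. pose proof (exp_pos (ln (Cmod z))). split; [ring|lra].
Qed.

Lemma Im_Clog (z : C) : Im (Clog z) = Carg z.
Proof. reflexivity. Qed.

Lemma Carg_eq (z : C) (a : R) : z <> 0 -> - PI < a <= PI ->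
  cos a * Cmod z = Re z -> sin a * Cmod z = Im z -> Carg z = a.
Proof.
  intros Hz Ha Hc Hs. rewrite <- Im_Clog.
  apply Cmod_gt_0 in Hz.
  replace z with (Cexp (ln (Cmod z), a)).
  - now rewrite Clog_Cexp.
  - apply Ceq; unfold Cexp; simpl; rewrite exp_ln by exact Hz; lra.
Qed.

Lemma Carg_Re_pos (z : C) : 0 < Re z -> Carg z = atan (Im z / Re z).
Proof.
  intros H. pose proof (slit_neq_0 z (slit_Re z H)) as H0.
  pose proof (atan_bound (Im z / Re z)). generalize PI_RGT_0; intros.
  assert (E : Cmod z = Re z * sqrt (1 + Rsqr (Im z / Re z))).
  { rewrite <- (sqrt_Rsqr (Re z)) at 1 by lra. rewrite <- sqrt_mult_alt by apply Rle_0_sqr.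
    unfold Cmod. f_equal. unfold Rsqr, Re, Im. unfold Re in H. field. lra. }
  assert (0 < sqrt (1 + Rsqr (Im z / Re z))).
  { apply sqrt_lt_R0. generalize (Rle_0_sqr (Im z / Re z)); lra. }
  apply Carg_eq; [exact H0 | lra | rewrite cos_atan, E; field; lra | rewrite sin_atan, E; field; lra].
Qed.

Lemma Carg_Im_pos (z : C) : 0 < Im z -> Carg z = PI / 2 - atan (Re z / Im z).
Proof.
  intros H. assert (Hs : slit z) by (apply slit_Im; lra). pose proof (slit_neq_0 z Hs) as H0.
  pose proof (atan_bound (Re z / Im z)). generalize PI_RGT_0; intros.
  assert (E : Cmod z = Im z * sqrt (1 + Rsqr (Re z / Im z))).
  { rewrite <- (sqrt_Rsqr (Im z)) at 1 by lra. rewrite <- sqrt_mult_alt by apply Rle_0_sqr.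
    unfold Cmod. f_equal. unfold Rsqr, Re, Im. unfold Im in H. field. lra. }
  assert (0 < sqrt (1 + Rsqr (Re z / Im z))).
  { apply sqrt_lt_R0. generalize (Rle_0_sqr (Re z / Im z)); lra. }
  apply Carg_eq; [exact H0 | lra | |].
  - rewrite cos_shift, sin_atan, E; field; lra.
  - rewrite sin_shift, cos_atan, E; field; lra.
Qed.

Lemma Carg_Im_neg (z : C) : Im z < 0 -> Carg z = - (PI / 2) - atan (Re z / Im z).
Proof.
  intros H. assert (Hs : slit z) by (apply slit_Im; lra). pose proof (slit_neq_0 z Hs) as H0.
  pose proof (atan_bound (Re z / Im z)). generalize PI_RGT_0; intros.
  assert (E : Cmod z = - Im z * sqrt (1 + Rsqr (Re z / Im z))).
  { rewrite <- (sqrt_Rsqr (- Im z)) at 1 by lra. rewrite <- sqrt_mult_alt by apply Rle_0_sqr.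
    unfold Cmod. f_equal. unfold Rsqr, Re, Im. unfold Im in H. field. lra. }
  assert (0 < sqrt (1 + Rsqr (Re z / Im z))).
  { apply sqrt_lt_R0. generalize (Rle_0_sqr (Re z / Im z)); lra. }
  replace (- (PI / 2) - atan (Re z / Im z)) with (- (PI / 2 + atan (Re z / Im z))) by ring.
  apply Carg_eq; [exact H0 | lra | |].
  - rewrite cos_neg, cos_plus, cos_PI2, sin_PI2, sin_atan, E; field; lra.
  - rewrite sin_neg, sin_plus, cos_PI2, sin_PI2, cos_atan, E; field; lra.
Qed.

Lemma continuous_atan_div {U : UniformSpace} (f g : U -> R) (u : U) :
  continuous f u -> continuous g u -> g u <> 0 -> continuous (fun v => atan (f v / g v)) u.
Proof.
  intros Hf Hg H0. apply (continuous_comp (fun v => f v / g v) atan).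
  - apply (continuous_mult (K := R_AbsRing)); [exact Hf|].
    apply (continuous_comp g Rinv); [exact Hg | now apply continuous_Rinv].
  - apply continuous_atan.
Qed.

Lemma locally_pos {U : UniformSpace} (f : U -> R) (u : U) :
  continuous f u -> 0 < f u -> locally u (fun v => 0 < f v).
Proof. intros H H0. apply (H (fun x => 0 < x)). now apply (open_gt 0). Qed.

Lemma locally_neg {U : UniformSpace} (f : U -> R) (u : U) :
  continuous f u -> f u < 0 -> locally u (fun v => f v < 0).
Proof. intros H H0. apply (H (fun x => x < 0)). now apply (open_lt 0). Qed.

Lemma ccont_Clog {U : UniformSpace} (f : U -> C) (u : U) :
  ccont f u -> slit (f u) -> ccont (fun v => Clog (f v)) u.
Proof.
  intros Hf Hs. split; simpl.
  - apply (continuous_comp (fun v => Cmod (f v)) ln); [now apply ccont_Cmod|].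
    apply continuous_derivable.
    apply slit_neq_0, Cmod_gt_0 in Hs. eexists; now apply is_derive_ln.
  - destruct Hf as [H1 H2].
    destruct (slit_cases _ Hs) as [h|[h|h]].
    + apply (continuous_ext_loc _ (fun v => atan (Im (f v) / Re (f v)))).
      * eapply filter_imp; [|exact (locally_pos _ _ H1 h)]. intros v Hv; now rewrite Carg_Re_pos.
      * apply continuous_atan_div; try assumption; lra.
    + apply (continuous_ext_loc _ (fun v => PI / 2 - atan (Re (f v) / Im (f v)))).
      * eapply filter_imp; [|exact (locally_pos _ _ H2 h)]. intros v Hv; now rewrite Carg_Im_pos.
      * apply (continuous_minus (V := R_NormedModule)); [apply continuous_const|].
        apply continuous_atan_div; try assumption; lra.
    + apply (continuous_ext_loc _ (fun v => - (PI / 2) - atan (Re (f v) / Im (f v)))).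
      * eapply filter_imp; [|exact (locally_neg _ _ H2 h)]. intros v Hv; now rewrite Carg_Im_neg.
      * apply (continuous_minus (V := R_NormedModule)); [apply continuous_const|].
        apply continuous_atan_div; try assumption; lra.
Qed.

Lemma is_derive_atan_div (p q : R -> R) (t dp dq : R) :
  is_derive p t dp -> is_derive q t dq -> q t <> 0 ->
  is_derive (fun s => atan (p s / q s)) t ((dp * q t - p t * dq) / (p t * p t + q t * q t)).
Proof.
  intros Hp Hq H.
  assert (Ep : Derive (fun x => p x) t = dp) by (apply is_derive_unique; exact Hp).
  assert (Eq : Derive (fun x => q x) t = dq) by (apply is_derive_unique; exact Hq).
  assert (0 < q t * q t) by nra. pose proof (Rle_0_sqr (p t)) as H1. unfold Rsqr in H1.
  auto_derive; [repeat split; try (eexists; eassumption); assumption|].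
  rewrite Ep, Eq. field. repeat split; try lra; try exact H; try nra.
Qed.

Lemma cderiv_Clog (f : R -> C) (t : R) (df : C) :
  cderiv f t df -> slit (f t) -> cderiv (fun s => Clog (f s)) t (df / f t)%C.
Proof.
  intros Hf Hs. pose proof (cderiv_cont _ _ _ Hf) as [Hc1 Hc2].
  destruct Hf as [H1 H2]. pose proof (slit_neq_0 _ Hs) as H0.
  pose proof (Re_Im_neq_0 _ H0) as Hn.
  assert (E : (df / f t)%C =
    ((Re df * Re (f t) + Im df * Im (f t)) / (Re (f t) * Re (f t) + Im (f t) * Im (f t)),
     (Im df * Re (f t) - Re df * Im (f t)) / (Re (f t) * Re (f t) + Im (f t) * Im (f t)))).
  { unfold Cdiv. rewrite Cinv_alt. apply Ceq; unfold Re, Im in *; simpl; field; exact Hn. }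
  rewrite E. split; simpl.
  - assert (F : forall p q : R -> R, forall dp dq, is_derive p t dp -> is_derive q t dq ->
      0 < p t * p t + q t * q t ->
      is_derive (fun s => ln (sqrt (p s * p s + q s * q s))) t
        ((dp * p t + dq * q t) / (p t * p t + q t * q t))).
    { intros p q dp dq Hp Hq H.
      assert (Ep : Derive (fun x => p x) t = dp) by (apply is_derive_unique; exact Hp).
      assert (Eq : Derive (fun x => q x) t = dq) by (apply is_derive_unique; exact Hq).
      pose proof (sqrt_lt_R0 _ H) as Hq0. pose proof (sqrt_sqrt _ (Rlt_le _ _ H)) as Hq1.
      auto_derive; [repeat split; try (eexists; eassumption); assumption|].
      rewrite Ep, Eq. 
      set (S := sqrt _) in *. rewrite <- Hq1. field. lra. }
    apply (is_derive_ext (fun s => ln (sqrt (Re (f s) * Re (f s) + Im (f s) * Im (f s))))).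
    { intros s. unfold Cmod. do 2 f_equal. unfold Re, Im. ring. }
    apply F; try assumption.
    generalize (Rle_0_sqr (Re (f t))) (Rle_0_sqr (Im (f t))); unfold Rsqr; lra.
  - assert (N : Im (f t) * Im (f t) + Re (f t) * Re (f t) <> 0) by lra.
    destruct (slit_cases _ Hs) as [h|[h|h]].
    + apply (is_derive_ext_loc (fun v => atan (Im (f v) / Re (f v)))).
      * eapply filter_imp; [|exact (locally_pos _ _ Hc1 h)]. intros v Hv; now rewrite Carg_Re_pos.
      * replace (_ / _) with ((Im df * Re (f t) - Im (f t) * Re df) / (Im (f t) * Im (f t) + Re (f t) * Re (f t)))
          by (field; repeat split; assumption).
        apply (is_derive_atan_div (fun v => Im (f v)) (fun v => Re (f v))); try assumption; lra.
    + apply (is_derive_ext_loc (fun v => PI / 2 - atan (Re (f v) / Im (f v)))).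
      * eapply filter_imp; [|exact (locally_pos _ _ Hc2 h)]. intros v Hv; now rewrite Carg_Im_pos.
      * match goal with |- is_derive _ _ ?d => replace d with (0 - (Re df * Im (f t) - Re (f t) * Im df) / (Re (f t) * Re (f t) + Im (f t) * Im (f t)))
          by (field; assumption) end.
        apply (is_derive_minus (V := R_NormedModule)); [apply (is_derive_const (V := R_NormedModule))|].
        apply (is_derive_atan_div (fun v => Re (f v)) (fun v => Im (f v))); try assumption; lra.
    + apply (is_derive_ext_loc (fun v => - (PI / 2) - atan (Re (f v) / Im (f v)))).
      * eapply filter_imp; [|exact (locally_neg _ _ Hc2 h)]. intros v Hv; now rewrite Carg_Im_neg.
      * match goal with |- is_derive _ _ ?d => replace d with (0 - (Re df * Im (f t) - Re (f t) * Im df) / (Re (f t) * Re (f t) + Im (f t) * Im (f t)))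
          by (field; assumption) end.
        apply (is_derive_minus (V := R_NormedModule)); [apply (is_derive_const (V := R_NormedModule))|].
        apply (is_derive_atan_div (fun v => Re (f v)) (fun v => Im (f v))); try assumption; lra.
Qed.

Lemma Re_1_plus (u : C) : 1 - Cmod u <= Re (1 + u).
Proof. rewrite re_plus. generalize (re_le_Cmod u) (Rabs_le_between (Re u) (Cmod u)). simpl. lra. Qed.

Lemma Clog_1_plus (u : C) : Cmod u <= 1 / 2 ->
  Cmod (Clog (1 + u) - (u - u * u / 2 + u * u * u / 3)) <= Cmod u ^ 4 * 2.
Proof.
  intros Hu.
  assert (Hr : forall t, 0 <= t <= 1 -> 1 / 2 <= Re (1 + RtoC t * u)).
  { intros t Ht. eapply Rle_trans; [|apply Re_1_plus].
    rewrite Cmod_mult, Cmod_RtoC_pos by lra. generalize (Cmod_ge_0 u); nra. }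
  pose (f := fun t => (Clog (1 + RtoC t * u) - (RtoC t * u - (RtoC t * u) * (RtoC t * u) / 2
    + (RtoC t * u) * (RtoC t * u) * (RtoC t * u) / 3))%C).
  assert (E0 : Clog 1 = 0).
  { rewrite <- Cexp_0, Clog_Cexp; [reflexivity|]. simpl. generalize PI_RGT_0; lra. }
  replace (Clog (1 + u) - (u - u * u / 2 + u * u * u / 3))%C with (f 1 - f 0)%C
    by (unfold f; rewrite !Cmult_0_l, Cplus_0_r, E0, Cmult_1_l; unfold Cdiv; ring).
  (* The difference of [1 / (1 + w)] and [1 - w + w^2] is exactly [- w^3 / (1 + w)], and
     [|1 + w| >= 1/2] gives the factor 2. *)
  apply (remainder_step f (fun t => - ((RtoC t * u) ^ 3 / (1 + RtoC t * u)))%C).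
  - intros t Ht. specialize (Hr t Ht).
    assert (Hs : slit (1 + RtoC t * u)) by (apply slit_Re; lra).
    unfold f, Cdiv. eapply cderiv_eq.
    + apply cderiv_minus.
      * apply cderiv_Clog; [|exact Hs]. apply cderiv_plus; [apply cderiv_const | apply cderiv_ray].
      * apply cderiv_plus; [apply cderiv_minus; [apply cderiv_ray|]|];
         (apply cderiv_mult; [|apply cderiv_const]).
        -- apply cderiv_mult; apply cderiv_ray.
        -- apply cderiv_mult; [apply cderiv_mult|]; apply cderiv_ray.
    + cbv beta. apply slit_neq_0 in Hs. simpl. field. exact Hs.
  - intros t Ht. specialize (Hr t Ht). rewrite Cmod_opp, Cmod_div, Cmod_pow
      by (apply slit_neq_0, slit_Re; lra).
    apply Rmult_le_compat_l; [apply pow_le, Cmod_ge_0|].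
    apply Rle_trans with (/ (1 / 2)); [|lra].
    apply Rinv_le_contravar; [lra|]. generalize (Re_le_Cmod (1 + RtoC t * u)); lra.
  - lra.
Qed.

Lemma Carg_Re_pos_bound (z : C) : 0 < Re z -> - (PI / 2) < Carg z < PI / 2.
Proof. intros H. rewrite Carg_Re_pos by exact H. generalize (atan_bound (Im z / Re z)); lra. Qed.

Lemma Clog_RtoC (x : R) : 0 < x -> Clog (RtoC x) = RtoC (ln x).
Proof.
  intros H. rewrite <- (exp_ln x) at 1 by exact H. rewrite <- Cexp_RtoC. apply Clog_Cexp.
  simpl. generalize PI_RGT_0; lra.
Qed.

Lemma Csqrt_sqr (z : C) : z <> 0 -> (Csqrt z * Csqrt z)%C = z.
Proof.
  intros H. unfold Csqrt. rewrite <- Cexp_plus.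
  replace (Clog z / 2 + Clog z / 2)%C with (Clog z) by field. now apply Cexp_Clog.
Qed.

Lemma Csqrt_inv (z : C) : slit z -> Csqrt (/ z) = (/ Csqrt z)%C.
Proof.
  intros H. pose proof (slit_neq_0 z H) as H0. unfold Csqrt. rewrite <- Cexp_opp. f_equal.
  replace (Clog (/ z)) with (- Clog z)%C; [field|].
  rewrite <- (Cexp_Clog z H0) at 2. rewrite <- Cexp_opp, Clog_Cexp; [reflexivity|].
  pose proof (Carg_slit_bounds z H). change (Im (- Clog z)) with (- Carg z). lra.
Qed.

Lemma Csqrt_RtoC (x : R) : 0 < x -> Csqrt (RtoC x) = RtoC (sqrt x).
Proof.
  intros H. unfold Csqrt. rewrite Clog_RtoC by exact H.
  replace (RtoC (ln x) / 2)%C with (RtoC (/ 2 * ln x)) by (rewrite RtoC_mult, RtoC_inv by lra; field).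
  rewrite Cexp_RtoC. f_equal. rewrite <- Rpower_sqrt by exact H. reflexivity.
Qed.

Lemma ccont_Csqrt {U : UniformSpace} (f : U -> C) (u : U) :
  ccont f u -> slit (f u) -> ccont (fun v => Csqrt (f v)) u.
Proof.
  intros H1 H2. unfold Csqrt. apply ccont_Cexp, ccont_mult; [now apply ccont_Clog | apply ccont_const].
Qed.

(** * Integrals of complex-valued functions of a real variable *)

Definition CInt (f : R -> C) (a b : R) : C :=
  (RInt (fun t => Re (f t)) a b, RInt (fun t => Im (f t)) a b).

Definition ccont_on (f : R -> C) (a b : R) : Prop := forall t, a <= t <= b -> ccont f t.

Section Integral.
Variables (a b : R).
Hypothesis Hab : a <= b.
Implicit Types f g : R -> C.

Lemma ex_RInt_cont_on (h : R -> R) : (forall t, a <= t <= b -> continuous h t) -> ex_RInt h a b.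
Proof.
  intros H. apply (ex_RInt_continuous (V := R_CompleteNormedModule)).
  intros t. rewrite Rmin_left, Rmax_right by exact Hab. apply H.
Qed.

Lemma ex_RInt_Re f : ccont_on f a b -> ex_RInt (fun t => Re (f t)) a b.
Proof. intros H; apply ex_RInt_cont_on; intros t Ht; apply (H t Ht). Qed.

Lemma ex_RInt_Im f : ccont_on f a b -> ex_RInt (fun t => Im (f t)) a b.
Proof. intros H; apply ex_RInt_cont_on; intros t Ht; apply (H t Ht). Qed.

Lemma RInt_ext_on (h k : R -> R) : (forall t, a <= t <= b -> h t = k t) -> RInt h a b = RInt k a b.
Proof.
  intros H; apply RInt_ext; intros t. rewrite Rmin_left, Rmax_right by exact Hab. intros; apply H; lra.
Qed.

Lemma CInt_ext f g : (forall t, a <= t <= b -> f t = g t) -> CInt f a b = CInt g a b.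
Proof. intros H; apply Ceq; simpl; apply RInt_ext_on; intros t Ht; now rewrite H. Qed.

Lemma CInt_plus f g : ccont_on f a b -> ccont_on g a b ->
  CInt (fun t => f t + g t)%C a b = (CInt f a b + CInt g a b)%C.
Proof.
  intros Hf Hg; apply Ceq.
  - exact (RInt_plus (V := R_CompleteNormedModule) (fun t => Re (f t)) (fun t => Re (g t)) a b
      (ex_RInt_Re f Hf) (ex_RInt_Re g Hg)).
  - exact (RInt_plus (V := R_CompleteNormedModule) (fun t => Im (f t)) (fun t => Im (g t)) a b
      (ex_RInt_Im f Hf) (ex_RInt_Im g Hg)).
Qed.

Lemma CInt_minus f g : ccont_on f a b -> ccont_on g a b ->
  CInt (fun t => f t - g t)%C a b = (CInt f a b - CInt g a b)%C.
Proof.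
  intros Hf Hg; apply Ceq.
  - exact (RInt_minus (V := R_CompleteNormedModule) (fun t => Re (f t)) (fun t => Re (g t)) a b
      (ex_RInt_Re f Hf) (ex_RInt_Re g Hg)).
  - exact (RInt_minus (V := R_CompleteNormedModule) (fun t => Im (f t)) (fun t => Im (g t)) a b
      (ex_RInt_Im f Hf) (ex_RInt_Im g Hg)).
Qed.

Lemma CInt_scal (c : C) f : ccont_on f a b ->
  CInt (fun t => c * f t)%C a b = (c * CInt f a b)%C.
Proof.
  intros Hf. pose proof (ex_RInt_Re f Hf) as H1. pose proof (ex_RInt_Im f Hf) as H2.
  assert (S : forall (k : R) (h : R -> R), ex_RInt h a b -> RInt (fun t => k * h t) a b = k * RInt h a b).
  { intros k h Hh. apply (RInt_scal (V := R_CompleteNormedModule) h a b k Hh). }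
  assert (S' : forall (k : R) (h : R -> R), ex_RInt h a b -> ex_RInt (fun t => k * h t) a b).
  { intros k h Hh. apply (ex_RInt_scal (V := R_NormedModule) h a b k Hh). }
  unfold CInt. apply Ceq; simpl.
  - rewrite <- !S by assumption.
    exact (RInt_minus (V := R_CompleteNormedModule) (fun t => Re c * Re (f t)) (fun t => Im c * Im (f t)) a b
      (S' _ _ H1) (S' _ _ H2)).
  - rewrite <- !S by assumption.
    exact (RInt_plus (V := R_CompleteNormedModule) (fun t => Re c * Im (f t)) (fun t => Im c * Re (f t)) a b
      (S' _ _ H2) (S' _ _ H1)).
Qed.

Lemma CInt_Cmod_le f (h : R -> R) : ccont_on f a b ->
  (forall t, a <= t <= b -> continuous h t) ->
  (forall t, a <= t <= b -> Cmod (f t) <= h t) -> Cmod (CInt f a b) <= RInt h a b.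
Proof.
  intros Hf Hh Hle. set (I := CInt f a b).
  (* Multiplication by the conjugate of the integral makes it real and nonnegative, which leaves an
     inequality between real integrals. *)
  assert (E : Cmod I * Cmod I = RInt (fun t => Re (Cconj I * f t)) a b).
  { rewrite Cmod_sqr.
    replace (Re I * Re I + Im I * Im I) with (Re (Cconj I * I)) by (unfold Re, Im; simpl; ring).
    unfold I at 2. rewrite <- CInt_scal by exact Hf. reflexivity. }
  assert (Hc : ccont_on (fun t => Cconj I * f t)%C a b).
  { intros t Ht. apply ccont_mult; [apply ccont_const | apply Hf, Ht]. }
  assert (L : RInt (fun t => Re (Cconj I * f t)) a b <= RInt (fun t => Cmod I * h t) a b).
  { apply RInt_le; [exact Hab | now apply ex_RInt_Re | |].
    - apply (ex_RInt_scal (V := R_NormedModule)). apply ex_RInt_cont_on, Hh.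
    - intros t Ht. eapply Rle_trans; [apply Re_le_Cmod|]. rewrite Cmod_mult, Cmod_conj.
      apply Rmult_le_compat_l; [apply Cmod_ge_0 | apply Hle; lra]. }
  assert (S : RInt (fun t => Cmod I * h t) a b = Cmod I * RInt h a b).
  { apply (RInt_scal (V := R_CompleteNormedModule) h a b (Cmod I)), ex_RInt_cont_on, Hh. }
  rewrite S, <- E in L.
  assert (0 <= RInt h a b).
  { apply RInt_ge_0; [exact Hab | apply ex_RInt_cont_on, Hh |].
    intros t Ht. eapply Rle_trans; [apply Cmod_ge_0 | apply Hle; lra]. }
  destruct (Req_dec (Cmod I) 0) as [->|E0]; [assumption|].
  pose proof (Cmod_ge_0 I). apply Rmult_le_reg_l with (Cmod I); lra.
Qed.

Lemma CInt_derive f df : (forall t, a <= t <= b -> cderiv f t (df t)) -> ccont_on df a b ->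
  CInt df a b = (f b - f a)%C.
Proof.
  intros Hf Hdf. apply Ceq; simpl; apply is_RInt_unique.
  - apply (is_RInt_derive (V := R_CompleteNormedModule) (fun t => Re (f t)));
      intros t; rewrite Rmin_left, Rmax_right by exact Hab; intros Ht; [apply (Hf t Ht) | apply (Hdf t Ht)].
  - apply (is_RInt_derive (V := R_CompleteNormedModule) (fun t => Im (f t)));
      intros t; rewrite Rmin_left, Rmax_right by exact Hab; intros Ht; [apply (Hf t Ht) | apply (Hdf t Ht)].
Qed.

(** Joint continuity at the endpoints of [[a, b]] is two-sided, hence the derivative is required on
    an interval longer by [e] at each end. *)
Lemma is_derive_RInt_jointly (k dk : R -> R -> R) (x e : R) : 0 < e ->
  (forall u t, x - e < u < x + e -> a - e < t < b + e -> is_derive (fun v => k v t) u (dk u t)) ->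
  (forall t, a <= t <= b -> continuous (fun p : R * R => dk (fst p) (snd p)) (x, t)) ->
  (forall u t, x - e < u < x + e -> a <= t <= b -> continuous (k u) t) ->
  is_derive (fun u => RInt (k u) a b) x (RInt (dk x) a b).
Proof.
  intros He Hd Hc Hk.
  assert (Hx : locally x (fun u => x - e < u < x + e)).
  { apply (locally_interval _ x (x - e) (x + e)); simpl; try lra. intros; lra. }
  replace (RInt (dk x) a b) with (RInt (fun t => Derive (fun u => k u t) x) a b).
  - apply (is_derive_RInt_param k).
    + eapply filter_imp; [|exact Hx]. intros u Hu t. rewrite Rmin_left, Rmax_right by exact Hab.
      intros Ht. eexists. apply Hd; lra.
    + intros t. rewrite Rmin_left, Rmax_right by exact Hab. intros Ht.
      apply continuity_2d_pt_ext_loc with dk.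
      * exists (mkposreal e He). simpl. intros u v Hu Hv. symmetry. apply is_derive_unique.
        apply Rabs_lt_between in Hu, Hv. apply Hd; lra.
      * apply continuity_2d_pt_filterlim. apply Hc, Ht.
    + eapply filter_imp; [|exact Hx]. intros u Hu. apply ex_RInt_cont_on. intros t Ht. now apply Hk.
  - apply RInt_ext_on. intros t Ht. apply is_derive_unique, Hd; lra.
Qed.

Lemma cderiv_CInt (k dk : R -> R -> C) (x e : R) : 0 < e ->
  (forall u t, x - e < u < x + e -> a - e < t < b + e -> cderiv (fun v => k v t) u (dk u t)) ->
  (forall t, a <= t <= b -> ccont (fun p : R * R => dk (fst p) (snd p)) (x, t)) ->
  (forall u t, x - e < u < x + e -> a <= t <= b -> ccont (k u) t) ->
  cderiv (fun u => CInt (k u) a b) x (CInt (dk x) a b).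
Proof.
  intros He Hd Hc Hk; split; simpl.
  - apply (is_derive_RInt_jointly (fun u t => Re (k u t)) (fun u t => Re (dk u t)) x e He).
    + intros u t Hu Ht; apply (Hd u t Hu Ht).
    + intros t Ht; apply (Hc t Ht).
    + intros u t Hu Ht; apply (Hk u t Hu Ht).
  - apply (is_derive_RInt_jointly (fun u t => Im (k u t)) (fun u t => Im (dk u t)) x e He).
    + intros u t Hu Ht; apply (Hd u t Hu Ht).
    + intros t Ht; apply (Hc t Ht).
    + intros u t Hu Ht; apply (Hk u t Hu Ht).
Qed.

End Integral.

Lemma PI_opp_le : - PI <= PI.
Proof. generalize PI_RGT_0; lra. Qed.

(** For the odd terms of the Laplace expansion: bounded by absolute values, they would leave a
    relative error [n^(-1/2)] instead of [1/n]. *)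
Lemma CInt_odd (f : R -> C) : ccont_on f (- PI) PI -> (forall t, f (- t) = (- f t)%C) ->
  CInt f (- PI) PI = 0.
Proof.
  intros Hf Ho.
  assert (O : forall h : R -> R, ex_RInt h (- PI) PI -> (forall t, h (- t) = - h t) -> RInt h (- PI) PI = 0).
  { intros h Hh Hodd.
    pose proof (RInt_correct (V := R_CompleteNormedModule) _ _ _ Hh) as H1.
    pose proof (is_RInt_swap _ _ _ _ H1) as H2.
    rewrite <- (Ropp_involutive PI) in H2 at 1.
    apply (is_RInt_comp_opp (V := R_NormedModule) h (- PI) PI) in H2.
    apply (is_RInt_ext _ h) in H2;
      [|intros t _; rewrite Hodd; apply Ropp_involutive].
    apply (is_RInt_unique (V := R_CompleteNormedModule)) in H2.
    unfold opp in H2; simpl in H2. unfold RInt in *; simpl in *. lra. }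
  apply Ceq; simpl; apply O.
  - now apply ex_RInt_Re; [apply PI_opp_le|].
  - intros t; now rewrite Ho.
  - now apply ex_RInt_Im; [apply PI_opp_le|].
  - intros t; now rewrite Ho.
Qed.

(** * Generating polynomials of the Stirling-Sibuya distribution *)

(** This is [theta ^ n] times the probability generating function, and [n!] times the coefficient of
    [x^n] in [(1 + y (exp x - 1)) ^ theta]. It is not divided by [theta ^ n], since the recurrence
    passes to [theta - 1], which may be 0; the summand [k = 0] gives the value 1 for [n = 0]. *)
Definition stirling_poly (n : nat) (theta : R) (y : C) : C :=
  sum_n (fun k => RtoC (INR (stirling2 n k) * falling theta k) * y ^ k)%C n.

Lemma stirling2_gt (n k : nat) : (n < k)%nat -> stirling2 n k = 0%nat.
Proof.
  revert k; induction n as [|n IH]; intros [|k] H; try lia; [reflexivity|].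
  simpl. rewrite !IH by lia. lia.
Qed.

Lemma falling_shift (theta : R) (k : nat) : falling theta (S k) = theta * falling (theta - 1) k.
Proof.
  induction k as [|k IH]; [simpl; ring|].
  change (falling theta (S (S k))) with (falling theta (S k) * (theta - INR (S k))).
  rewrite IH, S_INR. simpl. ring.
Qed.

Lemma sum_n_C_S (u : nat -> C) (n : nat) : sum_n u (S n) = (sum_n u n + u (S n))%C.
Proof. apply (sum_Sn (G := C_AbelianMonoid)). Qed.

Lemma sum_n_C_0 (u : nat -> C) : sum_n u 0 = u 0%nat.
Proof. apply (sum_O (G := C_AbelianMonoid)). Qed.

Ltac cring := match goal with |- @eq _ ?a ?b => change (@eq C a b) end; ring.

(** Coefficientwise form of [(f ^ theta)' = theta (f ^ theta + (y - 1) f ^ (theta - 1))], which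
    holds because [f = 1 + y (exp x - 1)] satisfies [f' = f + y - 1]. *)
Lemma stirling_poly_S (n : nat) (theta : R) (y : C) :
  stirling_poly (S n) theta y =
  (RtoC theta * (stirling_poly n theta y + (y - 1) * stirling_poly n (theta - 1) y))%C.
Proof.
  set (F := fun k => (RtoC (falling theta k) * y ^ k)%C).
  (* The shift of index leaves a boundary term at [S m], so partial sums are compared for every [m];
     for [m = n] the boundary term vanishes. *)
  assert (L : forall m, sum_n (fun k => RtoC (INR (stirling2 (S n) k) * falling theta k) * y ^ k)%C (S m)
     = (sum_n (fun k => RtoC (INR (stirling2 n k)) * (RtoC (INR k) * F k + F (S k)))%C m
        + RtoC (INR (S m * stirling2 n (S m))) * F (S m))%C).
  { induction m as [|m IH].
    - rewrite sum_n_C_S, !sum_n_C_0. unfold F. simpl stirling2.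
      rewrite ?plus_INR, ?mult_INR, ?RtoC_mult, ?RtoC_plus, ?RtoC_mult. simpl. cring.
    - rewrite sum_n_C_S, IH, (sum_n_C_S _ m). unfold F.
      change (stirling2 (S n) (S (S m))) with (S (S m) * stirling2 n (S (S m)) + stirling2 n (S m))%nat.
      rewrite !plus_INR, !mult_INR, ?RtoC_mult, ?RtoC_plus, ?RtoC_mult. cring. }
  unfold stirling_poly at 1. rewrite (L n), (stirling2_gt n (S n)) by lia.
  rewrite Nat.mul_0_r. simpl (INR 0). rewrite Cmult_0_l, Cplus_0_r.
  (* The summation bound is separated from the row [n] of Stirling numbers, and the induction runs
     on the bound alone. *)
  unfold stirling_poly. generalize n at 2 4 6. intros m.
  induction m as [|m IH].
  - rewrite !sum_n_C_0. unfold F. rewrite (falling_shift theta 0). simpl.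
    rewrite !RtoC_mult. cring.
  - rewrite !sum_n_C_S, IH. unfold F.
    assert (E1 : RtoC (falling theta (S (S m))) = (RtoC (falling theta (S m)) * (RtoC theta - RtoC (INR (S m))))%C)
      by (rewrite <- RtoC_minus, <- RtoC_mult; reflexivity).
    assert (E2 : RtoC (falling theta (S (S m))) = (RtoC theta * RtoC (falling (theta - 1) (S m)))%C)
      by (rewrite <- RtoC_mult, falling_shift; reflexivity).
    rewrite (Cpow_S y (S m)). rewrite !RtoC_mult.
    set (P := RtoC (falling (theta - 1) (S m))) in *.
    set (Q := RtoC (falling theta (S m))) in *.
    set (N := RtoC (INR (S m))) in *.
    rewrite E1 in E2 |- *.
    replace (RtoC theta * (sum_n (fun k => RtoC (INR (stirling2 n k) * falling theta k) * y ^ k) m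
      + RtoC (INR (stirling2 n (S m))) * Q * y ^ S m + (y - 1) *
      (sum_n (fun k => RtoC (INR (stirling2 n k) * falling (theta - 1) k) * y ^ k) m
      + RtoC (INR (stirling2 n (S m))) * P * y ^ S m)))%C
    with (RtoC theta * (sum_n (fun k => RtoC (INR (stirling2 n k) * falling theta k) * y ^ k) m
     + (y - 1) * sum_n (fun k => RtoC (INR (stirling2 n k) * falling (theta - 1) k) * y ^ k) m)
     + RtoC (INR (stirling2 n (S m))) * y ^ S m * (RtoC theta * Q + (y - 1) * (RtoC theta * P)))%C by cring.
    rewrite <- E2. cring.
Qed.

Lemma ccont_comp {U V : UniformSpace} (h : U -> V) (f : V -> C) (u : U) :
  continuous h u -> ccont f (h u) -> ccont (fun v => f (h v)) u.
Proof.
  intros Hh [H1 H2]; split; [apply (continuous_comp h (fun v => Re (f v))) | apply (continuous_comp h (fun v => Im (f v)))]; assumption.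
Qed.

Lemma PI_neq_0_C : RtoC PI <> 0.
Proof. intros H. apply RtoC_inj in H. generalize PI_RGT_0; lra. Qed.

Lemma Cminus_eq_0 (a b : C) : (a - b)%C = 0 -> a = b.
Proof. intros E. replace a with (a - b + b)%C by ring. rewrite E. ring. Qed.

Section CoefficientIntegral.

(* [H i x] plays the role of [(1 + y (exp x - 1)) ^ val i], and [prd] lowers the
   exponent by one. *)
Variables (I : Type) (val : I -> R) (prd : I -> I) (y : C) (H : I -> C -> C).
(** For natural exponents [D] is the whole plane; for real ones, where [H] is
    [exp (theta * Clog f)], it is the set on which [f] avoids the cut. The margin [e] allows
    differentiation under the integral up to the ends of the parameter ranges. *)
Variables (D : C -> Prop) (g dg : R -> C) (e : R).
Hypothesis He : 0 < e.
(** The first alternative is for the natural exponent 0, where [prd] cannot lower the exponent; the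
    term is then multiplied by [val i = 0]. *)
Hypothesis Hprd : forall i, val i = 0 \/ val (prd i) = val i - 1.
Let dH i x := (RtoC (val i) * (H i x + (y - 1) * H (prd i) x))%C.
Hypothesis HdH : forall i (x : R -> C) t d, cderiv x t d -> D (x t) ->
  cderiv (fun s => H i (x s)) t (dH i (x t) * d)%C.
Hypothesis HcH : forall i (p : R * R -> C) u, ccont p u -> D (p u) ->
  ccont (fun v => H i (p v)) u.
Hypothesis H0 : forall i, H i 0 = 1.
Hypothesis Hg : forall t, cderiv g t (dg t).
Hypothesis Hdg : forall t, ccont dg t.
Hypothesis Hg_closed : g (- PI) = g PI.
Hypothesis Hg_neq_0 : forall t, g t <> 0.
Hypothesis HD : forall u t, - e < u < 1 + e -> - PI - e < t < PI + e -> D (RtoC u * g t).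
Hypothesis Hwinding : CInt (fun t => dg t / g t)%C (- PI) PI = (2 * RtoC PI * Ci)%C.

Let Hg_cont t : ccont g t := cderiv_cont _ _ _ (Hg t).

Let deriv_t i u t : - e < u < 1 + e -> - PI - e < t < PI + e ->
  cderiv (fun s => H i (RtoC u * g s)) t (dH i (RtoC u * g t) * (RtoC u * dg t))%C.
Proof. intros Hu Ht. apply HdH; [apply cderiv_scal, Hg | now apply HD]. Qed.

Let cont_t i u t : - e < u < 1 + e -> - PI - e < t < PI + e ->
  ccont (fun s => H i (RtoC u * g s)) t.
Proof. intros Hu Ht. eapply cderiv_cont, deriv_t; assumption. Qed.

Let cont_dH i u t : - e < u < 1 + e -> - PI - e < t < PI + e ->
  ccont (fun s => dH i (RtoC u * g s)) t.
Proof.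
  intros Hu Ht. unfold dH.
  apply ccont_mult; [apply ccont_const|].
  apply ccont_plus; [|apply ccont_mult; [apply ccont_const|]]; now apply cont_t.
Qed.

(* Shrinking the loop [g] to the loop [u g], [u] in [0, 1], does not change the
   integral of [H i x / x]. *)
Lemma coefficient_integral_0 i :
  CInt (fun t => H i (g t) * (dg t / g t))%C (- PI) PI = (2 * RtoC PI * Ci)%C.
Proof.
  generalize PI_RGT_0; intros HPI.
  pose (K := fun u t => (H i (RtoC u * g t) * (dg t / g t))%C).
  pose (dK := fun u t => (dH i (RtoC u * g t) * dg t)%C).
  assert (HK : forall u, 0 <= u <= 1 -> cderiv (fun v => CInt (K v) (- PI) PI) u (CInt (dK u) (- PI) PI)).
  { intros u Hu. apply (cderiv_CInt (- PI) PI PI_opp_le K dK u e He).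
    - intros v t Hv Ht. unfold K, dK.
      assert (Hr : cderiv (fun v => H i (RtoC v * g t)) v (dH i (RtoC v * g t) * g t)%C).
      { apply HdH; [apply cderiv_ray | apply HD; lra]. }
      eapply cderiv_eq; [apply cderiv_mult; [exact Hr | apply cderiv_const]|].
      cbv beta. field. apply Hg_neq_0.
    - intros t Ht. unfold dK.
      assert (Hp : ccont (fun p : R * R => RtoC (fst p) * g (snd p))%C (u, t)).
      { apply ccont_mult; [apply ccont_RtoC, continuous_fst|].
        apply (ccont_comp snd g); [apply continuous_snd | apply Hg_cont]. }
      assert (HDp : D (RtoC (fst (u, t)) * g (snd (u, t)))) by (apply HD; simpl; lra).
      apply ccont_mult.
      + unfold dH. apply ccont_mult; [apply ccont_const|].
        apply ccont_plus; [|apply ccont_mult; [apply ccont_const|]].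
        * exact (HcH i _ (u, t) Hp HDp).
        * exact (HcH (prd i) _ (u, t) Hp HDp).
      + apply (ccont_comp snd dg); [apply continuous_snd | apply Hdg].
    - intros v t Hv Ht. unfold K. apply ccont_mult; [apply cont_t; lra|].
      apply ccont_div; [apply Hdg | apply Hg_cont | apply Hg_neq_0]. }
  (* For [u <> 0] the integrand is the derivative in [t] of [H i (u g t) / u], and the loop is
     closed; for [u = 0] it is a constant times [dg]. *)
  assert (HdK : forall u, 0 <= u <= 1 -> CInt (dK u) (- PI) PI = 0).
  { intros u Hu. unfold dK. destruct (Req_dec u 0) as [->|Hu0].
    - rewrite (CInt_ext _ _ PI_opp_le _ (fun t => dH i 0 * dg t)%C)
        by (intros t _; now rewrite Cmult_0_l).
      rewrite CInt_scal; [|apply PI_opp_le | intros t _; apply Hdg].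
      rewrite (CInt_derive _ _ PI_opp_le g); [|intros t _; apply Hg | intros t _; apply Hdg].
      rewrite Hg_closed. ring.
    - assert (Hu0' : RtoC u <> 0) by (intros E; apply RtoC_inj in E; contradiction).
      assert (E : CInt (fun t => dH i (RtoC u * g t) * (RtoC u * dg t))%C (- PI) PI = 0).
      { rewrite (CInt_derive _ _ PI_opp_le (fun t => H i (RtoC u * g t))).
        - rewrite Hg_closed; ring.
        - intros t Ht. apply deriv_t; lra.
        - intros t Ht. apply ccont_mult; [apply cont_dH; lra|].
          apply ccont_mult; [apply ccont_const | apply Hdg]. }
      rewrite (CInt_ext _ _ PI_opp_le _ (fun t => RtoC u * (dH i (RtoC u * g t) * dg t))%C) in E
        by (intros t _; ring).
      rewrite CInt_scal in E; [|apply PI_opp_le |].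
      + rewrite <- (Cmult_1_l (CInt _ _ _)), <- (Cinv_l (RtoC u) Hu0'), <- Cmult_assoc, E. ring.
      + intros t Ht. apply ccont_mult; [apply cont_dH; lra | apply Hdg]. }
  assert (E : Cmod (CInt (K 1) (- PI) PI - CInt (K 0) (- PI) PI) <= 0).
  { apply (Cmod_increment_le_const (fun v => CInt (K v) (- PI) PI) (fun v => CInt (dK v) (- PI) PI)).
    - exact HK.
    - intros t Ht. rewrite HdK by exact Ht. rewrite Cmod_0. lra. }
  assert (E1 : CInt (K 1) (- PI) PI = CInt (K 0) (- PI) PI).
  { apply Cminus_eq_0, Cmod_eq_0. apply Rle_antisym; [exact E | apply Cmod_ge_0]. }
  unfold K in E1.
  rewrite (CInt_ext _ _ PI_opp_le _ (fun t => H i (RtoC 1 * g t) * (dg t / g t))%C)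
    by (intros t _; now rewrite Cmult_1_l).
  rewrite E1.
  rewrite (CInt_ext _ _ PI_opp_le _ (fun t => dg t / g t)%C)
    by (intros t _; rewrite Cmult_0_l, H0; ring).
  exact Hwinding.
Qed.

(* Integration by parts turns the recurrence [stirling_poly_S] into the relation
   between [x ^ - (n + 2)] and [x ^ - (n + 1)] moments. *)
Lemma coefficient_integral (n : nat) (i : I) :
  (RtoC (INR (fact n)) * CInt (fun t => H i (g t) / g t ^ (S n) * dg t) (- PI) PI)%C =
  (2 * RtoC PI * Ci * stirling_poly n (val i) y)%C.
Proof.
  generalize PI_RGT_0; intros HPI.
  assert (Hc : forall j t, - PI <= t <= PI -> ccont (fun s => H j (g s)) t).
  { intros j t Ht. apply (ccont_ext_loc (fun s => H j (RtoC 1 * g s))).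
    - apply filter_forall; intros s; now rewrite Cmult_1_l.
    - apply cont_t; lra. }
  assert (Hci : forall j k, ccont_on (fun t => H j (g t) / g t ^ k * dg t)%C (- PI) PI).
  { intros j k t Ht. apply ccont_mult; [apply ccont_div; [now apply Hc | apply ccont_pow, Hg_cont | apply Cpow_nz, Hg_neq_0] | apply Hdg]. }
  revert i; induction n as [|n IH]; intros i.
  - simpl fact. simpl (INR 1).
    rewrite (CInt_ext _ _ PI_opp_le _ (fun t => H i (g t) * (dg t / g t))%C).
    + rewrite coefficient_integral_0. unfold stirling_poly. rewrite sum_n_C_0. simpl.
      rewrite RtoC_mult. ring.
    + intros t _. simpl. field. apply Hg_neq_0.
  - set (J := fun j => CInt (fun t => H j (g t) / g t ^ (S n) * dg t)%C (- PI) PI) in *.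
    assert (E : (RtoC (INR (S n)) * CInt (fun t => H i (g t) / g t ^ (S (S n)) * dg t)%C (- PI) PI
      = RtoC (val i) * (J i + (y - 1) * J (prd i)))%C).
    { assert (Z : CInt (fun t => RtoC (val i) * (H i (g t) / g t ^ (S n) * dg t + (y - 1) * (H (prd i) (g t) / g t ^ (S n) * dg t))
         - RtoC (INR (S n)) * (H i (g t) / g t ^ (S (S n)) * dg t))%C (- PI) PI = 0).
      { rewrite (CInt_derive _ _ PI_opp_le (fun t => H i (g t) * / (g t ^ (S n)))%C).
        - rewrite Hg_closed. ring.
        - intros t Ht.
          assert (D1 : cderiv (fun s => H i (g s)) t (dH i (g t) * dg t)%C).
          { apply HdH; [apply Hg|]. rewrite <- (Cmult_1_l (g t)). apply HD; lra. }
          eapply cderiv_eq.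
          + apply cderiv_mult; [exact D1|]. apply cderiv_inv; [apply cderiv_pow, Hg | apply Cpow_nz, Hg_neq_0].
          + cbv beta. simpl pred. unfold dH. rewrite !Cpow_S.
            pose proof (Hg_neq_0 t). pose proof (Cpow_nz (g t) n (Hg_neq_0 t)).
            field. split; assumption.
        - intros t Ht. apply ccont_minus.
          + apply ccont_mult; [apply ccont_const|]. apply ccont_plus; [now apply Hci|].
            apply ccont_mult; [apply ccont_const | now apply Hci].
          + apply ccont_mult; [apply ccont_const | now apply Hci]. }
      assert (C2 : ccont_on (fun t => (y - 1) * (H (prd i) (g t) / g t ^ (S n) * dg t))%C (- PI) PI).
      { intros t Ht. apply ccont_mult; [apply ccont_const | now apply Hci]. }
      assert (C1 : ccont_on (fun t => H i (g t) / g t ^ (S n) * dg t + (y - 1) * (H (prd i) (g t) / g t ^ (S n) * dg t))%C (- PI) PI).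
      { intros t Ht. apply ccont_plus; [now apply Hci | now apply C2]. }
      rewrite CInt_minus in Z; [| apply PI_opp_le | | ].
      - rewrite (CInt_scal _ _ PI_opp_le _ _ C1), (CInt_scal _ _ PI_opp_le _ _ (Hci i (S (S n)))),
          (CInt_plus _ _ PI_opp_le _ _ (Hci i (S n)) C2), (CInt_scal _ _ PI_opp_le _ _ (Hci (prd i) (S n))) in Z.
        symmetry. apply Cminus_eq_0. exact Z.
      - intros t Ht. apply ccont_mult; [apply ccont_const | now apply C1].
      - intros t Ht. apply ccont_mult; [apply ccont_const | now apply Hci]. }
    rewrite fact_simpl, mult_INR, RtoC_mult, (Cmult_comm (RtoC (INR (S n)))), <- Cmult_assoc, E.
    rewrite stirling_poly_S.
    pose proof (IH i) as IHi. pose proof (IH (prd i)) as IHp. fold (J i) in IHi. fold (J (prd i)) in IHp.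
    replace (RtoC (INR (fact n)) * (RtoC (val i) * (J i + (y - 1) * J (prd i))))%C
      with (RtoC (val i) * (RtoC (INR (fact n)) * J i + (y - 1) * (RtoC (INR (fact n)) * J (prd i))))%C by ring.
    rewrite IHi, IHp.
    destruct (Hprd i) as [Ev|Ev]; rewrite Ev; ring.
Qed.

End CoefficientIntegral.

Lemma exp_le (x y : R) : x <= y -> exp x <= exp y.
Proof. intros [H| ->]; [now apply Rlt_le, exp_increasing | lra]. Qed.

(** * Laplace's method *)

Lemma exp_INR_mult (n : nat) (x : R) : exp (INR n * x) = exp x ^ n.
Proof.
  induction n as [|n IH]; [simpl; rewrite Rmult_0_l; apply exp_0|].
  rewrite S_INR, Rmult_plus_distr_r, exp_plus, IH, Rmult_1_l. simpl. ring.
Qed.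

(** This is [x <= exp x] at [x = c v / (k + 1)], raised to the power [k + 1]. *)
Lemma pow_le_exp (c v : R) (k : nat) : 0 < c -> 0 <= v ->
  v ^ S k <= (INR (S k) / c) ^ S k * exp (c * v).
Proof.
  intros Hc Hv.
  assert (Hk : 0 < INR (S k)) by (apply lt_0_INR; lia).
  assert (E : exp (c * v) = exp (c * v / INR (S k)) ^ S k).
  { rewrite <- exp_INR_mult. f_equal. field. lra. }
  rewrite E, <- Rpow_mult_distr. apply pow_incr. split; [exact Hv|].
  assert (c * v / INR (S k) <= exp (c * v / INR (S k)))
    by (generalize (exp_ineq1_le (c * v / INR (S k))); lra).
  replace v with (INR (S k) / c * (c * v / INR (S k))) at 1 by (field; lra).
  apply Rmult_le_compat_l; [|assumption]. apply Rlt_le, Rdiv_lt_0_compat; assumption.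
Qed.

(** Applied with [v = n t^2]. The Gaussian factor is traded for [1 / (1 + v)], whose integral over
    [[-PI, PI]] is given by an arctangent. *)
Lemma exp_decay_bound (c : R) : 0 < c -> exists C, 0 < C /\ forall v, 0 <= v ->
  exp (- (c * v)) * (v + v ^ 2 + v ^ 3) <= C / (1 + v).
Proof.
  intros Hc.
  set (K := fun k => (INR (S k) / c) ^ S k).
  assert (HK : forall k, 0 < K k).
  { intros k. apply pow_lt, Rdiv_lt_0_compat; [apply lt_0_INR; lia | exact Hc]. }
  (* The weights are the coefficients of [(v + v^2 + v^3) (1 + v)], and [K k] bounds
     [v^(k+1) exp (- c v)]. *)
  exists (K 0%nat + 2 * K 1%nat + 2 * K 2%nat + K 3%nat).
  generalize (HK 0%nat) (HK 1%nat) (HK 2%nat) (HK 3%nat); intros k0 k1 k2 k3.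
  split; [lra|]. intros v Hv.
  apply (proj1 (Rle_div_r _ _ (1 + v) ltac:(lra))) .
  pose proof (pow_le_exp c v 0 Hc Hv) as P0. pose proof (pow_le_exp c v 1 Hc Hv) as P1.
  pose proof (pow_le_exp c v 2 Hc Hv) as P2. pose proof (pow_le_exp c v 3 Hc Hv) as P3.
  change ((INR 1 / c) ^ 1) with (K 0%nat) in P0. change ((INR 2 / c) ^ 2) with (K 1%nat) in P1.
  change ((INR 3 / c) ^ 3) with (K 2%nat) in P2. change ((INR 4 / c) ^ 4) with (K 3%nat) in P3.
  rewrite exp_Ropp. pose proof (exp_pos (c * v)) as He. rewrite pow_1 in P0.
  set (X := exp (c * v)) in *.
  apply Rmult_le_reg_l with X; [exact He|].
  replace (X * (/ X * (v + v ^ 2 + v ^ 3) * (1 + v))) with (v + 2 * v ^ 2 + 2 * v ^ 3 + v ^ 4)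
    by (field; lra).
  lra.
Qed.

Lemma RInt_lorentz_le (n : R) : 0 < n -> RInt (fun t => / (1 + n * t ^ 2)) (- PI) PI <= PI / sqrt n.
Proof.
  intros Hn. pose proof (sqrt_lt_R0 n Hn) as Hs. pose proof (sqrt_sqrt n (Rlt_le _ _ Hn)) as Hss.
  assert (Hp : forall t, 0 < 1 + n * t ^ 2) by (intros t; generalize (pow2_ge_0 t); nra).
  assert (E : is_RInt (fun t => / (1 + n * t ^ 2)) (- PI) PI
     (minus (atan (sqrt n * PI) / sqrt n) (atan (sqrt n * - PI) / sqrt n))).
  { apply (is_RInt_derive (V := R_CompleteNormedModule) (fun t => atan (sqrt n * t) / sqrt n)).
    - intros t _. auto_derive; [trivial|].
      replace (1 + n * t ^ 2) with (1 + sqrt n * sqrt n * t ^ 2) by (rewrite Hss; ring).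
      assert (0 <= sqrt n * sqrt n * t ^ 2) by (rewrite Hss; specialize (Hp t); generalize (pow2_ge_0 t); nra).
      simpl in *. field. repeat split; nra.
    - intros t _. apply continuous_derivable.
      auto_derive. specialize (Hp t). simpl in Hp. simpl. lra. }
  rewrite (is_RInt_unique (V := R_CompleteNormedModule) _ _ _ _ E).
  change (minus (atan (sqrt n * PI) / sqrt n) (atan (sqrt n * - PI) / sqrt n))
    with (atan (sqrt n * PI) / sqrt n - atan (sqrt n * - PI) / sqrt n).
  generalize (atan_bound (sqrt n * PI)) (atan_bound (sqrt n * - PI)); intros.
  replace (atan (sqrt n * PI) / sqrt n - atan (sqrt n * - PI) / sqrt n)
    with ((atan (sqrt n * PI) - atan (sqrt n * - PI)) / sqrt n) by (field; lra).
  apply Rmult_le_compat_r; [apply Rlt_le, Rinv_0_lt_compat, Hs | lra].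
Qed.

(* [E (exp Y - 1 - Y)] is bounded through whichever of [E] and [E exp Y] is larger. *)
Lemma Cexp_remainder_2_weighted (X Y : C) (m : R) :
  Cmod (Cexp X) <= m -> Cmod (Cexp (X + Y)) <= m ->
  Cmod (Cexp X * (Cexp Y - 1 - Y)) <= Cmod Y ^ 2 * m.
Proof.
  intros H1 H2. rewrite Cmod_mult.
  pose proof (Cexp_remainder_2 Y (Rmax 0 (Re Y)) (Rmax_r _ _) (Rmax_l _ _)) as H.
  pose proof (Cmod_ge_0 (Cexp X)) as H0.
  apply Rle_trans with (Cmod (Cexp X) * (Cmod Y ^ 2 * exp (Rmax 0 (Re Y)))).
  { now apply Rmult_le_compat_l. }
  replace (Cmod (Cexp X) * (Cmod Y ^ 2 * exp (Rmax 0 (Re Y))))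
    with (Cmod Y ^ 2 * (Cmod (Cexp X) * exp (Rmax 0 (Re Y)))) by ring.
  apply Rmult_le_compat_l; [apply pow2_ge_0|].
  rewrite Cexp_plus, Cmod_mult, (Cmod_Cexp Y) in H2.
  unfold Rmax. destruct (Rle_dec 0 (Re Y)); [assumption|]. rewrite exp_0. lra.
Qed.

Definition gaussian (alpha : C) (n : nat) (t : R) : C :=
  Cexp (RtoC (INR n) * (- (alpha / 2) * RtoC (t ^ 2)))%C.

Lemma Cmod_gaussian (alpha : C) (n : nat) (t : R) :
  Cmod (gaussian alpha n t) = exp (- (Re alpha / 2 * INR n * t ^ 2)).
Proof.
  unfold gaussian. rewrite Cmod_Cexp, re_scal_l, re_scal_r. f_equal.
  replace (- (alpha / 2))%C with (RtoC (- / 2) * alpha)%C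
    by (rewrite RtoC_opp, RtoC_inv by lra; field).
  rewrite re_scal_l. field.
Qed.

Lemma gaussian_cderiv (alpha : C) (n : nat) (t : R) :
  cderiv (gaussian alpha n) t (- (RtoC (INR n) * alpha * RtoC t) * gaussian alpha n t)%C.
Proof.
  unfold gaussian. eapply cderiv_eq.
  - apply cderiv_Cexp, cderiv_scal, cderiv_scal, (cderiv_RtoC (fun t => t ^ 2) t (2 * t)).
    auto_derive; [trivial | ring].
  - rewrite RtoC_mult. field.
Qed.

Lemma gaussian_cont (alpha : C) (n : nat) (t : R) : ccont (gaussian alpha n) t.
Proof. eapply cderiv_cont, gaussian_cderiv. Qed.

Lemma gaussian_even (alpha : C) (n : nat) (t : R) : gaussian alpha n (- t) = gaussian alpha n t.
Proof. unfold gaussian. do 4 f_equal. ring. Qed.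

(** Write [Gt = exp (X + Y)] with [X] the quadratic exponent. The difference splits into
    [exp X (exp Y - 1 - Y) At], of order [n^2 t^6], and [exp X] times [n rho At], [At - A0 - A1 t]
    and [n b t^3 (At - A0)], of orders [n t^4], [t^2] and [n t^4]. *)
Lemma laplace_bound_inner (n t t2 c B : R) (alpha b A0 A1 Gt At rho : C) :
  0 <= n -> 0 < t2 -> 0 <= B -> Rabs t <= t2 -> Rabs t <= PI ->
  Cmod b <= B -> Cmod A0 <= B -> Cmod A1 <= B -> Cmod rho <= B * t ^ 4 ->
  Cmod (At - A0 - A1 * RtoC t) <= B * t ^ 2 ->
  Cmod Gt <= exp (- (c * (n * t ^ 2))) ->
  Cmod (Cexp (RtoC n * (- (alpha / 2) * RtoC (t ^ 2)))) <= exp (- (c * (n * t ^ 2))) ->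
  Gt = Cexp (RtoC n * (- (alpha / 2) * RtoC (t ^ 2) + b * RtoC (t ^ 3) + rho)) ->
  Cmod (Gt * At - Cexp (RtoC n * (- (alpha / 2) * RtoC (t ^ 2))) *
     (A0 + (A1 * RtoC t + RtoC n * b * A0 * RtoC (t ^ 3)))) <=
  exp (- (c * (n * t ^ 2))) *
  ((B ^ 2 * (1 + t2) ^ 2 * (B + B * PI + B * PI ^ 2) + B * (B + B * PI + B * PI ^ 2) + B + B * (B + B * PI))
    * (t ^ 2 + n * t ^ 4 + n ^ 2 * t ^ 6)).
Proof.
  intros Hn Ht2 HB Ht HtPI Hb HA0 HA1 Hrho HA HG HE EG.
  pose proof (Rabs_pos t) as Ha. 
  assert (Ea : t ^ 2 = Rabs t ^ 2) by (rewrite RPow_abs; symmetry; apply Rabs_right, Rle_ge, pow2_ge_0).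
  assert (Ea4 : t ^ 4 = Rabs t ^ 4).
  { replace (t ^ 4) with ((t ^ 2) ^ 2) by ring. rewrite Ea. ring. }
  assert (Ea6 : t ^ 6 = Rabs t ^ 6).
  { replace (t ^ 6) with ((t ^ 2) ^ 3) by ring. rewrite Ea. ring. }
  set (x := Rabs t) in *.
  set (X := (RtoC n * (- (alpha / 2) * RtoC (t ^ 2)))%C) in *.
  set (Y := (RtoC n * (b * RtoC (t ^ 3) + rho))%C).
  assert (EG' : Gt = Cexp (X + Y)) by (rewrite EG; f_equal; unfold X, Y; ring).
  set (m := exp (- (c * (n * t ^ 2)))) in *.
  assert (Hm : 0 < m) by apply exp_pos.
  assert (Hbt : Cmod (b * RtoC (t ^ 3)) <= B * x ^ 3).
  { rewrite Cmod_mult, Cmod_R, <- RPow_abs. fold x. apply Rmult_le_compat_r; [apply pow_le, Ha | exact Hb]. }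
  assert (HY : Cmod Y <= n * (B * (1 + t2)) * x ^ 3).
  { unfold Y. rewrite Cmod_mult, Cmod_RtoC_pos by exact Hn. rewrite Rmult_assoc.
    apply Rmult_le_compat_l; [exact Hn|].
    eapply Rle_trans; [apply Cmod_triangle_le; [exact Hbt | exact Hrho]|]. rewrite Ea4.
    replace (B * x ^ 3 + B * x ^ 4) with (B * (1 + x) * x ^ 3) by ring.
    apply Rmult_le_compat_r; [apply pow_le, Ha|]. apply Rmult_le_compat_l; lra. }
  assert (HAA0 : Cmod (At - A0) <= (B + B * PI) * x).
  { replace (At - A0)%C with ((At - A0 - A1 * RtoC t) + A1 * RtoC t)%C by ring.
    eapply Rle_trans; [apply Cmod_triangle_le; [exact HA | rewrite Cmod_mult, Cmod_R; apply Rmult_le_compat_r; [apply Rabs_pos | exact HA1]]|].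
    fold x. rewrite Ea. assert (0 <= B * x * (PI - x)) by (apply Rmult_le_pos; nra). lra. }
  assert (HAt : Cmod At <= B + B * PI + B * PI ^ 2).
  { replace At with (A0 + (At - A0))%C by ring.
    eapply Rle_trans; [apply Cmod_triangle_le; [exact HA0 | exact HAA0]|].
    assert (0 <= B * (1 + PI) * (PI - x)) by (generalize PI_RGT_0; intros; apply Rmult_le_pos; nra). lra. }
  set (BA := B + B * PI + B * PI ^ 2) in *.
  assert (Hrem : Cmod (Cexp X * (Cexp Y - 1 - Y)) <= Cmod Y ^ 2 * m).
  { apply Cexp_remainder_2_weighted; [exact HE | rewrite <- EG'; exact HG]. }
  assert (HY2 : Cmod Y ^ 2 <= n ^ 2 * (B ^ 2 * (1 + t2) ^ 2) * x ^ 6).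
  { replace (n ^ 2 * (B ^ 2 * (1 + t2) ^ 2) * x ^ 6) with ((n * (B * (1 + t2)) * x ^ 3) ^ 2) by ring.
    apply pow_incr. split; [apply Cmod_ge_0 | exact HY]. }
  replace (Gt * At - Cexp X * (A0 + (A1 * RtoC t + RtoC n * b * A0 * RtoC (t ^ 3))))%C with
    ((Cexp X * (Cexp Y - 1 - Y)) * At + Cexp X * ((RtoC n * rho) * At + ((At - A0 - A1 * RtoC t)
       + (RtoC n * (b * RtoC (t ^ 3))) * (At - A0))))%C
    by (rewrite EG', Cexp_plus; unfold Y; ring).
  apply Rle_trans with (n ^ 2 * (B ^ 2 * (1 + t2) ^ 2) * x ^ 6 * m * BA +
     m * (n * (B * x ^ 4) * BA + (B * x ^ 2 + n * (B * x ^ 3) * ((B + B * PI) * x)))).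
  - apply Cmod_triangle_le.
    + rewrite Cmod_mult. apply Rmult_le_compat; try apply Cmod_ge_0; [|exact HAt].
      eapply Rle_trans; [exact Hrem|]. apply Rmult_le_compat_r; lra.
    + rewrite Cmod_mult. apply Rmult_le_compat; try apply Cmod_ge_0; [exact HE|].
      apply Cmod_triangle_le; [|apply Cmod_triangle_le].
      * rewrite !Cmod_mult, Cmod_RtoC_pos by exact Hn. rewrite <- Ea4.
        apply Rmult_le_compat; try apply Cmod_ge_0; [apply Rmult_le_pos; [exact Hn | apply Cmod_ge_0] | | exact HAt].
        now apply Rmult_le_compat_l.
      * rewrite <- Ea. exact HA.
      * rewrite Cmod_mult, (Cmod_mult (RtoC n)), Cmod_RtoC_pos by exact Hn.
        apply Rmult_le_compat; try apply Cmod_ge_0; [apply Rmult_le_pos; [exact Hn | apply Cmod_ge_0] | | exact HAA0].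
        now apply Rmult_le_compat_l.
  - rewrite Ea, Ea4, Ea6.
    assert (HPI := PI_RGT_0).
    assert (0 <= BA) by (unfold BA; generalize (pow2_ge_0 PI); nra).
    assert (Q2 : 0 <= x ^ 2) by apply pow_le, Ha.
    assert (Q4 : 0 <= n * x ^ 4) by (apply Rmult_le_pos; [exact Hn | apply pow_le, Ha]).
    assert (Q6 : 0 <= n ^ 2 * x ^ 6) by (apply Rmult_le_pos; apply pow_le; assumption).
    set (u2 := x ^ 2) in *. set (u4 := n * x ^ 4) in *. set (u6 := n ^ 2 * x ^ 6) in *.
    replace (n ^ 2 * (B ^ 2 * (1 + t2) ^ 2) * x ^ 6 * m * BA +
     m * (n * (B * x ^ 4) * BA + (B * u2 + n * (B * x ^ 3) * ((B + B * PI) * x))))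
     with (m * ((B ^ 2 * (1 + t2) ^ 2 * BA) * u6 + (B * BA) * u4 + B * u2 + (B * (B + B * PI)) * u4))
     by (unfold u4, u6; ring).
    apply Rmult_le_compat_l; [lra|].
    assert (0 <= B ^ 2 * (1 + t2) ^ 2 * BA).
    { apply Rmult_le_pos; [apply Rmult_le_pos; apply pow2_ge_0 | assumption]. }
    assert (0 <= B * BA) by nra. assert (0 <= B * (B + B * PI)) by (apply Rmult_le_pos; nra).
    set (c1 := B ^ 2 * (1 + t2) ^ 2 * BA) in *. set (c2 := B * BA) in *. set (c3 := B * (B + B * PI)) in *.
    nra.
Qed.

(** Away from 0 no cancellation is used: the two terms are bounded separately, and powers of
    [|t| / t2 >= 1] are inserted to reach the form of the inner bound. *)
Lemma laplace_bound_outer (n t t2 c B : R) (E b A0 A1 Gt At : C) :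
  0 <= n -> 0 < t2 -> 0 <= B -> t2 <= Rabs t -> Rabs t <= PI ->
  Cmod b <= B -> Cmod A0 <= B -> Cmod A1 <= B ->
  Cmod (At - A0 - A1 * RtoC t) <= B * t ^ 2 ->
  Cmod Gt <= exp (- (c * (n * t ^ 2))) ->
  Cmod E <= exp (- (c * (n * t ^ 2))) ->
  Cmod (Gt * At - E * (A0 + (A1 * RtoC t + RtoC n * b * A0 * RtoC (t ^ 3)))) <=
  exp (- (c * (n * t ^ 2))) *
  (((B + B * PI + B * PI ^ 2) / t2 ^ 2 + (B + B * PI) / t2 ^ 2 + B * B / t2) * (t ^ 2 + n * t ^ 4 + n ^ 2 * t ^ 6)).
Proof.
  intros Hn Ht2 HB Ht HtPI Hb HA0 HA1 HA HG HE.
  assert (HPI := PI_RGT_0).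
  assert (Ea : t ^ 2 = Rabs t ^ 2) by (rewrite RPow_abs; symmetry; apply Rabs_right, Rle_ge, pow2_ge_0).
  assert (Ea4 : t ^ 4 = Rabs t ^ 4).
  { replace (t ^ 4) with ((t ^ 2) ^ 2) by ring. rewrite Ea. ring. }
  assert (Ea6 : t ^ 6 = Rabs t ^ 6).
  { replace (t ^ 6) with ((t ^ 2) ^ 3) by ring. rewrite Ea. ring. }
  set (x := Rabs t) in *. set (m := exp (- (c * (n * t ^ 2)))) in *.
  assert (Hm : 0 < m) by apply exp_pos. assert (Hx : 0 < x) by lra.
  assert (HA1t : Cmod (A1 * RtoC t) <= B * PI).
  { rewrite Cmod_mult, Cmod_R. apply Rmult_le_compat; [apply Cmod_ge_0 | apply Rabs_pos | assumption | assumption]. }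
  assert (HAt : Cmod At <= B + B * PI + B * PI ^ 2).
  { replace At with (A0 + A1 * RtoC t + (At - A0 - A1 * RtoC t))%C by ring.
    apply Cmod_triangle_le; [now apply Cmod_triangle_le|].
    eapply Rle_trans; [exact HA|]. apply Rmult_le_compat_l; [exact HB|]. rewrite Ea. apply pow_incr. lra. }
  set (BA := B + B * PI + B * PI ^ 2) in *.
  assert (HBA : 0 <= BA) by (unfold BA; generalize (pow2_ge_0 PI); nra).
  apply Rle_trans with (m * BA + m * ((B + B * PI) + n * (B * B) * x ^ 3)).
  - eapply Rle_trans; [apply Cmod_minus_le|]. apply Rplus_le_compat.
    + rewrite Cmod_mult. apply Rmult_le_compat; try apply Cmod_ge_0; assumption.
    + rewrite Cmod_mult. apply Rmult_le_compat; try apply Cmod_ge_0; [assumption|].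
      replace (A0 + (A1 * RtoC t + RtoC n * b * A0 * RtoC (t ^ 3)))%C with
        (A0 + A1 * RtoC t + RtoC n * (b * A0) * RtoC (t ^ 3))%C by ring.
      apply Cmod_triangle_le; [now apply Cmod_triangle_le|].
      rewrite !Cmod_mult, Cmod_RtoC_pos, Cmod_R, <- RPow_abs by exact Hn. fold x.
      apply Rmult_le_compat_r; [apply pow_le; lra|].
      apply Rmult_le_compat_l; [exact Hn|]. apply Rmult_le_compat; try apply Cmod_ge_0; assumption.
  - rewrite Ea, Ea4, Ea6, <- Rmult_plus_distr_l. apply Rmult_le_compat_l; [lra|].
    assert (R1 : 1 <= / t2 ^ 2 * x ^ 2).
    { apply Rmult_le_reg_l with (t2 ^ 2); [apply pow_lt, Ht2|]. rewrite <- Rmult_assoc, Rinv_r, Rmult_1_r, Rmult_1_l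
       by (apply pow_nonzero; lra). apply pow_incr. lra. }
    assert (R2 : x ^ 3 <= / t2 * x ^ 4).
    { apply Rmult_le_reg_l with t2; [exact Ht2|]. rewrite <- Rmult_assoc, Rinv_r, Rmult_1_l by lra.
      replace (x ^ 4) with (x * x ^ 3) by ring. apply Rmult_le_compat_r; [apply pow_le|]; lra. }
    assert (Q2 : 0 <= x ^ 2) by (apply pow_le; lra).
    assert (Q4 : 0 <= n * x ^ 4) by (apply Rmult_le_pos; [exact Hn | apply pow_le; lra]).
    assert (Q6 : 0 <= n ^ 2 * x ^ 6) by (apply Rmult_le_pos; apply pow_le; lra).
    pose proof (Rinv_0_lt_compat _ Ht2) as I2.
    assert (I4 : 0 < / t2 ^ 2) by (apply Rinv_0_lt_compat, pow_lt, Ht2).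
    assert (S3 : n * (B * B) * x ^ 3 <= (B * B / t2) * (n * x ^ 4)).
    { replace (n * (B * B) * x ^ 3) with ((n * (B * B)) * x ^ 3) by ring.
      replace (B * B / t2 * (n * x ^ 4)) with ((n * (B * B)) * (/ t2 * x ^ 4)) by (field; lra).
      apply Rmult_le_compat_l; [|exact R2]. apply Rmult_le_pos; nra. }
    assert (S1 : BA <= BA / t2 ^ 2 * x ^ 2).
    { unfold Rdiv. rewrite Rmult_assoc. nra. }
    assert (S2 : B + B * PI <= (B + B * PI) / t2 ^ 2 * x ^ 2).
    { unfold Rdiv. rewrite Rmult_assoc. assert (0 <= B + B * PI) by nra. nra. }
    assert (0 <= BA / t2 ^ 2) by (apply Rmult_le_pos; lra).
    assert (0 <= (B + B * PI) / t2 ^ 2) by (apply Rmult_le_pos; nra).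
    assert (0 <= B * B / t2) by (apply Rmult_le_pos; nra).
    set (u2 := x ^ 2) in *. set (u4 := n * x ^ 4) in *. set (u6 := n ^ 2 * x ^ 6) in *.
    set (c1 := BA / t2 ^ 2) in *. set (c2 := (B + B * PI) / t2 ^ 2) in *. set (c3 := B * B / t2) in *.
    nra.
Qed.

(** The constant depends on [c], [B] and [t2] only, which makes the estimate uniform in the saddle
    point. The terms in [t] and [t^3], collected in [O] below, integrate to 0 against the even
    Gaussian. With [v = n t^2] the remaining bound is [(v + v^2 + v^3) / n] times the exponential,
    and the integral contributes another [n^(-1/2)]. *)
Lemma laplace_remainder (c B t2 : R) : 0 < c -> 0 <= B -> 0 < t2 ->
  exists M, 0 <= M /\ forall (n : nat) (G A : R -> C) (alpha b A0 A1 : C), (1 <= n)%nat ->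
  ccont_on G (- PI) PI -> ccont_on A (- PI) PI ->
  Cmod b <= B -> Cmod A0 <= B -> Cmod A1 <= B -> c <= Re alpha / 2 ->
  (forall t, Rabs t <= PI -> Cmod (G t) <= exp (- (c * (INR n * t ^ 2)))) ->
  (forall t, Rabs t <= PI -> Cmod (A t - A0 - A1 * RtoC t) <= B * t ^ 2) ->
  (forall t, Rabs t <= t2 -> exists rho, Cmod rho <= B * t ^ 4 /\
     G t = Cexp (RtoC (INR n) * (- (alpha / 2) * RtoC (t ^ 2) + b * RtoC (t ^ 3) + rho))) ->
  Cmod (CInt (fun t => G t * A t)%C (- PI) PI - A0 * CInt (gaussian alpha n) (- PI) PI)
  <= M / (INR n * sqrt (INR n)).
Proof.
  intros Hc HB Ht2. destruct (exp_decay_bound c Hc) as [C2 [HC2 Hdecay]].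
  assert (HPI := PI_RGT_0).
  set (BA := B + B * PI + B * PI ^ 2).
  assert (HBA : 0 <= BA) by (unfold BA; generalize (pow2_ge_0 PI); nra).
  set (K1 := B ^ 2 * (1 + t2) ^ 2 * BA + B * BA + B + B * (B + B * PI)).
  set (K2 := BA / t2 ^ 2 + (B + B * PI) / t2 ^ 2 + B * B / t2).
  assert (HK1 : 0 <= K1).
  { assert (0 <= B ^ 2 * (1 + t2) ^ 2 * BA)
      by (apply Rmult_le_pos; [apply Rmult_le_pos; apply pow2_ge_0 | assumption]).
    assert (0 <= B * BA) by nra. assert (0 <= B * (B + B * PI)) by (apply Rmult_le_pos; nra).
    unfold K1; lra. }
  assert (HK2 : 0 <= K2).
  { assert (I4 : 0 < / t2 ^ 2) by (apply Rinv_0_lt_compat, pow_lt, Ht2).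
    pose proof (Rinv_0_lt_compat _ Ht2) as I2.
    assert (0 <= BA / t2 ^ 2) by (apply Rmult_le_pos; lra).
    assert (0 <= (B + B * PI) / t2 ^ 2) by (apply Rmult_le_pos; nra).
    assert (0 <= B * B / t2) by (apply Rmult_le_pos; nra).
    unfold K2; lra. }
  exists ((K1 + K2) * C2 * PI).
  split; [apply Rmult_le_pos; [apply Rmult_le_pos|]; lra|].
  intros n G A alpha b A0 A1 Hn HGc HAc Hb HA0 HA1 Halpha HG HA HGt.
  assert (HnR : 1 <= INR n) by (change 1 with (INR 1); now apply le_INR).
  set (N := INR n) in *.
  assert (HE : forall t, Cmod (gaussian alpha n t) <= exp (- (c * (N * t ^ 2)))).
  { intros t. rewrite Cmod_gaussian. fold N. apply exp_le.
    apply Ropp_le_contravar. rewrite (Rmult_assoc (Re alpha / 2)).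
    apply Rmult_le_compat_r; [apply Rmult_le_pos; [lra | apply pow2_ge_0] | exact Halpha]. }
  set (O := fun t => (gaussian alpha n t * (A1 * RtoC t + RtoC N * b * A0 * RtoC (t ^ 3)))%C).
  assert (HOc : ccont_on O (- PI) PI).
  { intros t _. apply ccont_mult; [apply gaussian_cont|].
    apply ccont_plus; apply ccont_mult; try apply ccont_const; apply ccont_RtoC.
    - apply continuous_id.
    - apply continuous_derivable. auto_derive. trivial. }
  assert (HO : CInt O (- PI) PI = 0).
  { apply CInt_odd; [exact HOc|]. intros t. unfold O. rewrite gaussian_even, RtoC_opp.
    replace (RtoC ((- t) ^ 3)) with (- RtoC (t ^ 3))%C by (rewrite <- RtoC_opp; f_equal; ring). ring. }
  assert (HGA : ccont_on (fun t => G t * A t)%C (- PI) PI).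
  { intros t Ht; apply ccont_mult; [now apply HGc | now apply HAc]. }
  assert (HA0g : ccont_on (fun t => A0 * gaussian alpha n t)%C (- PI) PI).
  { intros t Ht; apply ccont_mult; [apply ccont_const | apply gaussian_cont]. }
  assert (HGA0 : ccont_on (fun t => G t * A t - A0 * gaussian alpha n t)%C (- PI) PI).
  { intros t Ht; apply ccont_minus; [now apply HGA | now apply HA0g]. }
  assert (E : (CInt (fun t => G t * A t)%C (- PI) PI - A0 * CInt (gaussian alpha n) (- PI) PI)%C =
     CInt (fun t => (G t * A t - A0 * gaussian alpha n t) - O t)%C (- PI) PI).
  { rewrite (CInt_minus _ _ PI_opp_le _ _ HGA0 HOc), HO, (CInt_minus _ _ PI_opp_le _ _ HGA HA0g).
    rewrite (CInt_scal _ _ PI_opp_le A0 _ (fun t _ => gaussian_cont alpha n t)). ring. }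
  rewrite E.
  eapply Rle_trans.
  { apply (CInt_Cmod_le _ _ PI_opp_le _ (fun t => (K1 + K2) * C2 / N * / (1 + N * t ^ 2))).
    - intros t Ht. apply ccont_minus; [now apply HGA0 | now apply HOc].
    - intros t _. apply continuous_derivable.
      auto_derive. assert (0 <= N * t ^ 2) by (apply Rmult_le_pos; [lra | apply pow2_ge_0]). simpl in *. lra.
    - intros t Ht. assert (Hta : Rabs t <= PI) by (apply Rabs_le_between; lra).
      replace (G t * A t - A0 * gaussian alpha n t - O t)%C with
        (G t * A t - gaussian alpha n t * (A0 + (A1 * RtoC t + RtoC N * b * A0 * RtoC (t ^ 3))))%C
        by (unfold O; ring).
      assert (Hq : 0 <= t ^ 2 + N * t ^ 4 + N ^ 2 * t ^ 6).
      { replace (t ^ 2 + N * t ^ 4 + N ^ 2 * t ^ 6) with (t ^ 2 * (1 + N * t ^ 2 + (N * t ^ 2) ^ 2)) by ring.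
        assert (0 <= N * t ^ 2) by (apply Rmult_le_pos; [lra | apply pow2_ge_0]).
        apply Rmult_le_pos; [apply pow2_ge_0 | nra]. }
      pose proof (exp_pos (- (c * (N * t ^ 2)))) as Hep.
      apply Rle_trans with (exp (- (c * (N * t ^ 2))) * ((K1 + K2) * (t ^ 2 + N * t ^ 4 + N ^ 2 * t ^ 6))).
      + destruct (Rle_dec (Rabs t) t2) as [Hin|Hout].
        * destruct (HGt t Hin) as [rho [Hrho EG]].
          eapply Rle_trans.
          { apply (laplace_bound_inner N t t2 c B alpha b A0 A1 (G t) (A t) rho); try assumption; try lra.
            - apply HA, Hta.
            - apply HG, Hta.
            - apply HE. }
          apply Rmult_le_compat_l; [lra|]. apply Rmult_le_compat_r; [exact Hq|]. fold BA. fold K1. lra.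
        * eapply Rle_trans.
          { apply (laplace_bound_outer N t t2 c B (gaussian alpha n t) b A0 A1 (G t) (A t)); try assumption; try lra.
            - apply HA, Hta.
            - apply HG, Hta.
            - apply HE. }
          apply Rmult_le_compat_l; [lra|]. apply Rmult_le_compat_r; [exact Hq|]. fold BA. fold K2. lra.
      + assert (Hv : 0 <= N * t ^ 2) by (apply Rmult_le_pos; [lra | apply pow2_ge_0]).
        specialize (Hdecay _ Hv).
        replace (exp (- (c * (N * t ^ 2))) * ((K1 + K2) * (t ^ 2 + N * t ^ 4 + N ^ 2 * t ^ 6)))
          with ((K1 + K2) / N * (exp (- (c * (N * t ^ 2))) * (N * t ^ 2 + (N * t ^ 2) ^ 2 + (N * t ^ 2) ^ 3)))
          by (field; lra).
        replace ((K1 + K2) * C2 / N * / (1 + N * t ^ 2)) with ((K1 + K2) / N * (C2 / (1 + N * t ^ 2)))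
          by (field; simpl in *; lra).
        apply Rmult_le_compat_l; [|exact Hdecay]. apply Rmult_le_pos; [lra|].
        apply Rlt_le, Rinv_0_lt_compat; lra. }
  assert (Hl : ex_RInt (fun t => / (1 + N * t ^ 2)) (- PI) PI).
  { apply ex_RInt_cont_on; [apply PI_opp_le|]. intros t _.
    apply continuous_derivable.
    auto_derive. assert (0 <= N * t ^ 2) by (apply Rmult_le_pos; [lra | apply pow2_ge_0]). simpl in *. lra. }
  assert (Es : RInt (fun t => (K1 + K2) * C2 / N * / (1 + N * t ^ 2)) (- PI) PI
     = (K1 + K2) * C2 / N * RInt (fun t => / (1 + N * t ^ 2)) (- PI) PI)
    by exact (RInt_scal (V := R_CompleteNormedModule) _ _ _ _ Hl).
  rewrite Es.
  pose proof (RInt_lorentz_le N ltac:(lra)) as HL.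
  pose proof (sqrt_lt_R0 N ltac:(lra)) as Hs.
  replace ((K1 + K2) * C2 * PI / (N * sqrt N)) with ((K1 + K2) * C2 / N * (PI / sqrt N)) by (field; lra).
  apply Rmult_le_compat_l; [|exact HL].
  apply Rmult_le_pos; [apply Rmult_le_pos; lra|]. apply Rlt_le, Rinv_0_lt_compat; lra.
Qed.

(** This replaces the substitution [t -> q t]. Along the segment [r] from 1 to [q], the derivative
    in [u] of [r * gaussian (r * r)] equals [q - 1] times the derivative in [t] of
    [t * gaussian (r * r)], so that only boundary values at [PI] and [- PI] remain, and these are
    exponentially small. *)
Lemma gaussian_rotation (q : C) (c : R) (n : nat) :
  (forall u, 0 <= u <= 1 -> c <= Re ((1 + RtoC u * (q - 1)) * (1 + RtoC u * (q - 1))) / 2) ->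
  Cmod (q * CInt (gaussian (q * q) n) (- PI) PI - CInt (gaussian 1 n) (- PI) PI)
  <= Cmod (q - 1) * (2 * PI * exp (- (c * (INR n * PI ^ 2)))).
Proof.
  intros Hq. assert (HPI := PI_RGT_0).
  set (r := fun u => (1 + RtoC u * (q - 1))%C) in *.
  pose (K := fun u t => (r u * gaussian (r u * r u) n t)%C).
  pose (dK := fun u t => ((q - 1) * ((1 - RtoC (INR n) * (r u * r u) * RtoC t * RtoC t) * gaussian (r u * r u) n t))%C).
  assert (Hr : forall u, cderiv r u (q - 1)%C).
  { intros u. unfold r. eapply cderiv_eq; [apply cderiv_plus; [apply cderiv_const | apply cderiv_ray]|]. ring. }
  assert (HdK : forall u t, ccont (fun s => (1 - RtoC (INR n) * (r u * r u) * RtoC s * RtoC s) * gaussian (r u * r u) n s)%C t).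
  { intros u t. apply ccont_mult; [|apply gaussian_cont].
    apply ccont_minus; [apply ccont_const|].
    apply ccont_mult; [apply ccont_mult; [apply ccont_const|]|]; apply ccont_RtoC, continuous_id. }
  replace (q * CInt (gaussian (q * q) n) (- PI) PI)%C with (CInt (K 1) (- PI) PI).
  2:{ unfold K. replace (r 1) with q by (unfold r; ring).
      apply CInt_scal; [apply PI_opp_le | intros t _; apply gaussian_cont]. }
  replace (CInt (gaussian 1 n) (- PI) PI) with (CInt (K 0) (- PI) PI).
  2:{ apply CInt_ext; [apply PI_opp_le|]. intros t _. unfold K.
      replace (r 0) with (RtoC 1) by (unfold r; ring). rewrite !Cmult_1_l. reflexivity. }
  apply (Cmod_increment_le_const (fun u => CInt (K u) (- PI) PI) (fun u => CInt (dK u) (- PI) PI)).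
  - intros u _. apply (cderiv_CInt (- PI) PI PI_opp_le K dK u 1 Rlt_0_1).
    + intros v t _ _. unfold K, dK, gaussian. eapply cderiv_eq.
      * apply cderiv_mult; [apply Hr|]. apply cderiv_Cexp, cderiv_scal.
        apply cderiv_mult; [|apply cderiv_const]. apply cderiv_opp. unfold Cdiv.
        apply cderiv_mult; [apply cderiv_mult; apply Hr | apply cderiv_const].
      * cbv beta. replace (RtoC (t ^ 2)) with (RtoC t * RtoC t)%C
          by (rewrite <- RtoC_mult; f_equal; ring). field.
    + intros t _. unfold dK, gaussian.
      assert (Cr : ccont (fun p : R * R => r (fst p)) (u, t)).
      { unfold r. apply ccont_plus; [apply ccont_const|].
        apply ccont_mult; [apply ccont_RtoC, continuous_fst | apply ccont_const]. }
      assert (Ct : ccont (fun p : R * R => RtoC (snd p)) (u, t)) by apply ccont_RtoC, continuous_snd.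
      assert (Crr : ccont (fun p : R * R => r (fst p) * r (fst p))%C (u, t)) by (apply ccont_mult; assumption).
      apply ccont_mult; [apply ccont_const|]. apply ccont_mult.
      * apply ccont_minus; [apply ccont_const|].
        apply ccont_mult; [apply ccont_mult; [apply ccont_mult; [apply ccont_const|]|]|]; assumption.
      * apply ccont_Cexp. apply ccont_mult; [apply ccont_const|]. apply ccont_mult.
        -- apply ccont_opp, ccont_mult; [assumption | apply ccont_const].
        -- apply ccont_RtoC. apply (continuous_comp snd (fun s => s ^ 2)); [apply continuous_snd|].
           apply continuous_derivable. auto_derive. trivial.
    + intros v t _ _. unfold K. apply ccont_mult; [apply ccont_const | apply gaussian_cont].
  - intros u Hu. unfold dK.
    rewrite (CInt_scal _ _ PI_opp_le); [|intros t _; apply HdK].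
    rewrite Cmod_mult. apply Rmult_le_compat_l; [apply Cmod_ge_0|].
    rewrite (CInt_derive _ _ PI_opp_le (fun t => RtoC t * gaussian (r u * r u) n t)%C).
    + rewrite gaussian_even, RtoC_opp.
      replace (RtoC PI * gaussian (r u * r u) n PI - - RtoC PI * gaussian (r u * r u) n PI)%C
        with (RtoC (2 * PI) * gaussian (r u * r u) n PI)%C by (rewrite RtoC_mult; ring).
      rewrite Cmod_mult, Cmod_RtoC_pos, Cmod_gaussian by lra.
      apply Rmult_le_compat_l; [lra|]. apply exp_le, Ropp_le_contravar. rewrite Rmult_assoc.
      apply Rmult_le_compat_r; [apply Rmult_le_pos; [apply pos_INR | apply pow2_ge_0] | now apply Hq].
    + intros t _. eapply cderiv_eq; [apply cderiv_mult; [apply cderiv_id | apply gaussian_cderiv]|].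
      ring.
    + intros t _. apply HdK.
Qed.

(** For [|t| <= n^(-1/2)] the integrand is at least 1/2, and this interval of length [2 n^(-1/2)]
    lies in [[-PI, PI]]. *)
Lemma gaussian_integral_lower (n : nat) : (1 <= n)%nat ->
  1 / sqrt (INR n) <= Cmod (CInt (gaussian 1 n) (- PI) PI).
Proof.
  intros Hn. assert (HPI := PI_RGT_0).
  assert (HnR : 1 <= INR n) by (change 1 with (INR 1); now apply le_INR).
  pose proof (sqrt_lt_R0 (INR n) ltac:(lra)) as Hs.
  pose proof (sqrt_sqrt (INR n) ltac:(lra)) as Hss.
  set (d := / sqrt (INR n)).
  assert (Hd : 0 < d) by (apply Rinv_0_lt_compat, Hs).
  assert (Hd1 : d <= 1).
  { unfold d. rewrite <- Rinv_1. apply Rinv_le_contravar; [lra|].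
    rewrite <- sqrt_1. apply sqrt_le_1_alt; lra. }
  assert (HPI3 : 1 < PI) by (generalize PI2_1; lra).
  eapply Rle_trans; [|apply Re_le_Cmod]. simpl.
  set (h := fun t => Re (gaussian 1 n t)).
  assert (Hh : forall t, h t = exp (- (INR n * t ^ 2 / 2))).
  { intros t. unfold h, gaussian.
    replace (RtoC (INR n) * (- (1 / 2) * RtoC (t ^ 2)))%C with (RtoC (- (INR n * t ^ 2 / 2))).
    - rewrite Cexp_RtoC. reflexivity.
    - unfold Rdiv. rewrite RtoC_opp, !RtoC_mult, RtoC_inv by lra. field. }
  assert (Hc : forall t, continuous h t) by (intros t; apply (gaussian_cont 1 n t)).
  assert (Hex : forall a b, a <= b -> ex_RInt h a b) by (intros a b Hab; apply ex_RInt_cont_on; [exact Hab | intros; apply Hc]).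
  assert (Hpos : forall a b, a <= b -> 0 <= RInt h a b).
  { intros a b Hab. apply RInt_ge_0; [exact Hab | now apply Hex |]. intros t _. rewrite Hh. apply Rlt_le, exp_pos. }
  assert (E1 : RInt h (- PI) PI = RInt h (- PI) (- d) + (RInt h (- d) d + RInt h d PI)).
  { rewrite <- (RInt_Chasles (V := R_CompleteNormedModule) h (- PI) (- d) PI) by (apply Hex; lra).
    rewrite <- (RInt_Chasles (V := R_CompleteNormedModule) h (- d) d PI) by (apply Hex; lra). reflexivity. }
  assert (E2 : RInt (fun _ => 1 / 2) (- d) d <= RInt h (- d) d).
  { apply RInt_le; [lra | apply ex_RInt_const | apply Hex; lra |].
    intros t Ht. rewrite Hh.
    assert (t ^ 2 <= d ^ 2) by nra.
    assert (Hd2 : INR n * d ^ 2 = 1).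
    { unfold d. rewrite <- Hss at 1. field. lra. }
    generalize (exp_ineq1_le (- (INR n * t ^ 2 / 2))). nra. }
  rewrite RInt_const in E2.
  change (scal (d - - d) (1 / 2)) with ((d - - d) * (1 / 2)) in E2.
  generalize (Hpos (- PI) (- d) ltac:(lra)) (Hpos d PI ltac:(lra)).
  intros P1 P2. apply Rle_trans with (RInt h (- PI) PI); [|right; reflexivity].
  rewrite E1. unfold Rdiv at 1. fold d. lra.
Qed.

(** * The contours *)

Definition cis (t : R) : C := Cexp (Ci * RtoC t).

(* For [1/2 < s <= 1] the circle with diameter [1 - 2 s, 1]: it winds around 0 and
   starts (at [t = 0]) at the point 1, where the saddle point will be placed. *)
Definition contour (s t : R) : C := (1 + RtoC s * (cis t - 1))%C.

(* The density of [dx / (i x)] along [contour s]. *)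
Definition weight (s t : R) : C := (RtoC s * cis t / contour s t)%C.

Lemma cis_alt (t : R) : cis t = (cos t, sin t).
Proof.
  unfold cis, Cexp. replace (Ci * RtoC t)%C with ((0, t) : C) by (apply Ceq; unfold Re, Im; simpl; ring).
  simpl. rewrite exp_0. apply Ceq; simpl; ring.
Qed.

Lemma Cmod_cis (t : R) : Cmod (cis t) = 1.
Proof.
  unfold cis. rewrite Cmod_Cexp. replace (Re (Ci * RtoC t)) with 0 by (unfold Re; simpl; ring). apply exp_0.
Qed.

Lemma cis_PI : cis (- PI) = cis PI.
Proof. rewrite !cis_alt, cos_neg, sin_neg, sin_PI. f_equal. ring. Qed.

Lemma cis_opp (t : R) : (cis (- t) * cis t)%C = 1.
Proof.
  unfold cis. rewrite <- Cexp_plus, RtoC_opp. replace (Ci * - RtoC t + Ci * RtoC t)%C with (RtoC 0) by ring.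
  apply Cexp_0.
Qed.

Lemma cis_0 : cis 0 = 1.
Proof. unfold cis. rewrite Cmult_0_r. apply Cexp_0. Qed.

Lemma cis_cderiv (t : R) : cderiv cis t (Ci * cis t)%C.
Proof.
  unfold cis. eapply cderiv_eq; [apply cderiv_Cexp, cderiv_scal, cderiv_id|]. cbv beta; ring.
Qed.

Lemma cis_cont (t : R) : ccont cis t.
Proof. eapply cderiv_cont, cis_cderiv. Qed.

Lemma Cmod_cis_minus_1 (t : R) : Cmod (cis t - 1) <= Rabs t.
Proof.
  unfold cis. eapply Rle_trans; [apply (Cexp_remainder_1 _ 0); [unfold Re; simpl; lra | lra]|].
  rewrite exp_0, Cmod_mult, Cmod_Ci, Cmod_R. lra.
Qed.

Lemma Cmod_cis_remainder_2 (t : R) : Cmod (cis t - 1 - Ci * RtoC t) <= t ^ 2.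
Proof.
  unfold cis. eapply Rle_trans; [apply (Cexp_remainder_2 _ 0); [unfold Re; simpl; lra | lra]|].
  rewrite exp_0, Cmod_mult, Cmod_Ci, Cmod_R, Rmult_1_l, RPow_abs, Rmult_1_r, Rabs_right; [lra|].
  apply Rle_ge, pow2_ge_0.
Qed.

Lemma contour_0 (s : R) : contour s 0 = 1.
Proof. unfold contour. rewrite cis_0. ring. Qed.

Lemma contour_cderiv (s t : R) : cderiv (contour s) t (RtoC s * (Ci * cis t))%C.
Proof.
  unfold contour. eapply cderiv_eq.
  - apply cderiv_plus; [apply cderiv_const|]. apply cderiv_scal, cderiv_minus; [apply cis_cderiv | apply cderiv_const].
  - ring.
Qed.

Lemma contour_cont (s t : R) : ccont (contour s) t.
Proof. eapply cderiv_cont, contour_cderiv. Qed.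

Lemma contour_PI (s : R) : contour s (- PI) = contour s PI.
Proof. unfold contour. now rewrite cis_PI. Qed.

Section Contour.
Variable s : R.
Hypothesis Hs : 1 / 2 < s <= 1.

Lemma Cmod_contour_ge (t : R) : 2 * s - 1 <= Cmod (contour s t).
Proof.
  replace (contour s t) with (RtoC s * cis t - RtoC (s - 1))%C by (unfold contour; rewrite RtoC_minus; ring).
  eapply Rle_trans; [|apply Cmod_reverse].
  rewrite Cmod_mult, Cmod_cis, !Cmod_R, Rabs_right, Rabs_left1 by lra. lra.
Qed.

Lemma Cmod_contour_le (t : R) : Cmod (contour s t) <= 1.
Proof.
  replace (contour s t) with (RtoC (1 - s) + RtoC s * cis t)%C by (unfold contour; rewrite RtoC_minus; ring).
  replace 1 with ((1 - s) + s) at 2 by ring. apply Cmod_triangle_le.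
  - rewrite Cmod_RtoC_pos; lra.
  - rewrite Cmod_mult, Cmod_cis, Cmod_RtoC_pos; lra.
Qed.

Lemma contour_neq_0 (t : R) : contour s t <> 0.
Proof. apply Cmod_gt_0. generalize (Cmod_contour_ge t). lra. Qed.

Lemma weight_cont (t : R) : ccont (weight s) t.
Proof.
  unfold weight. apply ccont_div; [|apply contour_cont | apply contour_neq_0].
  apply ccont_mult; [apply ccont_const | apply cis_cont].
Qed.

(** The contour factors as [s cis t (1 + r cis (- t))] with [r = (1 - s) / s < 1]. The last factor
    stays in the right half-plane, so its logarithm is a periodic summand of the primitive, while
    [cis t] contributes [Ci t]. *)
Lemma contour_winding (L : C) : L <> 0 ->
  CInt (fun t => (L * (RtoC s * (Ci * cis t))) / (L * contour s t))%C (- PI) PI = (2 * RtoC PI * Ci)%C.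
Proof.
  intros HL. assert (HPI := PI_RGT_0).
  set (r := (1 - s) / s).
  assert (Hr : 0 <= r < 1).
  { unfold r; split; [apply Rle_mult_inv_pos; lra | apply Rlt_div_l; lra]. }
  assert (Hslit : forall t, slit (1 + RtoC r * cis (- t))).
  { intros t. apply slit_Re. eapply Rlt_le_trans; [|apply Re_1_plus].
    rewrite Cmod_mult, Cmod_cis, Cmod_RtoC_pos; lra. }
  rewrite (CInt_derive _ _ PI_opp_le (fun t => Ci * RtoC t + Clog (1 + RtoC r * cis (- t)))%C).
  - rewrite Ropp_involutive, cis_PI, RtoC_opp. ring.
  - intros t _. eapply cderiv_eq.
    + apply cderiv_plus; [apply cderiv_scal, cderiv_id|]. apply cderiv_Clog; [|apply Hslit].
      apply cderiv_plus; [apply cderiv_const|]. apply cderiv_scal. unfold cis.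
      apply cderiv_Cexp, cderiv_scal. apply (cderiv_RtoC Ropp t (- (1))). auto_derive; [trivial | ring].
    + fold (cis (- t)). pose proof (contour_neq_0 t) as Hc. pose proof (slit_neq_0 _ (Hslit t)) as Hn.
      assert (Hs0 : RtoC s <> 0) by (intros E; apply RtoC_inj in E; lra).
      assert (Er : (RtoC s * RtoC r)%C = (1 - RtoC s)%C).
      { rewrite <- RtoC_mult, <- RtoC_minus. f_equal. unfold r. field. lra. }
      assert (Hx : contour s t = (RtoC s * cis t * (1 + RtoC r * cis (- t)))%C).
      { unfold contour. replace (RtoC s * cis t * (1 + RtoC r * cis (- t)))%C
          with (RtoC s * cis t + RtoC s * RtoC r * (cis (- t) * cis t))%C by ring.
        rewrite cis_opp, Er. ring. }
      assert (Hcis : cis t <> 0) by apply Cexp_neq_0.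
      cbv beta. rewrite Hx. fold (cis (- t)). rewrite RtoC_opp. field. repeat split; assumption.
  - intros t _. apply ccont_div.
    + apply ccont_mult; [apply ccont_const|]. apply ccont_mult; [apply ccont_const|].
      apply ccont_mult; [apply ccont_const | apply cis_cont].
    + apply ccont_mult; [apply ccont_const | apply contour_cont].
    + apply Cmult_neq_0; [exact HL | apply contour_neq_0].
Qed.

(** With [c = cis t - 1] the weight is exactly [s + s (1 - s) c - s^2 (1 - s) c^2 / contour], and
    the contour has modulus at least [2 s - 1]. *)
Lemma weight_expansion (t : R) :
  Cmod (weight s t - RtoC s - RtoC (s * (1 - s)) * Ci * RtoC t) <= (1 + / (2 * s - 1)) * t ^ 2.
Proof.
  pose proof (contour_neq_0 t) as Hc. pose proof (Cmod_contour_ge t) as Hg.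
  assert (E : (weight s t - RtoC s - RtoC (s * (1 - s)) * Ci * RtoC t)%C =
    (RtoC (s * (1 - s)) * (cis t - 1 - Ci * RtoC t)
     + RtoC (s * (1 - s) * s) * (- ((cis t - 1) * (cis t - 1) / contour s t)))%C).
  { unfold weight. unfold contour in *. rewrite !RtoC_mult, RtoC_minus. field. exact Hc. }
  rewrite E, Rmult_plus_distr_r. apply Cmod_triangle_le.
  - rewrite Cmod_mult, Cmod_RtoC_pos by nra.
    apply Rmult_le_compat; [nra | apply Cmod_ge_0 | nra | apply Cmod_cis_remainder_2].
  - rewrite Cmod_mult, Cmod_RtoC_pos, Cmod_opp, Cmod_div, Cmod_mult by (try exact Hc; nra).
    assert (H1 : Cmod (cis t - 1) * Cmod (cis t - 1) <= t ^ 2).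
    { rewrite <- (Rabs_right (t ^ 2)) by (apply Rle_ge, pow2_ge_0). rewrite <- RPow_abs.
      simpl. rewrite Rmult_1_r. apply Rmult_le_compat; try apply Cmod_ge_0; apply Cmod_cis_minus_1. }
    assert (H2 : / Cmod (contour s t) <= / (2 * s - 1)) by (apply Rinv_le_contravar; lra).
    assert (H3 : 0 < / Cmod (contour s t)) by (apply Rinv_0_lt_compat; lra).
    assert (H4 : 0 <= Cmod (cis t - 1) * Cmod (cis t - 1)) by (apply Rmult_le_pos; apply Cmod_ge_0).
    assert (H5 : 0 <= s * (1 - s) * s <= 1) by (split; [nra|]; assert (s * (1 - s) <= 1) by nra; nra).
    unfold Rdiv. replace (/ (2 * s - 1) * t ^ 2) with (1 * (t ^ 2 * / (2 * s - 1))) by ring.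
    apply Rmult_le_compat; [lra | nra | lra | apply Rmult_le_compat; lra].
Qed.

End Contour.

(** * Cauchy's formula for powers of [1 + y (exp x - 1)] *)

Definition occ (y x : C) : C := (1 + y * (Cexp x - 1))%C.

Lemma cderiv_occ (y : C) (x : R -> C) (t : R) (d : C) : cderiv x t d ->
  cderiv (fun r => occ y (x r)) t ((occ y (x t) + (y - 1)) * d)%C.
Proof.
  intros H. unfold occ. eapply cderiv_eq.
  - apply cderiv_plus; [apply cderiv_const|]. apply cderiv_scal, cderiv_minus; [apply cderiv_Cexp, H | apply cderiv_const].
  - ring.
Qed.

Lemma ccont_occ {U : UniformSpace} (y : C) (x : U -> C) (u : U) : ccont x u -> ccont (fun v => occ y (x v)) u.
Proof.
  intros H. unfold occ. apply ccont_plus; [apply ccont_const|]. apply ccont_mult; [apply ccont_const|].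
  apply ccont_minus; [now apply ccont_Cexp | apply ccont_const].
Qed.

Lemma occ_0 (y : C) : occ y 0 = 1.
Proof. unfold occ. rewrite Cexp_0. ring. Qed.

Section Cauchy.
Variables (s : R) (y L : C) (n : nat).
Hypothesis Hs : 1 / 2 < s <= 1.
Hypothesis HL : L <> 0.

Let rewrite_integrand (h : R -> C) : ccont_on h (- PI) PI ->
  CInt (fun t => h t / (L * contour s t) ^ (S n) * (L * (RtoC s * (Ci * cis t))))%C (- PI) PI =
  (Ci / L ^ n * CInt (fun t => h t / contour s t ^ n * weight s t) (- PI) PI)%C.
Proof.
  intros Hh. rewrite <- (CInt_scal _ _ PI_opp_le).
  - apply CInt_ext; [apply PI_opp_le|]. intros t _. unfold weight.
    rewrite Cpow_mult_l, !Cpow_S. pose proof (contour_neq_0 s Hs t) as H1.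
    pose proof (Cpow_nz _ n H1) as H2. pose proof (Cpow_nz _ n HL) as H3. field. repeat split; assumption.
  - intros t Ht. apply ccont_mult; [|now apply weight_cont].
    apply ccont_div; [now apply Hh | apply ccont_pow, contour_cont | apply Cpow_nz, contour_neq_0, Hs].
Qed.

Let finish (h : R -> C) (P : C) : ccont_on h (- PI) PI ->
  (RtoC (INR (fact n)) * CInt (fun t => h t / (L * contour s t) ^ (S n) * (L * (RtoC s * (Ci * cis t)))) (- PI) PI)%C =
    (2 * RtoC PI * Ci * P)%C ->
  P = (RtoC (INR (fact n) / (2 * PI)) / L ^ n * CInt (fun t => h t / contour s t ^ n * weight s t) (- PI) PI)%C.
Proof.
  intros Hh E. rewrite rewrite_integrand in E by exact Hh.
  set (J := CInt _ _ _) in *. 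
  assert (HCi : Ci <> 0) by (intros Ez; injection Ez; lra).
  pose proof (Cpow_nz _ n HL) as H3. pose proof PI_neq_0_C as H4.
  assert (H5 : RtoC 2 <> 0) by (intros Ez; apply RtoC_inj in Ez; lra).
  rewrite RtoC_div, RtoC_mult by (generalize PI_RGT_0; lra).
  replace P with (2 * RtoC PI * Ci * P / (2 * RtoC PI * Ci))%C by (field; repeat split; assumption).
  rewrite <- E. field. repeat split; assumption.
Qed.

(** A natural power of [occ y] is entire, so the loop may enclose zeros of [occ y]. *)
Lemma cauchy_nat (m : nat) :
  stirling_poly n (INR m) y =
  (RtoC (INR (fact n) / (2 * PI)) / L ^ n *
   CInt (fun t => occ y (L * contour s t) ^ m / contour s t ^ n * weight s t) (- PI) PI)%C.
Proof.
  apply (finish (fun t => occ y (L * contour s t) ^ m)%C).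
  { intros t _. apply ccont_pow, ccont_occ, ccont_mult; [apply ccont_const | apply contour_cont]. }
  apply (coefficient_integral nat INR Nat.pred y (fun m x => occ y x ^ m)%C (fun _ => True)
    (fun t => L * contour s t)%C (fun t => L * (RtoC s * (Ci * cis t)))%C 1 Rlt_0_1).
  - intros [|i]; [now left | right]. rewrite S_INR. simpl. ring.
  - intros i x t d Hx _. eapply cderiv_eq; [apply cderiv_pow, cderiv_occ, Hx|].
    destruct i as [|i]; simpl pred; [simpl; ring|]. rewrite Cpow_S. ring.
  - intros i p u Hp _. now apply ccont_pow, ccont_occ.
  - intros i. rewrite occ_0. apply Cpow_1_l.
  - intros t. apply cderiv_scal, contour_cderiv.
  - intros t. apply ccont_mult; [apply ccont_const|]. apply ccont_mult; [apply ccont_const|].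
    apply ccont_mult; [apply ccont_const | apply cis_cont].
  - now rewrite contour_PI.
  - intros t. apply Cmult_neq_0; [exact HL | now apply contour_neq_0].
  - trivial.
  - now apply contour_winding.
Qed.

(** The contraction of the loop to 0 requires [occ y] to avoid the cut on the whole region swept,
    with the margin [e] of the section above. *)
Lemma cauchy_real (theta e : R) : 0 < e ->
  (forall u t, - e < u < 1 + e -> - PI - e < t < PI + e -> slit (occ y (RtoC u * (L * contour s t)))) ->
  stirling_poly n theta y =
  (RtoC (INR (fact n) / (2 * PI)) / L ^ n *
   CInt (fun t => Cexp (RtoC theta * Clog (occ y (L * contour s t))) / contour s t ^ n * weight s t) (- PI) PI)%C.
Proof.
  intros He Hslit.
  apply (finish (fun t => Cexp (RtoC theta * Clog (occ y (L * contour s t))))).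
  { intros t Ht. apply ccont_Cexp, ccont_mult; [apply ccont_const|]. apply ccont_Clog.
    - apply ccont_occ, ccont_mult; [apply ccont_const | apply contour_cont].
    - rewrite <- (Cmult_1_l (L * contour s t)). apply Hslit; lra. }
  apply (coefficient_integral R (fun th => th) (fun th => th - 1) y
    (fun th x => Cexp (RtoC th * Clog (occ y x))) (fun x => slit (occ y x))
    (fun t => L * contour s t)%C (fun t => L * (RtoC s * (Ci * cis t)))%C e He).
  - intros i; now right.
  - intros i x t d Hx Hsx. eapply cderiv_eq.
    + apply cderiv_Cexp, cderiv_scal, cderiv_Clog; [apply cderiv_occ, Hx | exact Hsx].
    + cbv beta. pose proof (slit_neq_0 _ Hsx) as H0.
      replace (RtoC i * Clog (occ y (x t)))%C with (Clog (occ y (x t)) + RtoC (i - 1) * Clog (occ y (x t)))%C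
        by (rewrite RtoC_minus; ring).
      rewrite Cexp_plus, Cexp_Clog by exact H0. field. exact H0.
  - intros i p u Hp Hsx. apply ccont_Cexp, ccont_mult; [apply ccont_const|].
    apply ccont_Clog; [now apply ccont_occ | exact Hsx].
  - intros i. rewrite occ_0, Clog_RtoC, ln_1, Cmult_0_r by lra. apply Cexp_0.
  - intros t. apply cderiv_scal, contour_cderiv.
  - intros t. apply ccont_mult; [apply ccont_const|]. apply ccont_mult; [apply ccont_const|].
    apply ccont_mult; [apply ccont_const | apply cis_cont].
  - now rewrite contour_PI.
  - intros t. apply Cmult_neq_0; [exact HL | now apply contour_neq_0].
  - exact Hslit.
  - now apply contour_winding.
Qed.

End Cauchy.

(** * Third-order expansions *)

(** An expansion to third order without constant term. A single [B] bounds the coefficients and the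
    remainder, so that sums, products and compositions are controlled by such constants alone. *)
Definition jet (t : R) (f c1 c2 c3 : C) (B : R) : Prop :=
  Cmod c1 <= B /\ Cmod c2 <= B /\ Cmod c3 <= B /\
  Cmod (f - (c1 * RtoC t + c2 * RtoC t ^ 2 + c3 * RtoC t ^ 3)) <= B * Rabs t ^ 4.

Lemma jet_size (t : R) (f c1 c2 c3 : C) (B : R) : Rabs t <= 1 -> jet t f c1 c2 c3 B ->
  Cmod f <= 4 * B * Rabs t.
Proof.
  intros Ht (H1 & H2 & H3 & H4). pose proof (Rabs_pos t) as H0.
  assert (HB : 0 <= B) by (generalize (Cmod_ge_0 c1); lra).
  replace f with (f - (c1 * RtoC t + c2 * RtoC t ^ 2 + c3 * RtoC t ^ 3) +
    (c1 * RtoC t + c2 * RtoC t ^ 2 + c3 * RtoC t ^ 3))%C by ring.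
  set (x := Rabs t) in *.
  assert (P1 : Cmod (c1 * RtoC t) <= B * x).
  { rewrite Cmod_mult, Cmod_R. now apply Rmult_le_compat_r. }
  assert (P2 : Cmod (c2 * RtoC t ^ 2) <= B * x ^ 2).
  { rewrite Cmod_mult, Cmod_pow, Cmod_R. apply Rmult_le_compat_r; [now apply pow_le | exact H2]. }
  assert (P3 : Cmod (c3 * RtoC t ^ 3) <= B * x ^ 3).
  { rewrite Cmod_mult, Cmod_pow, Cmod_R. apply Rmult_le_compat_r; [now apply pow_le | exact H3]. }
  eapply Rle_trans; [apply Cmod_triangle_le; [exact H4 | apply Cmod_triangle_le; [apply Cmod_triangle_le|]; eassumption]|].
  assert (x ^ 2 <= x) by nra. assert (x ^ 3 <= x) by (simpl; nra).
  assert (x ^ 4 <= x) by (replace (x ^ 4) with (x ^ 2 * x ^ 2) by ring; nra).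
  nra.
Qed.

Lemma jet_plus (t : R) (f c1 c2 c3 g d1 d2 d3 : C) (B B' : R) :
  jet t f c1 c2 c3 B -> jet t g d1 d2 d3 B' -> jet t (f + g) (c1 + d1) (c2 + d2) (c3 + d3) (B + B').
Proof.
  intros (H1 & H2 & H3 & H4) (K1 & K2 & K3 & K4).
  repeat split; try (apply Cmod_triangle_le; assumption).
  rewrite Rmult_plus_distr_r.
  match goal with |- Cmod ?z <= _ => replace z with
    ((f - (c1 * RtoC t + c2 * RtoC t ^ 2 + c3 * RtoC t ^ 3)) + (g - (d1 * RtoC t + d2 * RtoC t ^ 2 + d3 * RtoC t ^ 3)))%C by ring end.
  now apply Cmod_triangle_le.
Qed.

Lemma jet_scal (t : R) (k f c1 c2 c3 : C) (K B : R) : Cmod k <= K -> jet t f c1 c2 c3 B ->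
  jet t (k * f) (k * c1) (k * c2) (k * c3) (K * B).
Proof.
  intros Hk (H1 & H2 & H3 & H4).
  repeat split; try (rewrite Cmod_mult; apply Rmult_le_compat; try apply Cmod_ge_0; assumption).
  match goal with |- Cmod ?z <= _ => replace z with
    (k * (f - (c1 * RtoC t + c2 * RtoC t ^ 2 + c3 * RtoC t ^ 3)))%C by ring end.
  rewrite Cmod_mult, Rmult_assoc. apply Rmult_le_compat; try apply Cmod_ge_0; assumption.
Qed.

Lemma jet_error (t : R) (f g c1 c2 c3 : C) (K B : R) : 0 <= K -> Cmod (g - f) <= K * Rabs t ^ 4 ->
  jet t f c1 c2 c3 B -> jet t g c1 c2 c3 (B + K).
Proof.
  intros HK Hg (H1 & H2 & H3 & H4). repeat split; try lra.
  replace (g - (c1 * RtoC t + c2 * RtoC t ^ 2 + c3 * RtoC t ^ 3))%C with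
    ((f - (c1 * RtoC t + c2 * RtoC t ^ 2 + c3 * RtoC t ^ 3)) + (g - f))%C by ring.
  rewrite Rmult_plus_distr_r. now apply Cmod_triangle_le.
Qed.

Lemma jet_mult (t : R) (f c1 c2 c3 g d1 d2 d3 : C) (B B' : R) : Rabs t <= 1 ->
  jet t f c1 c2 c3 B -> jet t g d1 d2 d3 B' ->
  jet t (f * g) 0 (c1 * d1) (c1 * d2 + c2 * d1) (13 * (B * B')).
Proof.
  intros Ht Hf Hg. pose proof (jet_size _ _ _ _ _ _ Ht Hg) as Sg.
  destruct Hf as (H1 & H2 & H3 & H4). destruct Hg as (K1 & K2 & K3 & K4).
  assert (HB : 0 <= B) by (generalize (Cmod_ge_0 c1); lra).
  assert (HB' : 0 <= B') by (generalize (Cmod_ge_0 d1); lra).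
  assert (HBB : 0 <= B * B') by nra. pose proof (Rabs_pos t) as H0.
  assert (M : forall a b : C, Cmod a <= B -> Cmod b <= B' -> Cmod (a * b) <= B * B').
  { intros a b Ha Hb. rewrite Cmod_mult. apply Rmult_le_compat; try apply Cmod_ge_0; assumption. }
  set (x := Rabs t) in *.
  assert (X4 : 0 <= x ^ 4) by now apply pow_le.
  assert (X54 : x ^ 5 <= x ^ 4) by (simpl in *; nra).
  assert (X64 : x ^ 6 <= x ^ 4) by (replace (x ^ 6) with (x * x ^ 5) by ring; assert (0 <= x ^ 5) by (now apply pow_le); nra).
  repeat split.
  - rewrite Cmod_0. lra.
  - generalize (M c1 d1 H1 K1). lra.
  - eapply Rle_trans; [apply Cmod_triangle_le; apply M; eassumption|]. lra.
  - set (e := (f - (c1 * RtoC t + c2 * RtoC t ^ 2 + c3 * RtoC t ^ 3))%C) in *.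
    set (e' := (g - (d1 * RtoC t + d2 * RtoC t ^ 2 + d3 * RtoC t ^ 3))%C) in *.
    match goal with |- Cmod ?z <= _ => replace z with
      (e * g + ((c1 * RtoC t) * e' + ((c2 * RtoC t ^ 2) * e' + ((c3 * RtoC t ^ 3) * e' +
       ((c1 * d3 + c2 * d2 + c3 * d1) * RtoC t ^ 4 + ((c2 * d3 + c3 * d2) * RtoC t ^ 5 + (c3 * d3) * RtoC t ^ 6))))))%C
      by (unfold e, e'; ring) end.
    assert (P : forall (c : C) (k : nat), Cmod c <= B -> Cmod (c * RtoC t ^ k * e') <= (B * B') * x ^ 4).
    { intros c k Hc. rewrite !Cmod_mult, Cmod_pow, Cmod_R. fold x.
      replace (B * B' * x ^ 4) with ((B * 1) * (B' * x ^ 4)) by ring.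
      assert (0 <= x ^ k) by now apply pow_le. assert (x ^ k <= 1) by (rewrite <- (pow1 k); apply pow_incr; lra).
      generalize (Cmod_ge_0 c); intros.
      apply Rmult_le_compat; [apply Rmult_le_pos; assumption | apply Cmod_ge_0 | apply Rmult_le_compat; assumption | exact K4]. }
    assert (Q : forall (c : C) (k : nat) m, Cmod c <= m -> Cmod (c * RtoC t ^ k) <= m * x ^ k).
    { intros c k m Hc. rewrite Cmod_mult, Cmod_pow, Cmod_R. fold x. apply Rmult_le_compat_r; [now apply pow_le | exact Hc]. }
    (* The weights 4, 1, 1, 1, 3, 2, 1 add up to the constant 13. *)
    apply Rle_trans with (4 * (B * B') * x ^ 4 + (B * B' * x ^ 4 + (B * B' * x ^ 4 + (B * B' * x ^ 4 +
      (3 * (B * B') * x ^ 4 + (2 * (B * B') * x ^ 5 + (B * B') * x ^ 6)))))).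
    + repeat apply Cmod_triangle_le.
      * rewrite Cmod_mult. apply Rle_trans with ((B * x ^ 4) * (4 * B')).
        -- apply Rmult_le_compat; try apply Cmod_ge_0; [exact H4|]. nra.
        -- right; ring.
      * generalize (P c1 1%nat H1). rewrite Cpow_1_r. trivial.
      * now apply P.
      * now apply P.
      * apply Q. replace (3 * (B * B')) with (B * B' + B * B' + B * B') by ring.
        apply Cmod_triangle_le; [apply Cmod_triangle_le|]; now apply M.
      * apply Q. replace (2 * (B * B')) with (B * B' + B * B') by ring. apply Cmod_triangle_le; now apply M.
      * apply Q. now apply M.
    + assert (B * B' * x ^ 5 <= B * B' * x ^ 4) by (now apply Rmult_le_compat_l).
      assert (B * B' * x ^ 6 <= B * B' * x ^ 4) by (now apply Rmult_le_compat_l).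
      fold x; lra.
Qed.

(** ** Families of jets with uniform bounds *)

Section JetFamilies.
Variable P : C -> Prop.

(** The coefficients may depend on the parameter [L], but [B] and [r] may not: this is what later
    makes the estimates locally uniform in [z]. *)
Definition jets (f : C -> R -> C) (c1 c2 c3 : C -> C) : Prop :=
  exists B r, 0 <= B /\ 0 < r <= 1 /\ forall L, P L -> forall t, Rabs t <= r ->
    jet t (f L t) (c1 L) (c2 L) (c3 L) B.

Lemma jets_ext f c1 c2 c3 g d1 d2 d3 : jets f c1 c2 c3 ->
  (forall L, P L -> (forall t, f L t = g L t) /\ c1 L = d1 L /\ c2 L = d2 L /\ c3 L = d3 L) ->
  jets g d1 d2 d3.
Proof.
  intros (B & r & HB & Hr & H) E. exists B, r. split; [exact HB|]. split; [exact Hr|].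
  intros L HL t Ht. destruct (E L HL) as (E0 & <- & <- & <-). rewrite <- E0. now apply H.
Qed.

Lemma jets_plus f c1 c2 c3 g d1 d2 d3 : jets f c1 c2 c3 -> jets g d1 d2 d3 ->
  jets (fun L t => f L t + g L t)%C (fun L => c1 L + d1 L)%C (fun L => c2 L + d2 L)%C (fun L => c3 L + d3 L)%C.
Proof.
  intros (B & r & HB & Hr & H) (B' & r' & HB' & Hr' & H').
  exists (B + B'), (Rmin r r'). split; [lra|].
  split; [split; [apply Rmin_pos; lra | generalize (Rmin_l r r'); lra]|].
  intros L HL t Ht. generalize (Rmin_l r r') (Rmin_r r r'); intros.
  apply jet_plus; [apply H | apply H']; try assumption; lra.
Qed.

Lemma jets_scal (k : C -> C) f c1 c2 c3 : (exists K, forall L, P L -> Cmod (k L) <= K) -> jets f c1 c2 c3 ->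
  jets (fun L t => k L * f L t)%C (fun L => k L * c1 L)%C (fun L => k L * c2 L)%C (fun L => k L * c3 L)%C.
Proof.
  intros [K HK] (B & r & HB & Hr & H). exists (Rmax 0 K * B), r.
  split; [apply Rmult_le_pos; [apply Rmax_l | exact HB]|]. split; [exact Hr|].
  intros L HL t Ht. apply jet_scal; [|now apply H]. eapply Rle_trans; [now apply HK | apply Rmax_r].
Qed.

Lemma jets_mult f c1 c2 c3 g d1 d2 d3 : jets f c1 c2 c3 -> jets g d1 d2 d3 ->
  jets (fun L t => f L t * g L t)%C (fun L => 0) (fun L => c1 L * d1 L)%C (fun L => c1 L * d2 L + c2 L * d1 L)%C.
Proof.
  intros (B & r & HB & Hr & H) (B' & r' & HB' & Hr' & H').
  exists (13 * (B * B')), (Rmin r r'). split; [nra|].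
  split; [split; [apply Rmin_pos; lra | generalize (Rmin_l r r'); lra]|].
  intros L HL t Ht. generalize (Rmin_l r r') (Rmin_r r r'); intros.
  eapply jet_mult; [lra | apply H; try assumption; lra | apply H'; try assumption; lra].
Qed.

Lemma jets_small f c1 c2 c3 (e : R) : 0 < e -> jets f c1 c2 c3 ->
  exists B r, 0 <= B /\ 0 < r <= 1 /\ forall L, P L -> forall t, Rabs t <= r ->
    jet t (f L t) (c1 L) (c2 L) (c3 L) B /\ Cmod (f L t) <= 4 * B * Rabs t /\ Cmod (f L t) <= e.
Proof.
  intros He (B & r & HB & Hr & H).
  assert (Hd : 0 < e / (4 * B + 1)) by (apply Rdiv_lt_0_compat; lra).
  exists B, (Rmin r (e / (4 * B + 1))). split; [exact HB|].
  split; [split; [apply Rmin_pos; lra | generalize (Rmin_l r (e / (4 * B + 1))); lra]|].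
  intros L HL t Ht. generalize (Rmin_l r (e / (4 * B + 1))) (Rmin_r r (e / (4 * B + 1))); intros.
  assert (Hj : jet t (f L t) (c1 L) (c2 L) (c3 L) B) by (apply H; [exact HL | lra]).
  assert (Hsz : Cmod (f L t) <= 4 * B * Rabs t) by (eapply jet_size; [|exact Hj]; lra).
  split; [exact Hj|]. split; [exact Hsz|].
  eapply Rle_trans; [exact Hsz|].
  apply Rle_trans with ((4 * B + 1) * (e / (4 * B + 1))); [|right; field; lra].
  apply Rmult_le_compat; [lra | apply Rabs_pos | lra | lra].
Qed.

Lemma pow4_error (a b x : R) : 0 <= a -> a <= b * x -> a ^ 4 <= b ^ 4 * x ^ 4.
Proof. intros Ha H. rewrite <- Rpow_mult_distr. now apply pow_incr. Qed.

(** Composition with the cubic Taylor polynomial of the exponential. The factor 0 in [0 * c2 L] is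
    the first coefficient of the square of [f], as produced by [jets_mult]. *)
Lemma jets_exp f c1 c2 c3 : jets f c1 c2 c3 ->
  jets (fun L t => Cexp (f L t) - 1)%C c1 (fun L => c2 L + / 2 * (c1 L * c1 L))%C
    (fun L => c3 L + / 2 * (c1 L * c2 L + c2 L * c1 L) + / 6 * (0 * c2 L + (c1 L * c1 L) * c1 L))%C.
Proof.
  intros Hf.
  eassert (H2 : jets _ _ _ _) by (eapply jets_mult; [exact Hf | exact Hf]).
  eassert (H3 : jets _ _ _ _) by (eapply jets_mult; [exact H2 | exact Hf]).
  eassert (Hs : jets _ _ _ _).
  { eapply jets_plus; [eapply jets_plus; [exact Hf|]|].
    - apply (jets_scal (fun _ => / 2)%C); [exists (Cmod (/ 2)); intros; lra | exact H2].
    - apply (jets_scal (fun _ => / 6)%C); [exists (Cmod (/ 6)); intros; lra | exact H3]. }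
  cbv beta in Hs. destruct Hs as (B' & r' & HB' & Hr' & Hs).
  destruct (jets_small f c1 c2 c3 1 Rlt_0_1 Hf) as (B & r & HB & Hr & Hsm).
  exists (B' + (4 * B) ^ 4 * exp 1), (Rmin r r').
  pose proof (exp_pos 1) as He1.
  assert (HK : 0 <= (4 * B) ^ 4 * exp 1) by (apply Rmult_le_pos; [apply pow_le|]; lra).
  split; [lra|]. split; [split; [apply Rmin_pos; lra | generalize (Rmin_l r r'); lra]|].
  intros L HL t Ht. generalize (Rmin_l r r') (Rmin_r r r'); intros.
  destruct (Hsm L HL t ltac:(lra)) as (_ & Hsz & H1).
  pose proof (Hs L HL t ltac:(lra)) as Hj.
  replace (c1 L + / 2 * 0 + / 6 * 0)%C with (c1 L) in Hj by ring.
  replace (c2 L + / 2 * (c1 L * c1 L) + / 6 * (0 * c1 L))%C with (c2 L + / 2 * (c1 L * c1 L))%C in Hj by ring.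
  eapply jet_error; [exact HK | | exact Hj].
  match goal with |- Cmod ?z <= _ => replace z with
    (Cexp (f L t) - 1 - f L t - f L t * f L t / 2 - f L t * f L t * f L t / 6)%C by (unfold Cdiv; ring) end.
  eapply Rle_trans; [apply (Cexp_remainder_4 _ 1); [generalize (Re_le_Cmod (f L t)); lra | lra]|].
  replace ((4 * B) ^ 4 * exp 1 * Rabs t ^ 4) with ((4 * B) ^ 4 * Rabs t ^ 4 * exp 1) by ring.
  apply Rmult_le_compat_r; [lra|]. apply pow4_error; [apply Cmod_ge_0 | exact Hsz].
Qed.

Lemma jets_log f c1 c2 c3 : jets f c1 c2 c3 ->
  jets (fun L t => Clog (1 + f L t))%C c1 (fun L => c2 L + - / 2 * (c1 L * c1 L))%C
    (fun L => c3 L + - / 2 * (c1 L * c2 L + c2 L * c1 L) + / 3 * (0 * c2 L + (c1 L * c1 L) * c1 L))%C.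
Proof.
  intros Hf.
  eassert (H2 : jets _ _ _ _) by (eapply jets_mult; [exact Hf | exact Hf]).
  eassert (H3 : jets _ _ _ _) by (eapply jets_mult; [exact H2 | exact Hf]).
  eassert (Hs : jets _ _ _ _).
  { eapply jets_plus; [eapply jets_plus; [exact Hf|]|].
    - apply (jets_scal (fun _ => - / 2)%C); [exists (Cmod (- / 2)); intros; lra | exact H2].
    - apply (jets_scal (fun _ => / 3)%C); [exists (Cmod (/ 3)); intros; lra | exact H3]. }
  cbv beta in Hs. destruct Hs as (B' & r' & HB' & Hr' & Hs).
  destruct (jets_small f c1 c2 c3 (1 / 2) ltac:(lra) Hf) as (B & r & HB & Hr & Hsm).
  exists (B' + (4 * B) ^ 4 * 2), (Rmin r r').
  assert (HK : 0 <= (4 * B) ^ 4 * 2) by (apply Rmult_le_pos; [apply pow_le|]; lra).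
  split; [lra|]. split; [split; [apply Rmin_pos; lra | generalize (Rmin_l r r'); lra]|].
  intros L HL t Ht. generalize (Rmin_l r r') (Rmin_r r r'); intros.
  destruct (Hsm L HL t ltac:(lra)) as (_ & Hsz & H1).
  pose proof (Hs L HL t ltac:(lra)) as Hj.
  replace (c1 L + - / 2 * 0 + / 3 * 0)%C with (c1 L) in Hj by ring.
  replace (c2 L + - / 2 * (c1 L * c1 L) + / 3 * (0 * c1 L))%C with (c2 L + - / 2 * (c1 L * c1 L))%C in Hj by ring.
  eapply jet_error; [exact HK | | exact Hj].
  match goal with |- Cmod ?z <= _ => replace z with
    (Clog (1 + f L t) - (f L t - f L t * f L t / 2 + f L t * f L t * f L t / 3))%C by (unfold Cdiv; ring) end.
  eapply Rle_trans; [apply Clog_1_plus; lra|].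
  replace ((4 * B) ^ 4 * 2 * Rabs t ^ 4) with ((4 * B) ^ 4 * Rabs t ^ 4 * 2) by ring.
  apply Rmult_le_compat_r; [lra|]. apply pow4_error; [apply Cmod_ge_0 | exact Hsz].
Qed.

End JetFamilies.

(** * The phase function at the saddle point *)

(* [occ y (L x) / occ y L] at [x = contour s t], where [L] is the saddle point;
   only [L] remains of the dependence on [y]. *)
Definition rel_occ (vth s : R) (L : C) (t : R) : C :=
  (1 + / (RtoC vth * L) * (Cexp (L * (RtoC s * (cis t - 1))) - 1))%C.

Definition phase (vth s : R) (L : C) (t : R) : C :=
  (RtoC vth * Clog (rel_occ vth s L t) - Clog (contour s t))%C.

Lemma jets_cis (P : C -> Prop) :
  jets P (fun _ t => cis t - 1)%C (fun _ => Ci) (fun _ => - / 2)%C (fun _ => - / 6 * Ci)%C.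
Proof.
  assert (HCi : (Ci * Ci)%C = (- (1))%C) by (apply Ceq; unfold Re, Im; simpl; ring).
  exists 1, 1. split; [lra|]. split; [lra|]. intros L _ t _. 
  assert (H2 : Cmod (/ 2) = / 2) by (rewrite Cmod_inv, Cmod_RtoC_pos by (try (intros E; apply RtoC_inj in E); lra); lra).
  assert (H6 : Cmod (/ 6) = / 6) by (rewrite Cmod_inv, Cmod_RtoC_pos by (try (intros E; apply RtoC_inj in E); lra); lra).
  repeat split.
  - rewrite Cmod_Ci. lra.
  - rewrite Cmod_opp, H2. lra.
  - rewrite Cmod_mult, Cmod_opp, H6, Cmod_Ci. lra.
  - unfold cis. set (w := (Ci * RtoC t)%C).
    match goal with |- Cmod ?z <= _ => replace z with (Cexp w - 1 - w - w * w / 2 - w * w * w / 6)%C end.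
    + eapply Rle_trans; [apply (Cexp_remainder_4 w 0); [unfold w, Re; simpl; lra | lra]|].
      rewrite exp_0. unfold w. rewrite Cmod_mult, Cmod_Ci, Cmod_R, Rmult_1_l. lra.
    + unfold w. replace (Ci * RtoC t * (Ci * RtoC t))%C with (Ci * Ci * (RtoC t * RtoC t))%C by ring.
      rewrite HCi. simpl. field.
Qed.

(** That the coefficient of [t] vanishes expresses that [L] is the saddle point. The cubic
    coefficient is existential because it enters only through its bound, its term being odd. *)
Lemma phase_expansion (vth s l : R) : 0 < vth -> 0 < s <= 1 -> 0 < l ->
  exists b : C -> C, jets (fun L => l <= Cmod L <= 3 * l) (phase vth s) (fun _ => 0)
    (fun L => - ((L + 1 - / RtoC vth) * RtoC (s * s) / 2))%C b.
Proof.
  intros Hvth Hs Hl. set (P := fun L : C => l <= Cmod L <= 3 * l).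
  assert (Hv0 : RtoC vth <> 0) by (intros E; apply RtoC_inj in E; lra).
  eassert (Hd : jets P _ _ _ _).
  { apply (jets_scal P (fun _ => RtoC s)); [exists s; intros; rewrite Cmod_RtoC_pos; lra | apply jets_cis]. }
  eassert (Hv : jets P _ _ _ _).
  { apply (jets_scal P (fun L => L)); [exists (3 * l); intros L [_ HL]; exact HL | exact Hd]. }
  eassert (Hu : jets P _ _ _ _).
  { apply (jets_scal P (fun L => / (RtoC vth * L))%C); [|apply (jets_exp P); exact Hv].
    exists (/ (vth * l)). intros L [HL _].
    assert (L <> 0) by (apply Cmod_gt_0; lra).
    rewrite Cmod_inv, Cmod_mult, Cmod_RtoC_pos by (try apply Cmult_neq_0; try assumption; lra).
    apply Rinv_le_contravar; nra. }
  eassert (Hp : jets P _ _ _ _).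
  { apply (jets_plus P).
    - apply (jets_scal P (fun _ => RtoC vth)); [exists vth; intros; rewrite Cmod_RtoC_pos; lra|].
      apply (jets_log P). exact Hu.
    - apply (jets_scal P (fun _ => - (1))%C); [exists 1; intros; rewrite Cmod_opp, Cmod_1; lra|].
      apply (jets_log P). exact Hd. }
  cbv beta in Hp. eexists. eapply (jets_ext P); [exact Hp|].
  intros L [HL _]. assert (HL0 : L <> 0) by (apply Cmod_gt_0; lra).
  assert (HCi : (Ci * Ci)%C = (- (1))%C) by (apply Ceq; unfold Re, Im; simpl; ring).
  split; [|split; [|split; [|reflexivity]]].
  - intros t. unfold phase, rel_occ, contour. ring.
  - field. split; assumption.
  - rewrite RtoC_mult.
    match goal with |- ?lhs = _ => replace lhs with
     ((RtoC vth * (/ (RtoC vth * L) * (L * (RtoC s * - / 2) + / 2 * (L * (RtoC s) * (L * (RtoC s)) * (Ci * Ci))) +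
        - / 2 * (/ (RtoC vth * L) * (L * (RtoC s)) * (/ (RtoC vth * L) * (L * (RtoC s))) * (Ci * Ci)))) +
        - (1) * (RtoC s * - / 2 + - / 2 * (RtoC s * RtoC s * (Ci * Ci))))%C by ring end.
    rewrite HCi. field. split; assumption.
Qed.

(** * Uniform neighbourhoods by compactness, and the asymptotics of the saddle integral *)

(** Compactness of the rectangle turns radii that vary from point to point into one radius, and the
    resulting tube overlaps the rectangle on all sides. The predicate may mention the radius, so
    that a strict inequality yields a uniform gap. *)
Lemma tube_lemma (a b a' b' : R) (L0 : C) (P : R -> C -> R -> R -> Prop) : a <= b -> a' <= b' ->
  (forall e e' L u t, 0 < e' <= e -> P e L u t -> P e' L u t) ->
  (forall u t, a <= u <= b -> a' <= t <= b' -> exists e, 0 < e /\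
     forall L u' t', Cmod (L - L0) < e -> Rabs (u' - u) < e -> Rabs (t' - t) < e -> P e L u' t') ->
  exists e, 0 < e /\ forall L u t, Cmod (L - L0) < e -> a - e < u < b + e -> a' - e < t < b' + e -> P e L u t.
Proof.
  intros Hab Hab' Hmono Hloc.
  (* The radius is halved: a point of the tube is first moved by less than [d] into the rectangle
     and then compared with a centre whose radius is at least [d]. *)
  assert (Hd : forall p : R * R, exists d : posreal, a <= fst p <= b -> a' <= snd p <= b' ->
     forall L u' t', Cmod (L - L0) < 2 * d -> Rabs (u' - fst p) < 2 * d -> Rabs (t' - snd p) < 2 * d -> P (2 * d) L u' t').
  { intros [u t]. destruct (classic (a <= u <= b /\ a' <= t <= b')) as [[Hu Ht]|Hn].
    - destruct (Hloc u t Hu Ht) as [e [He H]]. exists (mkposreal (e / 2) ltac:(lra)). intros _ _. simpl.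
      replace (2 * (e / 2)) with e by field. exact H.
    - exists (mkposreal 1 Rlt_0_1). simpl. tauto. }
  pose (delta := fun u t => proj1_sig (constructive_indefinite_description _ (Hd (u, t)))).
  destruct (compactness_value_2d a b a' b' delta) as [d Hcover].
  exists d. split; [apply cond_pos|]. intros L u t HL Hu Ht.
  assert (Proj : forall lo hi x, lo <= hi -> lo - d < x < hi + d -> exists y, lo <= y <= hi /\ Rabs (x - y) < d).
  { intros lo hi x Hlh Hx. pose proof (cond_pos d).
    destruct (Rlt_dec x lo); [exists lo; split; [lra | apply Rabs_lt_between; lra]|].
    destruct (Rlt_dec hi x); [exists hi; split; [lra | apply Rabs_lt_between; lra]|].
    exists x. split; [lra|]. rewrite Rminus_diag, Rabs_R0. lra. }
  destruct (Proj a b u Hab Hu) as [x [Hx Hux]]. destruct (Proj a' b' t Hab' Ht) as [y [Hy Hty]].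
  destruct (NNPP _ (Hcover x y Hx Hy)) as (u0 & v0 & Hu0 & Hv0 & H1 & H2 & H3).
  unfold delta in *. destruct (constructive_indefinite_description _ (Hd (u0, v0))) as [r Hr]. simpl in *.
  pose proof (cond_pos d).
  apply (Hmono (2 * r)); [lra|]. apply Hr; try assumption; try lra.
  - replace (u - u0) with ((u - x) + (x - u0)) by ring. eapply Rle_lt_trans; [apply Rabs_triang|]. lra.
  - replace (t - v0) with ((t - y) + (y - v0)) by ring. eapply Rle_lt_trans; [apply Rabs_triang|]. lra.
Qed.

Lemma locally_C_Cmod (L0 : C) (P : C -> Prop) : locally (T := C_UniformSpace) L0 P ->
  exists e, 0 < e /\ forall L, Cmod (L - L0) < e -> P L.
Proof.
  intros [e H]. exists e. split; [apply cond_pos|]. intros L HL. apply H.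
  apply C_NormedModule_mixin_compat1. exact HL.
Qed.

Lemma locally_triple (L0 : C) (u t : R) (P : C * (R * R) -> Prop) :
  locally (T := prod_UniformSpace C_UniformSpace (prod_UniformSpace R_UniformSpace R_UniformSpace)) (L0, (u, t)) P ->
  exists e, 0 < e /\ forall L u' t', Cmod (L - L0) < e -> Rabs (u' - u) < e -> Rabs (t' - t) < e -> P (L, (u', t')).
Proof.
  intros [e H]. exists e. split; [apply cond_pos|]. intros L u' t' HL Hu Ht. apply H.
  split; [|split]; simpl; [apply C_NormedModule_mixin_compat1; exact HL | exact Hu | exact Ht].
Qed.

Lemma ccont_rel_occ (vth s : R) (L0 : C) (u t : R) : 0 < vth -> L0 <> 0 ->
  ccont (U := prod_UniformSpace C_UniformSpace (prod_UniformSpace R_UniformSpace R_UniformSpace))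
    (fun p => rel_occ vth s (fst p) (snd (snd p))) (L0, (u, t)).
Proof.
  intros Hv HL.
  set (U := prod_UniformSpace C_UniformSpace (prod_UniformSpace R_UniformSpace R_UniformSpace)).
  assert (C1 : ccont (U := U) (fun p => fst p) (L0, (u, t))).
  { apply (ccont_comp (V := C_UniformSpace) fst (fun z => z)); [apply continuous_fst | apply ccont_id]. }
  assert (C2 : ccont (U := U) (fun p => cis (snd (snd p))) (L0, (u, t))).
  { apply (ccont_comp (V := R_UniformSpace) (fun p : U => snd (snd p)) cis); [|apply cis_cont].
    apply (continuous_comp snd snd); apply continuous_snd. }
  assert (Hv0 : RtoC vth <> 0) by (intros E; apply RtoC_inj in E; lra).
  unfold rel_occ. apply ccont_plus; [apply ccont_const|]. apply ccont_mult.
  - apply ccont_inv; [apply ccont_mult; [apply ccont_const | exact C1] | now apply Cmult_neq_0].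
  - apply ccont_minus; [|apply ccont_const]. apply ccont_Cexp, ccont_mult; [exact C1|].
    apply ccont_mult; [apply ccont_const|]. apply ccont_minus; [exact C2 | apply ccont_const].
Qed.

(** The strict inequality at [L0] persists with a gap for nearby complex [L], provided [t] stays
    away from 0, where both sides equal 1; near 0 the expansion of the phase takes over. *)
Lemma rel_occ_tube (vth s L0 t2 : R) : 0 < vth -> 1 / 2 < s <= 1 -> 0 < L0 -> 0 < t2 ->
  (forall t, Rabs t <= PI -> t <> 0 ->
     Cmod (rel_occ vth s (RtoC L0) t) < exp (ln (Cmod (contour s t)) / vth)) ->
  exists e, 0 < e /\ forall L t, Cmod (L - RtoC L0) < e -> t2 <= Rabs t <= PI ->
     Cmod (rel_occ vth s L t) <= exp (ln (Cmod (contour s t)) / vth - e).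
Proof.
  intros Hv Hs HL Ht2 Hmod.
  assert (HL0 : RtoC L0 <> 0) by (intros E; apply RtoC_inj in E; lra).
  set (Q := fun t => exp (ln (Cmod (contour s t)) / vth)) in *.
  destruct (tube_lemma 0 0 (- PI) PI (RtoC L0)
     (fun e L _ t => t2 <= Rabs t -> Cmod (rel_occ vth s L t) <= Q t - e)) as [e [He H]].
  - lra.
  - apply PI_opp_le.
  - intros e e' L u t [He He'] HP Ht. specialize (HP Ht). lra.
  - intros u t _ Ht. destruct (Rlt_dec (Rabs t) t2) as [Hlt|Hge].
    + exists (t2 - Rabs t). split; [lra|]. intros L u' t' _ _ Ht' Ht2'. exfalso.
      generalize (Rabs_triang (t' - t) t). replace (t' - t + t) with t' by ring. lra.
    + assert (Hd : 0 < Q t - Cmod (rel_occ vth s (RtoC L0) t)).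
      { apply Rlt_0_minus, Hmod; [apply Rabs_le_between; lra|]. intros ->. rewrite Rabs_R0 in Hge. lra. }
      set (d := Q t - Cmod (rel_occ vth s (RtoC L0) t)) in *.
      set (U := prod_UniformSpace C_UniformSpace (prod_UniformSpace R_UniformSpace R_UniformSpace)).
      assert (HF : continuous (T := U) (fun p => Q (snd (snd p)) - Cmod (rel_occ vth s (fst p) (snd (snd p)))) (RtoC L0, (u, t))).
      { apply (continuous_minus (V := R_NormedModule)).
        - apply (continuous_comp (fun p : U => snd (snd p)) Q).
          { apply (continuous_comp snd snd); apply continuous_snd. }
          unfold Q. apply (continuous_comp (fun r => ln (Cmod (contour s r)) / vth) exp); [|apply continuous_exp].
          apply (continuous_mult (K := R_AbsRing)); [|apply continuous_const].
          apply (continuous_comp (fun r => Cmod (contour s r)) ln); [apply ccont_Cmod, contour_cont|].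
          apply continuous_derivable.
          eexists. apply is_derive_ln. generalize (Cmod_contour_ge s Hs t). simpl. lra.
        - apply ccont_Cmod. now apply ccont_rel_occ. }
      assert (HF2 : locally (T := U) (RtoC L0, (u, t)) (fun p => d / 2 < Q (snd (snd p)) - Cmod (rel_occ vth s (fst p) (snd (snd p))))).
      { apply (HF (fun x => d / 2 < x)). apply (open_gt (d / 2)). simpl. fold d. lra. }
      destruct (locally_triple _ _ _ _ HF2) as [e [He H]].
      exists (Rmin e (d / 2)). generalize (Rmin_l e (d / 2)) (Rmin_r e (d / 2)); intros.
      split; [apply Rmin_pos; lra|]. intros L u' t' HL1 Hu1 Ht1 _.
      specialize (H L u' t' ltac:(lra) ltac:(lra) ltac:(lra)). simpl in H. lra.
  - exists e. split; [exact He|]. intros L t HLe [Ht Ht'].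
    apply Rabs_le_between in Ht'.
    specialize (H L 0 t HLe ltac:(lra) ltac:(lra) Ht).
    eapply Rle_trans; [exact H|]. unfold Rminus. rewrite exp_plus. fold (Q t).
    (* Since [Q t <= 1], the additive gap becomes a factor:
       [Q t - e <= Q t (1 - e) <= Q t exp (- e)]. *)
    assert (HQ : 0 < Q t <= 1).
    { split; [apply exp_pos|]. unfold Q. rewrite <- exp_0. apply exp_le.
      assert (ln (Cmod (contour s t)) <= 0).
      { rewrite <- ln_1. apply ln_le; [generalize (Cmod_contour_ge s Hs t); lra | now apply Cmod_contour_le]. }
      apply Rle_div_l; lra. }
    generalize (exp_ineq1_le (- e)). intros. nra.
Qed.

(** Near [L0] the number [q] is close to the positive real [s * sqrt a0], so the segment from 1 to
    [q] stays close to the positive axis and away from 0, as [gaussian_rotation] requires. *)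
Lemma Csqrt_path (s a0 : R) (vth : R) (L0 : R) : 0 < s -> a0 = L0 + 1 - / vth -> 0 < a0 ->
  exists e m K, 0 < e /\ 0 < m /\ forall L, Cmod (L - RtoC L0) < e ->
   let q := (RtoC s * Csqrt (L + 1 - RtoC (/ vth)))%C in
   m <= Cmod q /\ Cmod (q - 1) <= K /\
   forall u, 0 <= u <= 1 -> m ^ 2 <= Re ((1 + RtoC u * (q - 1)) * (1 + RtoC u * (q - 1))) / 2.
Proof.
  intros Hs Ea Ha.
  set (f := fun L : C_UniformSpace => (RtoC s * Csqrt (L + 1 - RtoC (/ vth)))%C).
  assert (E1 : (RtoC L0 + 1 - RtoC (/ vth))%C = RtoC a0).
  { rewrite Ea, RtoC_minus, RtoC_plus. reflexivity. }
  assert (E0 : f (RtoC L0) = RtoC (s * sqrt a0)).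
  { unfold f. rewrite E1, Csqrt_RtoC by exact Ha. now rewrite RtoC_mult. }
  set (q0 := s * sqrt a0) in *.
  assert (Hq0 : 0 < q0) by (apply Rmult_lt_0_compat; [exact Hs | now apply sqrt_lt_R0]).
  assert (Hc : ccont f (RtoC L0)).
  { unfold f. apply ccont_mult; [apply ccont_const|]. apply ccont_Csqrt.
    - apply ccont_minus; [|apply ccont_const]. apply ccont_plus; [apply ccont_id | apply ccont_const].
    - rewrite E1. apply slit_Re. exact Ha. }
  set (m := Rmin 1 q0). assert (Hm : 0 < m) by (apply Rmin_pos; lra).
  assert (Hm1 : m <= 1) by apply Rmin_l. assert (Hmq : m <= q0) by apply Rmin_r.
  destruct (locally_C_Cmod _ _ (ccont_near f (RtoC L0) (m / 4) ltac:(lra) Hc)) as [e [He H]].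
  (* On the segment the real part is at least [3 m / 4] and the imaginary part at most [m / 4] in
     modulus, so half the real part of the square is at least [(m / 2)^2]. *)
  exists e, (m / 2), (m / 4 + q0 + 1). split; [exact He|]. split; [lra|].
  intros L HL q. specialize (H L HL). fold (f L) in q. rewrite E0 in H. fold q in H.
  change (f L) with q in H.
  pose proof (re_le_Cmod (q - RtoC q0)) as HRe. pose proof (Rabs_Im_le_Cmod (q - RtoC q0)) as HIm.
  assert (R1 : Re (q - RtoC q0) = Re q - q0) by (unfold Re; simpl; ring).
  assert (I1 : Im (q - RtoC q0) = Im q) by (unfold Im; simpl; ring).
  rewrite R1 in HRe. rewrite I1 in HIm.
  assert (HRe' := proj1 (Rabs_le_between _ _) (Rle_trans _ _ _ HRe (Rlt_le _ _ H))).
  assert (HIm' := proj1 (Rabs_le_between _ _) (Rle_trans _ _ _ HIm (Rlt_le _ _ H))).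
  split; [|split].
  - generalize (Re_le_Cmod q). lra.
  - replace (q - 1)%C with ((q - RtoC q0) + (RtoC q0 - 1))%C by ring.
    eapply Rle_trans; [apply Cmod_triangle_le; [apply Rlt_le, H | apply Cmod_minus_le]|].
    rewrite Cmod_1, Cmod_RtoC_pos; lra.
  - intros u Hu.
    assert (R2 : Re (1 + RtoC u * (q - 1)) = 1 + u * (Re q - 1)) by (unfold Re; simpl; ring).
    assert (I2 : Im (1 + RtoC u * (q - 1)) = u * Im q) by (unfold Im; simpl; ring).
    rewrite re_mult, R2, I2.
    assert (3 / 4 * m <= 1 + u * (Re q - 1)).
    { replace (1 + u * (Re q - 1)) with ((1 - u) * 1 + u * Re q) by ring. nra. }
    assert (- (m / 4) <= u * Im q <= m / 4) by nra.
    nra.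
Qed.

(** [U] stands for the power of [rel_occ] with exponent [vth n], however it is defined: only its
    modulus on the whole circle and its branch near [t = 0] matter. The result is relative to the
    Gaussian integral with parameter 1, which is common to all saddles. *)
Lemma saddle_asymptotics (vth s L0 t0 : R) : 0 < vth -> 1 / 2 < s <= 1 -> 0 < L0 ->
  0 < L0 + 1 - / vth -> 0 < t0 ->
  (forall t, Rabs t <= PI -> t <> 0 ->
     Cmod (rel_occ vth s (RtoC L0) t) < exp (ln (Cmod (contour s t)) / vth)) ->
  exists eta M, 0 < eta /\ forall (L : C) (n : nat) (U : R -> C),
    Cmod (L - RtoC L0) < eta -> (1 <= n)%nat -> ccont_on U (- PI) PI ->
    (forall t r, Rabs t <= PI -> Cmod (rel_occ vth s L t) <= exp r -> Cmod (U t) <= exp (vth * INR n * r)) ->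
    (forall t, Rabs t <= t0 -> U t = Cexp (RtoC (vth * INR n) * Clog (rel_occ vth s L t))) ->
    Cmod (CInt (fun t => U t / contour s t ^ n * weight s t)%C (- PI) PI
      - Csqrt (/ (L + 1 - / RtoC vth)) * CInt (gaussian 1 n) (- PI) PI) <= M / (INR n * sqrt (INR n)).
Proof.
  intros Hv Hs HL0 Ha0 Ht0 Hmod.
  assert (HPI := PI_RGT_0).
  set (a0 := L0 + 1 - / vth) in *.
  destruct (phase_expansion vth s (L0 / 2) Hv ltac:(lra) ltac:(lra)) as (b & B & r & HB & Hr & Hjet).
  assert (Hss : 0 < s * s) by nra.
  assert (Has : 0 < a0 * (s * s)) by (now apply Rmult_lt_0_compat).
  (* It will turn out that [Re alpha / 2 >= 2 c0]: one [c0] absorbs the cubic and quartic terms for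
     [|t| <= t2], the other is left as the rate of decay. *)
  set (c0 := a0 * (s * s) / 8).
  set (t2 := Rmin t0 (Rmin r (c0 / (2 * B + 1)))).
  assert (Ht2a : t2 <= t0) by apply Rmin_l.
  assert (Ht2b : t2 <= r) by (eapply Rle_trans; [apply Rmin_r | apply Rmin_l]).
  assert (Ht2c : t2 <= c0 / (2 * B + 1)) by (eapply Rle_trans; [apply Rmin_r | apply Rmin_r]).
  assert (Ht2 : 0 < t2).
  { unfold t2. apply Rmin_pos; [exact Ht0|]. apply Rmin_pos; [lra|]. apply Rdiv_lt_0_compat; unfold c0; lra. }
  destruct (rel_occ_tube vth s L0 t2 Hv Hs HL0 Ht2 Hmod) as [e3 [He3 Htube]].
  destruct (Csqrt_path s a0 vth L0 ltac:(lra) eq_refl Ha0) as (e4 & m & K & He4 & Hm & Hpath).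
  (* On the outer part the gap [vth e3] is rewritten as a Gaussian rate by means of
     [t^2 <= PI^2]. *)
  set (c := Rmin c0 (vth * e3 / PI ^ 2)).
  assert (HPI2 : 0 < PI ^ 2) by (apply pow_lt, HPI).
  assert (Hc : 0 < c) by (apply Rmin_pos; [unfold c0; lra | apply Rdiv_lt_0_compat; [apply Rmult_lt_0_compat|]; assumption]).
  set (B' := B + 1 + (1 + / (2 * s - 1))).
  assert (Hinv : 0 < / (2 * s - 1)) by (apply Rinv_0_lt_compat; lra).
  destruct (laplace_remainder c B' t2 Hc ltac:(unfold B'; lra) Ht2) as [M1 [HM1 Hlap]].
  set (k := m ^ 2 * PI ^ 2). assert (Hk : 0 < k) by (apply Rmult_lt_0_compat; [now apply pow_lt | exact HPI2]).
  exists (Rmin (L0 / 2) (Rmin (a0 / 2) (Rmin e3 e4))).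
  exists (M1 + s / m * (K * (2 * PI) * (INR 2 / k) ^ 2)).
  split; [repeat apply Rmin_pos; lra|].
  intros L n U HL Hn HU HU1 HU2.
  assert (HLa : Cmod (L - RtoC L0) < L0 / 2) by (eapply Rlt_le_trans; [exact HL | apply Rmin_l]).
  assert (HLb : Cmod (L - RtoC L0) < a0 / 2) by (eapply Rlt_le_trans; [exact HL | eapply Rle_trans; [apply Rmin_r | apply Rmin_l]]).
  assert (HLc : Cmod (L - RtoC L0) < e3) by (eapply Rlt_le_trans; [exact HL | do 2 (eapply Rle_trans; [apply Rmin_r|]); apply Rmin_l]).
  assert (HLd : Cmod (L - RtoC L0) < e4) by (eapply Rlt_le_trans; [exact HL | do 2 (eapply Rle_trans; [apply Rmin_r|]); apply Rmin_r]).
  assert (HnR : 1 <= INR n) by (change 1 with (INR 1); now apply le_INR).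
  set (N := INR n) in *.
  assert (HP : L0 / 2 <= Cmod L <= 3 * (L0 / 2)).
  { generalize (Cmod_reverse (RtoC L0) L) (Cmod_triangle (L - RtoC L0) (RtoC L0)).
    replace (L - RtoC L0 + RtoC L0)%C with L by ring.
    rewrite Cmod_minus_sym, Cmod_RtoC_pos by lra. lra. }
  specialize (Hjet L HP).
  set (a := (L + 1 - / RtoC vth)%C) in *.
  set (alpha := (a * RtoC (s * s))%C) in *.
  assert (Hinvv : RtoC (/ vth) = (/ RtoC vth)%C) by (apply RtoC_inv; lra).
  specialize (Hpath L HLd). rewrite Hinvv in Hpath. fold a in Hpath. cbv zeta in Hpath.
  set (q := (RtoC s * Csqrt a)%C) in *. destruct Hpath as (Hqm & HqK & Hqpath).
  assert (Ha : a0 / 2 <= Re a).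
  { unfold a. rewrite <- Hinvv. 
    replace (Re (L + 1 - RtoC (/ vth))) with (a0 + Re (L - RtoC L0)) by (unfold a0, Re; simpl; ring).
    generalize (re_le_Cmod (L - RtoC L0)) (Rabs_le_between (Re (L - RtoC L0)) (Cmod (L - RtoC L0))). lra. }
  assert (Hslit : slit a) by (apply slit_Re; lra).
  assert (Halpha : Re alpha = Re a * (s * s)) by apply re_scal_r.
  assert (HRalpha : 2 * c0 <= Re alpha / 2) by (rewrite Halpha; unfold c0; nra).
  assert (Hcc0 : c <= c0) by apply Rmin_l.
  assert (Hin : forall t, Rabs t <= t2 -> (U t / contour s t ^ n)%C = Cexp (RtoC N * phase vth s L t)).
  { intros t Ht. rewrite HU2 by lra. unfold phase.
    replace (RtoC N * (RtoC vth * Clog (rel_occ vth s L t) - Clog (contour s t)))%C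
      with (RtoC (vth * N) * Clog (rel_occ vth s L t) + - (RtoC N * Clog (contour s t)))%C
      by (rewrite RtoC_mult; ring).
    rewrite Cexp_plus, Cexp_opp. unfold N. rewrite Cexp_pow, Cexp_Clog by (now apply contour_neq_0). reflexivity. }
  assert (Hrho : forall t, Rabs t <= t2 -> exists rho, Cmod rho <= B * Rabs t ^ 4 /\ Cmod (b L) <= B /\
     phase vth s L t = (- (alpha / 2) * RtoC (t ^ 2) + b L * RtoC (t ^ 3) + rho)%C).
  { intros t Ht. destruct (Hjet t ltac:(lra)) as (_ & _ & J3 & J4).
    exists (phase vth s L t - (- (alpha / 2) * RtoC (t ^ 2) + b L * RtoC (t ^ 3)))%C.
    split; [|split; [exact J3 | ring]].
    rewrite !RtoC_pow. eapply Rle_trans; [|exact J4]. right. f_equal. unfold alpha. ring. }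
  assert (Hbound : forall t, Rabs t <= PI -> Cmod (U t / contour s t ^ n) <= exp (- (c * (N * t ^ 2)))).
  { intros t Ht. assert (Hx := Cmod_contour_ge s Hs t). assert (Hx0 := contour_neq_0 s Hs t).
    assert (Ht2N : 0 <= N * t ^ 2) by (apply Rmult_le_pos; [lra | apply pow2_ge_0]).
    destruct (Rle_dec (Rabs t) t2) as [Hle|Hgt].
    - rewrite Hin by exact Hle. rewrite Cmod_Cexp, re_scal_l. apply exp_le.
      destruct (Hrho t Hle) as (rho & Hr1 & Hr2 & ->).
      set (x := Rabs t) in *. pose proof (Rabs_pos t) as Hx1. fold x in Hx1.
      assert (Et : t ^ 2 = x ^ 2) by (unfold x; rewrite RPow_abs; symmetry; apply Rabs_right, Rle_ge, pow2_ge_0).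
      assert (R0 : Re (- (alpha / 2) * RtoC (t ^ 2)) = - (Re alpha / 2 * x ^ 2)).
      { rewrite re_scal_r, <- Et. replace (- (alpha / 2))%C with (RtoC (- / 2) * alpha)%C
          by (rewrite RtoC_opp, RtoC_inv by lra; field). rewrite re_scal_l. field. }
      rewrite !re_plus, R0.
      assert (S1 : Re (b L * RtoC (t ^ 3)) <= B * x ^ 3).
      { eapply Rle_trans; [apply Re_le_Cmod|]. rewrite Cmod_mult, Cmod_R, <- RPow_abs. fold x.
        apply Rmult_le_compat_r; [now apply pow_le | exact Hr2]. }
      assert (S2 : Re rho <= B * x ^ 4) by (eapply Rle_trans; [apply Re_le_Cmod | exact Hr1]).
      assert (Hx1' : x <= 1) by lra.
      assert (S3 : B * x ^ 3 + B * x ^ 4 <= c0 * x ^ 2).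
      { replace (B * x ^ 3 + B * x ^ 4) with ((B * x * (1 + x)) * x ^ 2) by ring.
        apply Rmult_le_compat_r; [now apply pow_le|].
        apply Rle_trans with ((2 * B + 1) * x).
        { assert (0 <= B * x) by (now apply Rmult_le_pos). assert (0 <= B * x * (1 - x)) by (apply Rmult_le_pos; lra). lra. }
        apply Rle_trans with ((2 * B + 1) * (c0 / (2 * B + 1))); [apply Rmult_le_compat_l; lra|].
        right; field; lra. }
      assert (Hx2 : 0 <= x ^ 2) by now apply pow_le.
      assert (S4 : 2 * c0 * x ^ 2 <= Re alpha / 2 * x ^ 2) by (now apply Rmult_le_compat_r).
      assert (S5 : c * x ^ 2 <= c0 * x ^ 2) by (now apply Rmult_le_compat_r).
      rewrite Et. replace (- (c * (N * x ^ 2))) with (N * (- (c * x ^ 2))) by ring.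
      apply Rmult_le_compat_l; lra.
    - rewrite Cmod_div, Cmod_pow by (now apply Cpow_nz).
      specialize (Htube L t HLc ltac:(lra)). specialize (HU1 t _ Ht Htube).
      assert (HX : Cmod (contour s t) ^ n = exp (N * ln (Cmod (contour s t)))).
      { unfold N. rewrite exp_INR_mult, exp_ln by lra. reflexivity. }
      rewrite HX. apply Rle_div_l; [apply exp_pos|]. eapply Rle_trans; [exact HU1|].
      rewrite <- exp_plus. apply exp_le.
      replace (vth * N * (ln (Cmod (contour s t)) / vth - e3)) with
        (N * ln (Cmod (contour s t)) - N * (vth * e3)) by (field; lra).
      assert (Htt : t ^ 2 <= PI ^ 2).
      { rewrite <- (Rabs_right (t ^ 2)) by (apply Rle_ge, pow2_ge_0). rewrite <- RPow_abs.
        apply pow_incr. split; [apply Rabs_pos | exact Ht]. }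
      assert (Hct : c * t ^ 2 <= vth * e3).
      { apply Rle_trans with ((vth * e3 / PI ^ 2) * PI ^ 2); [|right; field; lra].
        apply Rmult_le_compat; [lra | apply pow2_ge_0 | apply Rmin_r | exact Htt]. }
      nra. }
  assert (Hbb : Cmod (b L) <= B).
  { destruct (Hrho 0) as (_ & _ & Hbb & _); [rewrite Rabs_R0; lra | exact Hbb]. }
  specialize (Hlap n (fun t => U t / contour s t ^ n)%C (weight s) alpha (b L) (RtoC s) (RtoC (s * (1 - s)) * Ci)%C Hn).
  assert (HG : ccont_on (fun t => U t / contour s t ^ n)%C (- PI) PI).
  { intros t Ht. apply ccont_div; [now apply HU | apply ccont_pow, contour_cont | now apply Cpow_nz, contour_neq_0]. }
  assert (HA1 : Cmod (RtoC (s * (1 - s)) * Ci) <= B').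
  { rewrite Cmod_mult, Cmod_Ci, Cmod_RtoC_pos by nra. unfold B'. nra. }
  specialize (Hlap HG (fun t _ => weight_cont s Hs t) ltac:(unfold B'; lra)
    ltac:(rewrite Cmod_RtoC_pos by lra; unfold B'; lra) HA1 ltac:(lra) Hbound).
  assert (Hlap' := Hlap ltac:(intros t _; eapply Rle_trans; [apply weight_expansion; exact Hs |];
     apply Rmult_le_compat_r; [apply pow2_ge_0 | unfold B'; lra])). clear Hlap.
  assert (Hlap : Cmod (CInt (fun t => U t / contour s t ^ n * weight s t)%C (- PI) PI
     - RtoC s * CInt (gaussian alpha n) (- PI) PI) <= M1 / (INR n * sqrt (INR n))).
  { apply Hlap'. intros t Ht. destruct (Hrho t Ht) as (rho & Hr1 & _ & E). exists rho. split.
    - replace (t ^ 4) with (Rabs t ^ 4)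
        by (rewrite RPow_abs; apply Rabs_right; replace (t ^ 4) with ((t ^ 2) ^ 2) by ring; apply Rle_ge, pow2_ge_0).
      eapply Rle_trans; [exact Hr1|]. apply Rmult_le_compat_r; [apply pow_le, Rabs_pos | unfold B'; lra].
    - rewrite Hin, E by exact Ht. reflexivity. }
  pose proof (gaussian_rotation q (m ^ 2) n Hqpath) as Hrot.
  assert (Eq : (q * q)%C = alpha).
  { unfold q, alpha. rewrite <- (Csqrt_sqr a) at 3 by (now apply slit_neq_0). rewrite RtoC_mult. ring. }
  rewrite Eq in Hrot.
  assert (Hq0 : q <> 0) by (apply Cmod_gt_0; lra).
  assert (Hs0 : RtoC s <> 0) by (intros E; apply RtoC_inj in E; lra).
  (* The factor [s] from the weight and the [1 / q] from the rotation combine to the square root of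
     the theorem, on the right branch. *)
  assert (Hsq : Csqrt (/ a) = (RtoC s / q)%C).
  { rewrite Csqrt_inv by exact Hslit. unfold q. field. split; [|exact Hs0].
    intros E. apply Hq0. unfold q. rewrite E. ring. }
  rewrite Hsq.
  set (I1 := CInt (fun t => U t / contour s t ^ n * weight s t)%C (- PI) PI) in *.
  set (I2 := CInt (gaussian alpha n) (- PI) PI) in *.
  set (I3 := CInt (gaussian 1 n) (- PI) PI) in *.
  replace (I1 - RtoC s / q * I3)%C with ((I1 - RtoC s * I2) + RtoC s / q * (q * I2 - I3))%C by (field; exact Hq0).
  pose proof (sqrt_lt_R0 N ltac:(lra)) as Hsqrt.
  assert (HNs : 0 < N * sqrt N) by (apply Rmult_lt_0_compat; lra).
  unfold Rdiv at 1. rewrite Rmult_plus_distr_r. apply Cmod_triangle_le; [exact Hlap|].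
  rewrite Cmod_mult, Cmod_div, Cmod_RtoC_pos by (try exact Hq0; lra).
  rewrite (Rmult_assoc (s / m)). apply Rmult_le_compat.
  - apply Rle_mult_inv_pos; lra.
  - apply Cmod_ge_0.
  - apply Rmult_le_compat_l; [lra|]. apply Rinv_le_contravar; lra.
  - eapply Rle_trans; [exact Hrot|].
    apply Rle_trans with (K * (2 * PI * exp (- (m ^ 2 * (INR n * PI ^ 2))))).
    { apply Rmult_le_compat_r; [|exact HqK]. apply Rmult_le_pos; [lra | apply Rlt_le, exp_pos]. }
    assert (HK : 0 <= K) by (generalize (Cmod_ge_0 (q - 1)); lra).
    replace (K * (2 * PI) * (INR 2 / k) ^ 2 * / (N * sqrt N)) with (K * (2 * PI * ((INR 2 / k) ^ 2 / (N * sqrt N))))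
      by (unfold Rdiv; ring).
    apply Rmult_le_compat_l; [exact HK|]. apply Rmult_le_compat_l; [lra|].
    pose proof (pow_le_exp k N 1 Hk ltac:(lra)) as Hpe.
    replace (m ^ 2 * (INR n * PI ^ 2)) with (k * N) by (unfold k, N; ring).
    rewrite exp_Ropp. pose proof (exp_pos (k * N)) as Hek.
    assert (Hsq2 : N * sqrt N <= N ^ 2).
    { assert (sqrt N <= N); [|nra]. rewrite <- (sqrt_Rsqr N) at 2 by lra. apply sqrt_le_1_alt. unfold Rsqr. nra. }
    apply (proj1 (Rle_div_r _ _ _ HNs)). rewrite Rmult_comm.
    apply (proj2 (Rle_div_l _ _ _ Hek)). exact (Rle_trans _ _ _ Hsq2 Hpe).
Qed.

(** * Limits of sequences with geometrically decreasing increments *)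

(** The sequences [a k - 2 C 2^(-k)] and [a k + 2 C 2^(-k)] are monotone and enclose the limit,
    which yields the rate at once. *)
Lemma exists_limit_of_geometric (a : nat -> R) (C : R) : 0 <= C ->
  (forall k, Rabs (a (S k) - a k) <= C * (1 / 2) ^ k) ->
  exists l, forall k, Rabs (a k - l) <= 2 * C * (1 / 2) ^ k.
Proof.
  intros HC H.
  assert (Hstep : forall k, - (C * (1 / 2) ^ k) <= a (S k) - a k <= C * (1 / 2) ^ k).
  { intros k. apply Rabs_le_between, H. }
  set (b := fun k => a k - 2 * C * (1 / 2) ^ k). set (c := fun k => a k + 2 * C * (1 / 2) ^ k).
  assert (Hpow : forall k, 0 <= C * (1 / 2) ^ k) by (intros k; apply Rmult_le_pos; [exact HC | apply pow_le; lra]).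
  assert (Hb : forall k, b k <= b (S k)) by (intros k; unfold b; simpl; generalize (Hstep k); lra).
  assert (Hc : forall k, c (S k) <= c k) by (intros k; unfold c; simpl; generalize (Hstep k); lra).
  assert (Hbj : forall k j, b k <= b (k + j)%nat).
  { intros k j. induction j; [rewrite Nat.add_0_r; lra|]. rewrite Nat.add_succ_r. generalize (Hb (k + j)%nat). lra. }
  assert (Hcj : forall k j, c (k + j)%nat <= c k).
  { intros k j. induction j; [rewrite Nat.add_0_r; lra|]. rewrite Nat.add_succ_r. generalize (Hc (k + j)%nat). lra. }
  assert (Hbc : forall k j, b k <= c j).
  { intros k j. generalize (Hbj k j) (Hcj j k). rewrite (Nat.add_comm j k).
    generalize (Hpow (k + j)%nat). unfold b, c. lra. }
  destruct (completeness (fun x => exists k, x = b k)) as [l [Hl1 Hl2]].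
  - exists (c 0%nat). intros x [k ->]. apply Hbc.
  - exists (b 0%nat). now exists 0%nat.
  - exists l. intros k. apply Rabs_le_between.
    assert (b k <= l) by (apply Hl1; now exists k).
    assert (l <= c k) by (apply Hl2; intros x [j ->]; apply Hbc).
    unfold b, c in *. lra.
Qed.

Lemma exists_climit_of_geometric (a : nat -> C) (C : R) : 0 <= C ->
  (forall k, Cmod (a (S k) - a k) <= C * (1 / 2) ^ k) ->
  exists l, forall k, Cmod (a k - l) <= 4 * C * (1 / 2) ^ k.
Proof.
  intros HC H.
  destruct (exists_limit_of_geometric (fun k => Re (a k)) C HC) as [l1 H1].
  { intros k. eapply Rle_trans; [apply (re_le_Cmod (a (S k) - a k)) | apply H]. }
  destruct (exists_limit_of_geometric (fun k => Im (a k)) C HC) as [l2 H2].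
  { intros k. eapply Rle_trans; [apply (Rabs_Im_le_Cmod (a (S k) - a k)) | apply H]. }
  exists (l1, l2). intros k. eapply Rle_trans; [apply Cmod_le_Re_Im|].
  specialize (H1 k). specialize (H2 k).
  change (Rabs (Re (a k) - l1) + Rabs (Im (a k) - l2) <= 4 * C * (1 / 2) ^ k). lra.
Qed.

(** * Local inversion of [w exp w] *)

Definition wexp (w : C) : C := (w * Cexp w)%C.

Definition dwexp (w : C) : C := ((1 + w) * Cexp w)%C.

(** Both points vary: this gives the contraction in the local inversion, and with [w' = w0] the
    derivative of the inverse. *)
Lemma wexp_strict_diff (w0 : C) (e : R) : 0 < e -> exists r, 0 < r /\
  forall w w', Cmod (w - w0) < r -> Cmod (w' - w0) < r ->
    Cmod (wexp w - wexp w' - dwexp w0 * (w - w')) <= e * Cmod (w - w').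
Proof.
  intros He.
  assert (Hc : ccont (U := C_UniformSpace) dwexp w0).
  { unfold dwexp. apply ccont_mult; [apply ccont_plus; [apply ccont_const | apply ccont_id] | apply ccont_Cexp, ccont_id]. }
  destruct (locally_C_Cmod _ _ (ccont_near dwexp w0 e He Hc)) as [r [Hr H]].
  exists r. split; [exact Hr|]. intros w w' Hw Hw'.
  set (p := fun t => (w' + RtoC t * (w - w'))%C).
  assert (Hp : forall t, cderiv p t (w - w')%C).
  { intros t. unfold p. eapply cderiv_eq; [apply cderiv_plus; [apply cderiv_const | apply cderiv_ray]|]. ring. }
  pose (f := fun t => (wexp (p t) - RtoC t * (dwexp w0 * (w - w')))%C).
  replace (wexp w - wexp w' - dwexp w0 * (w - w'))%C with (f 1 - f 0)%C.
  2:{ unfold f, p. replace (w' + RtoC 1 * (w - w'))%C with w by ring.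
      replace (w' + RtoC 0 * (w - w'))%C with w' by ring. ring. }
  apply (Cmod_increment_le_const f (fun t => (dwexp (p t) - dwexp w0) * (w - w'))%C).
  - intros t _. unfold f, wexp. eapply cderiv_eq.
    + apply cderiv_minus; [|apply cderiv_ray]. apply cderiv_mult; [apply Hp | apply cderiv_Cexp, Hp].
    + unfold dwexp. ring.
  - intros t Ht. rewrite Cmod_mult. apply Rmult_le_compat_r; [apply Cmod_ge_0|].
    apply Rlt_le, H. unfold p.
    replace (w' + RtoC t * (w - w') - w0)%C with (RtoC (1 - t) * (w' - w0) + RtoC t * (w - w0))%C
      by (rewrite RtoC_minus; ring).
    apply Rle_lt_trans with ((1 - t) * Cmod (w' - w0) + t * Cmod (w - w0)).
    + apply Cmod_triangle_le; rewrite Cmod_mult, Cmod_RtoC_pos; lra.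
    + destruct (Req_dec t 1) as [->|Ht1]; [lra|].
      generalize (Cmod_ge_0 (w - w0)). nra.
Qed.

(** Newton's iteration with the derivative frozen at [w0] contracts by 1/2 near [w0], and its fixed
    point solves [wexp w = z]. *)
Lemma wexp_local_inverse (w0 : C) : dwexp w0 <> 0 -> exists K d, 0 < K /\ 0 < d /\
  forall z, Cmod (z - wexp w0) < d -> exists w, wexp w = z /\ Cmod (w - w0) <= K * Cmod (z - wexp w0).
Proof.
  intros Hd. set (D := dwexp w0) in *. pose proof (proj1 (Cmod_gt_0 D) Hd) as HD.
  destruct (wexp_strict_diff w0 (Cmod D / 2) ltac:(lra)) as [r [Hr Hlip]]. fold D in Hlip.
  (* The limit is within [4 h] of [w0], where [h = |z - wexp w0| / |D|], and this must stay below
     [r]. *)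
  exists (4 / Cmod D), (r * Cmod D / 4).
  assert (HK : 0 < 4 / Cmod D) by (apply Rdiv_lt_0_compat; lra).
  split; [exact HK|]. split; [nra|]. intros z Hz.
  set (T := fun w => (w - (wexp w - z) / D)%C).
  set (h := Cmod (z - wexp w0) / Cmod D).
  assert (Hh0 : 0 <= h) by (apply Rle_mult_inv_pos; [apply Cmod_ge_0 | exact HD]).
  assert (Hh : 4 * h < r).
  { unfold h. replace (4 * (Cmod (z - wexp w0) / Cmod D)) with (4 * Cmod (z - wexp w0) / Cmod D) by (field; lra).
    apply Rlt_div_l; lra. }
  assert (HT : forall w w', Cmod (w - w0) < r -> Cmod (w' - w0) < r -> Cmod (T w - T w') <= 1 / 2 * Cmod (w - w')).
  { intros w w' Hw Hw'. specialize (Hlip w w' Hw Hw').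
    replace (T w - T w')%C with (- ((wexp w - wexp w' - D * (w - w')) / D))%C by (unfold T; field; exact Hd).
    rewrite Cmod_opp, Cmod_div by exact Hd. apply Rle_div_l; [exact HD|]. lra. }
  set (a := fun k => Nat.iter k T w0).
  assert (Ha : forall k, Cmod (a k - w0) <= 2 * h * (1 - (1 / 2) ^ k) /\ Cmod (a (S k) - a k) <= h * (1 / 2) ^ k).
  { induction k as [|k [IH1 IH2]].
    - split; [change (a 0%nat) with w0; replace (w0 - w0)%C with (RtoC 0) by ring; rewrite Cmod_0; simpl; lra|].
      change (a 1%nat) with (T w0). change (a 0%nat) with w0.
      replace (T w0 - w0)%C with ((z - wexp w0) / D)%C by (unfold T; field; exact Hd).
      rewrite Cmod_div by exact Hd. fold h. simpl. lra.
    - assert (Hp : 0 < (1 / 2) ^ k) by (apply pow_lt; lra).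
      assert (IH3 : Cmod (a (S k) - w0) <= 2 * h * (1 - (1 / 2) ^ S k)).
      { replace (a (S k) - w0)%C with ((a (S k) - a k) + (a k - w0))%C by ring.
        eapply Rle_trans; [apply Cmod_triangle_le; eassumption|]. simpl. lra. }
      split; [exact IH3|].
      change (a (S (S k))) with (T (a (S k))). change (a (S k)) with (T (a k)) at 2.
      eapply Rle_trans; [apply HT|].
      + eapply Rle_lt_trans; [exact IH3|]. assert (0 < (1 / 2) ^ S k) by (apply pow_lt; lra). nra.
      + eapply Rle_lt_trans; [exact IH1|]. nra.
      + change ((1 / 2) ^ S k) with (1 / 2 * (1 / 2) ^ k). lra. }
  destruct (exists_climit_of_geometric a h Hh0 (fun k => proj2 (Ha k))) as [l Hl].
  assert (Hlw : Cmod (l - w0) <= 4 * h).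
  { specialize (Hl 0%nat). simpl in Hl. rewrite Cmod_minus_sym. change (a 0%nat) with w0 in Hl. lra. }
  exists l. split.
  - assert (E : T l = l).
    { apply Cminus_eq_0, Cmod_eq_0. apply Rle_antisym; [|apply Cmod_ge_0].
      apply Rnot_lt_le. intros Hpos.
      assert (Hk : forall k, Cmod (T l - l) <= 4 * h * (1 / 2) ^ k).
      { intros k. replace (T l - l)%C with ((T l - T (a k)) + (a (S k) - l))%C
          by (change (a (S k)) with (T (a k)); ring).
        assert (Hp : 0 < (1 / 2) ^ k) by (apply pow_lt; lra).
        eapply Rle_trans; [apply Cmod_triangle_le; [apply HT | apply Hl]|].
        - lra.
        - eapply Rle_lt_trans; [apply Ha|]. nra.
        - specialize (Hl k). rewrite Cmod_minus_sym in Hl. simpl. lra. }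
      destruct (pow_lt_1_zero (1 / 2) ltac:(rewrite Rabs_right; lra) (Cmod (T l - l) / (4 * h + 1))) as [k0 Hk0].
      { apply Rdiv_lt_0_compat; lra. }
      specialize (Hk0 k0 (Nat.le_refl _)). specialize (Hk k0).
      assert (Hp : 0 < (1 / 2) ^ k0) by (apply pow_lt; lra).
      rewrite Rabs_right in Hk0 by lra. apply Rlt_div_r in Hk0; [|lra]. nra. }
    unfold T in E.
    assert (E2 : ((wexp l - z) / D)%C = 0).
    { replace ((wexp l - z) / D)%C with (l - (l - (wexp l - z) / D))%C by ring. rewrite E. ring. }
    apply Cminus_eq_0. replace (wexp l - z)%C with ((wexp l - z) / D * D)%C by (field; exact Hd).
    rewrite E2. ring.
  - eapply Rle_trans; [exact Hlw|]. right. unfold h. field. lra.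
Qed.

(** * The range of the principal branch *)

(** The boundary curve [Re w = - Im w cot (Im w)] of the range is avoided: off the real axis it is
    enough that [w exp w] lies on the same side of the axis as [w]. *)
Definition W0_range (w : C) : Prop :=
  Rabs (Im w) < PI /\ (Im w = 0 -> -1 < Re w) /\ (Im w <> 0 -> 0 < Im w * Im (wexp w)).

Lemma Im_wexp (w : C) : Im (wexp w) = exp (Re w) * (Re w * sin (Im w) + Im w * cos (Im w)).
Proof. unfold wexp, Cexp, Re, Im. simpl. ring. Qed.

Lemma W0_range_conj (w : C) : W0_range w -> W0_range (Cconj w).
Proof.
  intros (H1 & H2 & H3). unfold W0_range. rewrite Im_wexp in *.
  change (Re (Cconj w)) with (Re w). change (Im (Cconj w)) with (- Im w).
  rewrite Rabs_Ropp, sin_neg, cos_neg. split; [exact H1|]. split.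
  - intros; apply H2; lra.
  - intros; replace (- Im w * _) with (Im w * (exp (Re w) * (Re w * sin (Im w) + Im w * cos (Im w)))) by ring.
    apply H3; lra.
Qed.

Lemma wexp_conj (w : C) : wexp (Cconj w) = Cconj (wexp w).
Proof.
  apply Ceq; unfold wexp, Cexp, Re, Im; simpl; rewrite ?sin_neg, ?cos_neg; ring.
Qed.

Lemma dwexp_neq_0 (w : C) : W0_range w -> dwexp w <> 0.
Proof.
  intros (_ & H & _). unfold dwexp. apply Cmult_neq_0; [|apply Cexp_neq_0].
  intros E. assert (ER : Re (1 + w) = 0) by (rewrite E; reflexivity).
  assert (EI : Im (1 + w) = 0) by (rewrite E; reflexivity).
  unfold Re, Im in *. simpl in *. assert (-1 < fst w) by (apply H; lra). lra.
Qed.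

Lemma W0_range_open (w0 : C) : W0_range w0 -> exists d, 0 < d /\ forall w, Cmod (w - w0) < d -> W0_range w.
Proof.
  intros (H1 & H2 & H3).
  assert (CI : continuous (T := C_UniformSpace) (fun w => Im w) w0) by apply (ccont_id w0).
  assert (CR : continuous (T := C_UniformSpace) (fun w => Re w) w0) by apply (ccont_id w0).
  assert (LP : locally (T := C_UniformSpace) w0 (fun w => 0 < PI - Rabs (Im w))).
  { apply (locally_pos (U := C_UniformSpace) (fun w => PI - Rabs (Im w))); [|lra].
    apply (continuous_minus (V := R_NormedModule)); [apply continuous_const|].
    apply (continuous_comp (fun w : C_UniformSpace => Im w) Rabs); [exact CI | apply continuous_Rabs]. }
  destruct (Req_dec (Im w0) 0) as [E0|E0].
  - specialize (H2 E0).
    assert (LQ : locally (T := C_UniformSpace) w0 (fun w => 0 < Re w + cos (Im w))).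
    { apply (locally_pos (U := C_UniformSpace) (fun w => Re w + cos (Im w))); [|rewrite E0, cos_0; lra].
      apply (continuous_plus (V := R_NormedModule)); [exact CR|].
      apply (continuous_comp (fun w : C_UniformSpace => Im w) cos); [exact CI | apply continuous_cos]. }
    assert (LR : locally (T := C_UniformSpace) w0 (fun w => 0 < PI / 2 - Rabs (Im w))).
    { apply (locally_pos (U := C_UniformSpace) (fun w => PI / 2 - Rabs (Im w))); [|rewrite E0, Rabs_R0; generalize PI_RGT_0; lra].
      apply (continuous_minus (V := R_NormedModule)); [apply continuous_const|].
      apply (continuous_comp (fun w : C_UniformSpace => Im w) Rabs); [exact CI | apply continuous_Rabs]. }
    destruct (locally_C_Cmod _ _ (filter_and _ _ LQ LR)) as [d [Hd H]].
    exists d. split; [exact Hd|]. intros w Hw. destruct (H w Hw) as [HQ HR]. 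
    assert (HI : - (PI / 2) < Im w < PI / 2) by (apply Rabs_lt_between; lra).
    (* At a real point the sign condition is vacuous and has to be derived for its neighbours. Since
       [y > sin y] and [cos y > 0], the expression exceeds [sin y (x + cos y)]. *)
    assert (Key : forall x y, 0 < y < PI / 2 -> 0 < x + cos y -> 0 < x * sin y + y * cos y).
    { intros x y Hy Hxy. assert (0 < sin y) by (apply sin_gt_0; generalize PI_RGT_0; lra).
      assert (sin y < y) by (apply sin_lt_x; lra). assert (0 < cos y) by (apply cos_gt_0; lra).
      destruct (Rle_dec 0 x); nra. }
    pose proof (exp_pos (Re w)) as He.
    split; [|split].
    + generalize PI_RGT_0; lra.
    + intros E. rewrite E, cos_0 in HQ. lra.
    + intros E. rewrite Im_wexp. destruct (Rdichotomy _ _ E) as [h|h].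
      * assert (K := Key (Re w) (- Im w) ltac:(lra)). rewrite cos_neg, sin_neg in K. specialize (K HQ).
        replace (Im w * (exp (Re w) * (Re w * sin (Im w) + Im w * cos (Im w)))) with
          ((- Im w) * (exp (Re w) * (Re w * - sin (Im w) + - Im w * cos (Im w)))) by ring.
        apply Rmult_lt_0_compat; [lra|]. now apply Rmult_lt_0_compat.
      * assert (K := Key (Re w) (Im w) ltac:(lra) HQ).
        apply Rmult_lt_0_compat; [lra|]. now apply Rmult_lt_0_compat.
  - specialize (H3 E0).
    assert (CW : continuous (T := C_UniformSpace) (fun w => Im (wexp w)) w0).
    { apply (ccont_mult (U := C_UniformSpace) (fun w => w) Cexp); [apply ccont_id | apply (ccont_Cexp (U := C_UniformSpace) (fun w => w)), ccont_id]. }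
    assert (LQ : locally (T := C_UniformSpace) w0 (fun w => 0 < Im w * Im (wexp w))).
    { apply (locally_pos (U := C_UniformSpace) (fun w => Im w * Im (wexp w))); [|exact H3].
      apply (continuous_mult (K := R_AbsRing)); assumption. }
    destruct (locally_C_Cmod _ _ (filter_and _ _ LQ LP)) as [d [Hd H]].
    exists d. split; [exact Hd|]. intros w Hw. destruct (H w Hw) as [HQ HP].
    split; [lra|]. split; [intros E; rewrite E in HQ; lra | intros _; exact HQ].
Qed.

(* For [w] in the upper half plane with argument [b], [w exp w = z] amounts to
   [Im w = a - b] and [ln |z| = log_modulus a b], where [a = arg z]. *)
Definition log_modulus (a b : R) : R := ln ((a - b) / sin b) + (a - b) * (cos b / sin b).

(** With the numerator written as a sum of squares, [log_modulus a] is visibly strictly decreasing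
    on [(0, a)]. *)
Lemma log_modulus_derive (a b : R) : 0 < b < a -> a < PI ->
  is_derive (log_modulus a) b
    (- ((a - b + sin b * cos b) ^ 2 + sin b ^ 4) / ((a - b) * sin b ^ 2)).
Proof.
  intros Hb Ha. assert (Hs : 0 < sin b) by (apply sin_gt_0; lra).
  unfold log_modulus. auto_derive.
  - repeat split; try lra. apply Rdiv_lt_0_compat; lra.
  - assert (E : cos b * cos b = 1 - sin b * sin b) by (generalize (sin2_cos2 b); unfold Rsqr; lra).
    set (S := sin b) in *. set (K := cos b) in *. field_simplify_eq; [|split; lra].
    replace (K ^ 2) with (1 - S ^ 2) by (simpl; lra). ring.
Qed.

Lemma log_modulus_inj (a b b' : R) : a < PI -> 0 < b < a -> 0 < b' < a ->
  log_modulus a b = log_modulus a b' -> b = b'.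
Proof.
  intros Ha.
  assert (Hlt : forall b b', 0 < b < a -> 0 < b' < a -> b < b' -> log_modulus a b' < log_modulus a b).
  { clear b b'. intros b b' Hb Hb' Hlt.
    destruct (MVT_gen (log_modulus a) b b' (fun b => - ((a - b + sin b * cos b) ^ 2 + sin b ^ 4) / ((a - b) * sin b ^ 2)))
      as [c [Hc E]].
    - intros x. rewrite Rmin_left, Rmax_right by lra. intros; apply log_modulus_derive; lra.
    - intros x. rewrite Rmin_left, Rmax_right by lra. intros. apply continuity_pt_filterlim.
      apply continuous_derivable. eexists. apply log_modulus_derive; lra.
    - rewrite Rmin_left, Rmax_right in Hc by lra.
      assert (Hs : 0 < sin c) by (apply sin_gt_0; lra).
      assert (0 < ((a - c + sin c * cos c) ^ 2 + sin c ^ 4) / ((a - c) * sin c ^ 2)).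
      { apply Rdiv_lt_0_compat.
        - generalize (pow2_ge_0 (a - c + sin c * cos c)) (pow_lt _ 4 Hs). lra.
        - apply Rmult_lt_0_compat; [lra | apply pow_lt, Hs]. }
      unfold Rdiv in E. rewrite Ropp_mult_distr_l_reverse in E. fold (Rdiv ((a - c + sin c * cos c) ^ 2 + sin c ^ 4) ((a - c) * sin c ^ 2)) in E.
      nra. }
  intros Hb Hb' E. destruct (Rtotal_order b b') as [h|[h|h]]; [|exact h|].
  - specialize (Hlt _ _ Hb Hb' h). lra.
  - specialize (Hlt _ _ Hb' Hb h). lra.
Qed.

Lemma upper_polar (w : C) : 0 < Im w -> 0 < Carg w < PI /\ 
  w = Cmult (Im w) ((cos (Carg w) / sin (Carg w))%R, 1%R) /\ Cmod w = Im w / sin (Carg w).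
Proof.
  intros H. assert (Hs : slit w) by (apply slit_Im; lra). pose proof (Carg_slit_bounds w Hs) as Hb.
  pose proof (slit_neq_0 w Hs) as H0. pose proof (proj1 (Cmod_gt_0 w) H0) as Hm.
  assert (E := Cexp_Clog w H0).
  assert (ER : Cmod w * cos (Carg w) = Re w).
  { rewrite <- E at 3. unfold Cexp, Clog; simpl. now rewrite exp_ln. }
  assert (EI : Cmod w * sin (Carg w) = Im w).
  { rewrite <- E at 3. unfold Cexp, Clog; simpl. now rewrite exp_ln. }
  assert (Hsin : 0 < sin (Carg w)) by nra.
  split; [split; [|lra]|split].
  - apply Rnot_le_lt. intros Hle. 
    assert (sin (- Carg w) >= 0) by (apply Rle_ge, sin_ge_0; lra). rewrite sin_neg in H1. lra.
  - apply Ceq; unfold Re, Im in *; simpl; rewrite <- ?ER, <- EI; field; lra.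
  - rewrite <- EI. field. lra.
Qed.

Lemma wexp_upper (w : C) : 0 < Im w -> W0_range w ->
  0 < Carg w < Carg (wexp w) /\ Carg (wexp w) < PI /\
  Im w = Carg (wexp w) - Carg w /\ ln (Cmod (wexp w)) = log_modulus (Carg (wexp w)) (Carg w).
Proof.
  intros H (H1 & _ & H3). specialize (H3 ltac:(lra)).
  destruct (upper_polar w H) as (Hb & Ew & Em).
  assert (HI : 0 < Im (wexp w)) by nra.
  assert (H0 : w <> 0) by (apply slit_neq_0, slit_Im; lra).
  rewrite Rabs_right in H1 by lra.
  assert (Hsin : 0 < sin (Carg w)) by (apply sin_gt_0; lra).
  pose proof (proj1 (Cmod_gt_0 w) H0) as Hm.
  assert (E : wexp w = Cexp (Clog w + w)) by (rewrite Cexp_plus, Cexp_Clog by exact H0; reflexivity).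
  (* The sum lies in [(0, 2 PI)], and from [PI] on its sine would not be positive, against [HI].
     Hence the arguments add up without reduction modulo [2 PI]. *)
  assert (Hlt : Carg w + Im w < PI).
  { apply Rnot_le_lt. intros Hge. rewrite E in HI. unfold Cexp in HI. simpl in HI.
    assert (Hs : sin (Carg w + Im w) <= 0) by (apply sin_le_0; lra).
    pose proof (exp_pos (ln (Cmod w) + Re w)). unfold Re, Im in *; simpl in *. nra. }
  assert (EL : Clog (wexp w) = (Clog w + w)%C).
  { rewrite E. apply Clog_Cexp. change (Im (Clog w + w)) with (Carg w + Im w). lra. }
  assert (EA : Carg (wexp w) = Carg w + Im w) by (change (Im (Clog (wexp w)) = Carg w + Im w); rewrite EL; reflexivity).
  assert (EM : ln (Cmod (wexp w)) = ln (Cmod w) + Re w) by (change (Re (Clog (wexp w)) = ln (Cmod w) + Re w); rewrite EL; reflexivity).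
  rewrite EA, EM. split; [lra|]. split; [lra|]. split; [ring|].
  unfold log_modulus. replace (Carg w + Im w - Carg w) with (Im w) by ring. rewrite Em.
  apply (f_equal Re) in Ew. change (Re w = Im w * (cos (Carg w) / sin (Carg w)) - 0 * 1) in Ew. lra.
Qed.

Lemma W0_range_inj_upper (w w' : C) : 0 < Im w -> 0 < Im w' -> W0_range w -> W0_range w' ->
  wexp w = wexp w' -> w = w'.
Proof.
  intros H H' HW HW' E.
  destruct (wexp_upper w H HW) as (A1 & A2 & A3 & A4).
  destruct (wexp_upper w' H' HW') as (B1 & B2 & B3 & B4).
  rewrite <- E in B1, B2, B3, B4.
  assert (Eb : Carg w = Carg w').
  { apply (log_modulus_inj (Carg (wexp w))); try assumption; lra. }
  destruct (upper_polar w H) as (_ & -> & _). destruct (upper_polar w' H') as (_ & -> & _).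
  rewrite A3, B3, Eb. reflexivity.
Qed.

Lemma continuity_pt_real_wexp (t : R) : continuity_pt (fun x => x * exp x) t.
Proof.
  apply continuity_pt_filterlim.
  apply (continuous_derivable (fun x => x * exp x)).
  auto_derive. trivial.
Qed.

Lemma real_wexp_increasing (x y : R) : -1 < x -> x < y -> x * exp x < y * exp y.
Proof.
  intros Hx Hxy.
  destruct (MVT_gen (fun t => t * exp t) x y (fun t => (1 + t) * exp t)) as [c [Hc E]].
  - intros t _. auto_derive; [trivial | ring].
  - intros t _. apply continuity_pt_real_wexp.
  - rewrite Rmin_left, Rmax_right in Hc by lra. pose proof (exp_pos c).
    assert (0 < (1 + c) * exp c * (y - x)) by (apply Rmult_lt_0_compat; [apply Rmult_lt_0_compat|]; lra). lra.
Qed.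

Lemma wexp_RtoC (x : R) : wexp (RtoC x) = RtoC (x * exp x).
Proof. unfold wexp. rewrite Cexp_RtoC, RtoC_mult. reflexivity. Qed.

Lemma Im_0_RtoC (w : C) : Im w = 0 -> w = RtoC (Re w).
Proof. intros H. apply Ceq; [reflexivity | exact H]. Qed.

Lemma W0_range_sign (w : C) : W0_range w -> (Im w = 0 <-> Im (wexp w) = 0) /\
  (0 < Im w <-> 0 < Im (wexp w)) /\ (Im w < 0 <-> Im (wexp w) < 0).
Proof.
  intros (_ & _ & H).
  assert (E0 : Im w = 0 -> Im (wexp w) = 0) by (intros E; rewrite Im_wexp, E, sin_0; ring).
  destruct (Rtotal_order (Im w) 0) as [h|[h|h]].
  - specialize (H ltac:(lra)). repeat split; intros; nra.
  - specialize (E0 h). repeat split; intros; lra.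
  - specialize (H ltac:(lra)). repeat split; intros; nra.
Qed.

Lemma W0_range_inj (w w' : C) : W0_range w -> W0_range w' -> wexp w = wexp w' -> w = w'.
Proof.
  intros H H' E. destruct (W0_range_sign w H) as (S1 & S2 & S3). destruct (W0_range_sign w' H') as (S1' & S2' & S3').
  rewrite <- E in S1', S2', S3'.
  destruct (Rtotal_order (Im w) 0) as [h|[h|h]].
  - assert (h' : Im w' < 0) by (apply S3', S3, h).
    assert (E' : Cconj w = Cconj w').
    { apply W0_range_inj_upper; try (now apply W0_range_conj).
      - change (Im (Cconj w)) with (- Im w). lra.
      - change (Im (Cconj w')) with (- Im w'). lra.
      - now rewrite !wexp_conj, E. }
    apply Ceq; [exact (f_equal Re E')|]. apply (f_equal Im) in E'.
    change (Im (Cconj w)) with (- Im w) in E'. change (Im (Cconj w')) with (- Im w') in E'. lra.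
  - assert (h' : Im w' = 0) by (apply S1', S1, h).
    destruct H as (_ & R1 & _). destruct H' as (_ & R2 & _).
    specialize (R1 h). specialize (R2 h').
    rewrite (Im_0_RtoC w h), (Im_0_RtoC w' h'). rewrite (Im_0_RtoC w h), (Im_0_RtoC w' h') in E.
    f_equal. rewrite !wexp_RtoC in E. apply RtoC_inj in E.
    destruct (Rtotal_order (Re w) (Re w')) as [k|[k|k]]; [|exact k|]; exfalso.
    + generalize (real_wexp_increasing _ _ R1 k). lra.
    + generalize (real_wexp_increasing _ _ R2 k). lra.
  - apply W0_range_inj_upper; try assumption. apply S2', S2, h.
Qed.

(** The function tends to [+oo] at 0 and to [-oo] at [a]; explicit points on either side of the
    value [rho] are given for the intermediate value theorem. *)
Lemma log_modulus_surj (a rho : R) : 0 < a < PI -> exists b, 0 < b < a /\ log_modulus a b = rho.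
Proof.
  intros Ha.
  (* [s0] bounds [sin] from below on [[a / 2, a]]. At [b1] the logarithm is at least [rho + 1]; at
     [a - h] the cotangent term is at most [PI / s0] and the logarithm at most
     [rho - 1 - PI / s0]. *)
  set (s0 := Rmin (sin (a / 2)) (sin a)).
  assert (Hs0 : 0 < s0) by (apply Rmin_pos; apply sin_gt_0; lra).
  set (b1 := Rmin (a / 2) (a / 2 * exp (- rho - 1))).
  set (h := Rmin (a / 4) (s0 * exp (rho - 1 - PI / s0))).
  assert (Hb1 : 0 < b1).
  { apply Rmin_pos; [lra|]. apply Rmult_lt_0_compat; [lra | apply exp_pos]. }
  assert (Hh : 0 < h).
  { apply Rmin_pos; [lra|]. apply Rmult_lt_0_compat; [lra | apply exp_pos]. }
  assert (Hb1a : b1 <= a / 2) by apply Rmin_l. assert (Hb1b : b1 <= a / 2 * exp (- rho - 1)) by apply Rmin_r.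
  assert (Hha : h <= a / 4) by apply Rmin_l. assert (Hhb : h <= s0 * exp (rho - 1 - PI / s0)) by apply Rmin_r.
  assert (G1 : rho < log_modulus a b1).
  { assert (Hsb : 0 < sin b1) by (apply sin_gt_0; lra). assert (sin b1 < b1) by (apply sin_lt_x; lra).
    assert (0 <= cos b1) by (apply cos_ge_0; lra).
    assert (0 <= (a - b1) * (cos b1 / sin b1)) by (apply Rmult_le_pos; [lra | apply Rle_mult_inv_pos; lra]).
    assert (rho + 1 <= ln ((a - b1) / sin b1)).
    { rewrite <- (ln_exp (rho + 1)). apply ln_le; [apply exp_pos|].
      apply (proj1 (Rle_div_r _ _ _ Hsb)).
      apply Rle_trans with (exp (rho + 1) * (a / 2 * exp (- rho - 1))).
      - apply Rmult_le_compat_l; [apply Rlt_le, exp_pos | lra].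
      - replace (exp (rho + 1) * (a / 2 * exp (- rho - 1))) with (a / 2 * (exp (rho + 1) * exp (- rho - 1))) by ring.
        rewrite <- exp_plus. replace (rho + 1 + (- rho - 1)) with 0 by ring. rewrite exp_0. lra. }
    unfold log_modulus. lra. }
  set (b2 := a - h).
  assert (G2 : log_modulus a b2 < rho).
  { assert (Hsb : s0 <= sin b2).
    { unfold b2, s0. destruct (Rle_dec (a - h) (PI / 2)) as [k|k].
      - eapply Rle_trans; [apply Rmin_l|]. apply sin_incr_1; lra.
      - eapply Rle_trans; [apply Rmin_r|]. apply sin_decr_1; lra. }
    unfold log_modulus. replace (a - b2) with h by (unfold b2; ring).
    assert (T1 : h * (cos b2 / sin b2) <= PI / s0).
    { unfold Rdiv. rewrite <- Rmult_assoc. 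
      assert (h * cos b2 <= PI) by (generalize (COS_bound b2); nra).
      assert (/ sin b2 <= / s0) by (apply Rinv_le_contravar; lra).
      assert (0 < / sin b2) by (apply Rinv_0_lt_compat; lra). generalize PI_RGT_0; nra. }
    assert (T2 : ln (h / sin b2) <= rho - 1 - PI / s0).
    { rewrite <- (ln_exp (rho - 1 - PI / s0)). apply ln_le; [apply Rdiv_lt_0_compat; lra|].
      apply Rle_div_l; [lra|]. eapply Rle_trans; [exact Hhb|]. rewrite Rmult_comm.
      apply Rmult_le_compat_l; [apply Rlt_le, exp_pos | exact Hsb]. }
    lra. }
  destruct (IVT_interv (fun b => rho - log_modulus a b) b1 b2) as [b [Hb E]].
  - intros b Hb. apply continuity_pt_filterlim.
    apply (continuous_minus (V := R_NormedModule)); [apply continuous_const|].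
    apply continuous_derivable. eexists. 
    apply log_modulus_derive; unfold b2 in *; lra.
  - unfold b2; lra.
  - lra.
  - lra.
  - exists b. unfold b2 in *. split; lra.
Qed.

Lemma W0_range_surj_upper (z : C) : 0 < Im z -> exists w, W0_range w /\ wexp w = z.
Proof.
  intros H. destruct (upper_polar z H) as (Ha & _ & _).
  assert (H0 : z <> 0) by (apply slit_neq_0, slit_Im; lra).
  destruct (log_modulus_surj (Carg z) (ln (Cmod z)) Ha) as [b [Hb E]].
  assert (Hs : 0 < sin b) by (apply sin_gt_0; lra).
  set (y := Carg z - b). set (w := ((y * (cos b / sin b), y) : C)).
  assert (Hlw : w = Cexp (RtoC (ln (y / sin b)) + (0, b))).
  { apply Ceq; unfold w, Cexp, Re, Im; simpl; rewrite Rplus_0_r, Rplus_0_l, exp_ln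
      by (apply Rdiv_lt_0_compat; unfold y; lra); field; lra. }
  assert (Ew : wexp w = z).
  { unfold wexp. rewrite Hlw at 1. rewrite <- Cexp_plus, <- (Cexp_Clog z H0). f_equal.
    unfold log_modulus in E. fold y in E. apply Ceq; unfold w, Clog, Re, Im; simpl; [lra | unfold y; ring]. }
  exists w. split; [|exact Ew]. unfold W0_range. rewrite Ew. change (Im w) with y.
  split; [rewrite Rabs_right; unfold y; lra|]. split; [unfold y; lra|]. intros _. apply Rmult_lt_0_compat; [unfold y; lra | exact H].
Qed.

Lemma W0_range_RtoC (x : R) : -1 < x -> W0_range (RtoC x).
Proof.
  intros H. unfold W0_range. simpl. rewrite Rabs_R0. generalize PI_RGT_0. intuition.
Qed.

Lemma W0_range_surj (z : C) : C_minus_ray (- exp (-1)) z -> exists w, W0_range w /\ wexp w = z.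
Proof.
  intros Hz. destruct (Rtotal_order (Im z) 0) as [h|[h|h]].
  - destruct (W0_range_surj_upper (Cconj z)) as [w [Hw E]].
    { change (Im (Cconj z)) with (- Im z). lra. }
    exists (Cconj w). split; [now apply W0_range_conj|]. rewrite wexp_conj, E.
    apply Ceq; unfold Re, Im; simpl; ring.
  - assert (Hr : - exp (-1) < Re z) by (apply Rnot_le_lt; intros Hle; apply Hz; split; assumption).
    set (b := Rabs (Re z) + 1).
    assert (Hb : 1 <= b) by (unfold b; generalize (Rabs_pos (Re z)); lra).
    destruct (IVT_interv (fun x => x * exp x - Re z) (-1) b) as [x [Hx E]].
    + intros x _. apply (continuity_pt_minus (fun x => x * exp x) (fun _ => Re z)).
      * apply continuity_pt_real_wexp.
      * apply continuity_pt_const. now intros ? ?.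
    + lra.
    + lra.
    + assert (1 <= exp b) by (generalize (exp_ineq1_le b); lra).
      assert (Re z < b) by (unfold b; generalize (Rle_abs (Re z)); lra). nra.
    + exists (RtoC x). split.
      * apply W0_range_RtoC. destruct Hx as [[Hx|Hx] _]; [exact Hx|]. exfalso. subst x. lra.
      * rewrite wexp_RtoC, (Im_0_RtoC z h). f_equal. lra.
  - now apply W0_range_surj_upper.
Qed.

(** The value at [z] is chosen among the preimages in [W0_range], where it is unique by injectivity.
    Differentiability comes from the local inverse, once the latter is identified with the chosen
    value. *)
Lemma LambertW0_exists : exists W, is_LambertW0 W.
Proof.
  set (W := fun z => epsilon (inhabits (RtoC 0)) (fun w => W0_range w /\ wexp w = z)).
  assert (HW : forall z, C_minus_ray (- exp (-1)) z -> W0_range (W z) /\ wexp (W z) = z).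
  { intros z Hz. apply (epsilon_spec (inhabits (RtoC 0)) (fun w => W0_range w /\ wexp w = z)).
    now apply W0_range_surj. }
  assert (HWeq : forall w, W0_range w -> W (wexp w) = w).
  { intros w Hw. 
    destruct (epsilon_spec (inhabits (RtoC 0)) (fun v => W0_range v /\ wexp v = wexp w) (ex_intro _ w (conj Hw eq_refl))) as [H1 H2].
    apply W0_range_inj; assumption. }
  exists W. split; [|split].
  - intros z Hz. destruct (HW z Hz) as [Hr E]. set (w0 := W z) in *.
    pose proof (dwexp_neq_0 w0 Hr) as Hd. pose proof (proj1 (Cmod_gt_0 _) Hd) as HD.
    destruct (W0_range_open w0 Hr) as [d1 [Hd1 Hopen]].
    destruct (wexp_local_inverse w0 Hd) as (K & d2 & HK & Hd2 & Hinv). rewrite E in Hinv.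
    exists (/ dwexp w0)%C. split; [apply is_linear_scal_l|].
    intros x Hx. rewrite <- (is_filter_lim_locally_unique _ _ Hx). clear x Hx.
    intros eps.
    destruct (wexp_strict_diff w0 (eps * Cmod (dwexp w0) / K)) as [r [Hr0 Hdiff]].
    { apply Rdiv_lt_0_compat; [apply Rmult_lt_0_compat; [apply cond_pos | exact HD] | exact HK]. }
    set (m := Rmin d1 r). assert (Hm : 0 < m) by (now apply Rmin_pos).
    assert (Hdelta : 0 < Rmin d2 (m / (2 * K))).
    { apply Rmin_pos; [exact Hd2|]. apply Rdiv_lt_0_compat; lra. }
    exists (mkposreal _ Hdelta). intros y Hy. change (Cmod (y - z) < Rmin d2 (m / (2 * K))) in Hy.
    destruct (Hinv y (Rlt_le_trans _ _ _ Hy (Rmin_l _ _))) as [w [Ey Hw]].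
    assert (Hwm : Cmod (w - w0) < m).
    { eapply Rle_lt_trans; [exact Hw|].
      apply Rle_lt_trans with (K * (m / (2 * K))); [apply Rmult_le_compat_l; [lra|]; eapply Rle_trans; [apply Rlt_le, Hy | apply Rmin_r]|].
      replace (K * (m / (2 * K))) with (m / 2) by (field; lra). lra. }
    (* As [W0_range] is open, the preimage near [w0] lies in it and is therefore the chosen one. *)
    assert (Wy : W y = w).
    { rewrite <- Ey. apply HWeq, Hopen. eapply Rlt_le_trans; [exact Hwm | apply Rmin_l]. }
    specialize (Hdiff w w0 (Rlt_le_trans _ _ _ Hwm (Rmin_r _ _))).
    replace (w0 - w0)%C with (RtoC 0) in Hdiff by ring. rewrite Cmod_0 in Hdiff. specialize (Hdiff Hr0).
    rewrite Ey, E in Hdiff.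
    change (Cmod ((W y - w0) - (y - z) * / dwexp w0) <= eps * Cmod (y - z)). rewrite Wy.
    replace ((w - w0) - (y - z) * / dwexp w0)%C with (- ((y - z - dwexp w0 * (w - w0)) / dwexp w0))%C
      by (field; exact Hd).
    rewrite Cmod_opp, Cmod_div by exact Hd. apply Rle_div_l; [exact HD|].
    eapply Rle_trans; [exact Hdiff|].
    apply Rle_trans with (eps * Cmod (dwexp w0) / K * (K * Cmod (y - z))).
    + apply Rmult_le_compat_l; [|exact Hw]. apply Rlt_le, Rdiv_lt_0_compat; [|exact HK].
      apply Rmult_lt_0_compat; [apply cond_pos | exact HD].
    + right. field. lra.
  - intros z Hz. exact (proj2 (HW z Hz)).
  - intros x Hx. rewrite <- wexp_RtoC. apply HWeq. now apply W0_range_RtoC.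
Qed.

Lemma LambertW0_spec : is_LambertW0 LambertW0.
Proof. exact (epsilon_spec (inhabits (fun z : C => z)) is_LambertW0 LambertW0_exists). Qed.

Lemma LambertW0_continuous (z : C) (e : R) : C_minus_ray (- exp (-1)) z -> 0 < e ->
  exists d, 0 < d /\ forall y, Cmod (y - z) < d -> Cmod (LambertW0 y - LambertW0 z) < e.
Proof.
  intros Hz He. pose proof (proj1 LambertW0_spec z Hz) as Hd.
  apply (ex_derive_continuous (K := C_AbsRing) (V := C_NormedModule)) in Hd.
  (* The balls of the uniform structure on [C] are products of intervals: the modulus is only below
     [sqrt 2 <= 2] times the radius. *)
  assert (He2 : 0 < e / 2) by lra.
  destruct (Hd (fun w => Cmod (w - LambertW0 z) < e)) as [d H].
  - exists (mkposreal _ He2). intros w Hw. apply C_NormedModule_mixin_compat2 in Hw.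
    eapply Rlt_le_trans; [exact Hw|]. simpl.
    assert (sqrt 2 <= 2). { rewrite <- (sqrt_Rsqr 2) at 2 by lra. apply sqrt_le_1_alt. unfold Rsqr; lra. }
    nra.
  - exists d. split; [apply cond_pos|]. intros y Hy. apply H. exact Hy.
Qed.

(** * Dominance of a real saddle point on its circle *)

Lemma cos_lt_1 (t : R) : Rabs t <= PI -> t <> 0 -> cos t < 1.
Proof.
  intros Ht H0. assert (HPI := PI_RGT_0). rewrite <- cos_0.
  assert (H : forall x, 0 < x <= PI -> cos x < cos 0) by (intros x Hx; apply cos_decreasing_1; lra).
  destruct (Rdichotomy _ _ H0) as [h|h].
  - rewrite Rabs_left in Ht by lra. rewrite <- cos_neg. apply H; lra.
  - rewrite Rabs_right in Ht by lra. apply H; lra.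
Qed.

Lemma Re_contour (s t : R) : Re (contour s t) = 1 + s * (cos t - 1).
Proof. unfold contour. rewrite cis_alt. unfold Re; simpl. ring. Qed.

Lemma contour_1 (t : R) : contour 1 t = cis t.
Proof. unfold contour. ring. Qed.

Lemma exp_contour_1 (vth t : R) : exp (ln (Cmod (contour 1 t)) / vth) = 1.
Proof. rewrite contour_1, Cmod_cis, ln_1. unfold Rdiv. rewrite Rmult_0_l. apply exp_0. Qed.

(** The quotient is the mean of [exp] over [[0, x]]; its strict growth is the source of the strict
    inequality below. *)
Lemma exp_quotient_increasing (u v : R) : 0 < u < v -> (exp u - 1) / u < (exp v - 1) / v.
Proof.
  intros H.
  destruct (MVT_gen (fun x => (exp x - 1) / x) u v (fun x => (x * exp x - (exp x - 1)) / (x * x))) as [c [Hc E]].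
  - intros x. rewrite Rmin_left, Rmax_right by lra. intros Hx. auto_derive; [lra|]. field. lra.
  - intros x. rewrite Rmin_left, Rmax_right by lra. intros Hx. apply continuity_pt_filterlim.
    apply (continuous_derivable (fun x => (exp x - 1) / x)).
    auto_derive. lra.
  - rewrite Rmin_left, Rmax_right in Hc by lra.
    assert (0 < c * exp c - (exp c - 1)).
    { assert (Hi : 1 + - c < exp (- c)) by (apply exp_ineq1; lra).
      pose proof (exp_pos c). rewrite exp_Ropp in Hi.
      assert (exp c * (1 + - c) < exp c * / exp c) by (now apply Rmult_lt_compat_l).
      rewrite Rinv_r in H1 by lra. lra. }
    assert (0 < (c * exp c - (exp c - 1)) / (c * c) * (v - u)).
    { apply Rmult_lt_0_compat; [apply Rdiv_lt_0_compat; [assumption | nra] | lra]. }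
    lra.
Qed.

(** The derivative along the segment from 0 to [w] is at most [|w| exp (t M)], which is integrated
    exactly, with equality for [w = M]. *)
Lemma Cmod_Cexp_minus_1_le (w : C) (M : R) : Re w <= M -> 0 < M ->
  Cmod (Cexp w - 1) <= Cmod w * ((exp M - 1) / M).
Proof.
  intros Hw HM.
  replace (Cexp w - 1)%C with (Cexp (RtoC 1 * w) - Cexp (RtoC 0 * w))%C
    by (rewrite Cmult_0_l, Cexp_0, Cmult_1_l; reflexivity).
  replace (Cmod w * ((exp M - 1) / M)) with (Cmod w * (exp (1 * M) / M) - Cmod w * (exp (0 * M) / M))
    by (rewrite Rmult_0_l, Rmult_1_l, exp_0; field; lra).
  apply (Cmod_increment_le (fun t => Cexp (RtoC t * w)) (fun t => w * Cexp (RtoC t * w))%C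
    (fun t => Cmod w * (exp (t * M) / M)) (fun t => Cmod w * exp (t * M))).
  - intros t _. apply cderiv_Cexp, cderiv_ray.
  - intros t _. auto_derive; [trivial | field; lra].
  - intros t Ht. rewrite Cmod_mult, Cmod_Cexp, re_scal_l. apply Rmult_le_compat_l; [apply Cmod_ge_0|].
    apply exp_le. nra.
Qed.

Lemma Cmod_Cexp_minus_1_lt (w : C) (M : R) : Re w < M -> 0 < M -> w <> 0 ->
  Cmod (Cexp w - 1) < Cmod w * ((exp M - 1) / M).
Proof.
  intros Hw HM H0. apply Cmod_gt_0 in H0.
  (* [Re w] may be negative, while the quotient needs a positive bound below [M]. *)
  eapply Rle_lt_trans; [apply (Cmod_Cexp_minus_1_le w (Rmax (Re w) (M / 2)))|].
  - apply Rmax_l.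
  - eapply Rlt_le_trans; [|apply Rmax_r]. lra.
  - apply Rmult_lt_compat_l; [exact H0|]. apply exp_quotient_increasing. split.
    + eapply Rlt_le_trans; [|apply Rmax_r]. lra.
    + apply Rmax_lub_lt; lra.
Qed.

Section Modulus.
Variables (vth L0 : R).
Hypotheses (Hv : 0 < vth) (HL0 : 0 < L0).

Let vL : (RtoC vth * RtoC L0)%C = RtoC (vth * L0).
Proof. now rewrite RtoC_mult. Qed.

(** For [1 / (vth L0) <= 1], [rel_occ] is a convex combination of 1 and a point inside the unit
    disc. *)
Lemma rel_occ_lt_convex (t : R) : 1 <= vth * L0 -> Rabs t <= PI -> t <> 0 ->
  Cmod (rel_occ vth 1 (RtoC L0) t) < exp (ln (Cmod (contour 1 t)) / vth).
Proof.
  intros H1 Ht H0. rewrite exp_contour_1.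
  set (k := / (vth * L0)). 
  assert (Hk : 0 < k <= 1).
  { unfold k. split; [apply Rinv_0_lt_compat; lra|]. rewrite <- Rinv_1. apply Rinv_le_contravar; lra. }
  unfold rel_occ. set (w := (RtoC L0 * (RtoC 1 * (cis t - 1)))%C).
  assert (Hw : Re w < 0).
  { unfold w. rewrite cis_alt. replace (Re _) with (L0 * (cos t - 1)) by (unfold Re; simpl; ring).
    generalize (cos_lt_1 t Ht H0). nra. }
  rewrite vL, <- RtoC_inv by lra. fold k.
  replace (1 + RtoC k * (Cexp w - 1))%C with (RtoC (1 - k) + RtoC k * Cexp w)%C by (rewrite RtoC_minus; ring).
  eapply Rle_lt_trans; [apply Cmod_triangle|]. rewrite Cmod_mult, !Cmod_RtoC_pos, Cmod_Cexp by lra.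
  assert (exp (Re w) < 1) by (rewrite <- exp_0; now apply exp_increasing). nra.
Qed.

(* When [vth L0 < 1], the zero [x] of [occ y] on the real axis is [- k L0]. *)
Let k : R := - (L0 + ln (1 - vth * L0)) / L0.

Hypotheses (HvL : vth * L0 < 1) (Hk : 0 < k).

(** The distance from the saddle point [L0] to the real zero [- k L0]. *)
Let w0 : R := L0 * (1 + k).

Let w0_pos : 0 < w0.
Proof. unfold w0. apply Rmult_lt_0_compat; lra. Qed.

Let exp_w0 : exp w0 * (1 - vth * L0) = 1.
Proof.
  unfold w0, k. replace (L0 * (1 + - (L0 + ln (1 - vth * L0)) / L0)) with (- ln (1 - vth * L0)) by (field; lra).
  rewrite exp_Ropp, exp_ln by lra. field. lra.
Qed.

(** Since [occ y] vanishes at [- k L0], it is proportional to [exp (x + k L0) - 1]; the denominator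
    normalises it to 1 at the saddle point. *)
Let rel_occ_alt (s t : R) :
  rel_occ vth s (RtoC L0) t = ((Cexp (RtoC L0 * (contour s t + RtoC k)) - 1) / RtoC (exp w0 - 1))%C.
Proof.
  replace (RtoC L0 * (contour s t + RtoC k))%C with (RtoC L0 * (RtoC s * (cis t - 1)) + RtoC w0)%C
    by (unfold contour, w0; rewrite RtoC_mult, RtoC_plus; ring).
  rewrite Cexp_plus, Cexp_RtoC. unfold rel_occ. set (P := Cexp _).
  assert (E1 : exp w0 - 1 = vth * L0 * exp w0) by lra.
  pose proof (exp_pos w0) as He. assert (Hv0 : 0 < vth * L0) by nra.
  assert (Hw1 : exp w0 - 1 <> 0) by (rewrite E1; apply Rgt_not_eq; nra).
  assert (N1 : RtoC (exp w0 - 1) <> 0) by (intros E; apply RtoC_inj in E; lra).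
  assert (N2 : RtoC vth <> 0) by (intros E; apply RtoC_inj in E; lra).
  assert (N3 : RtoC L0 <> 0) by (intros E; apply RtoC_inj in E; lra).
  assert (E2 : (RtoC (exp w0) - 1)%C = (RtoC vth * RtoC L0 * RtoC (exp w0))%C).
  { rewrite <- !RtoC_mult, <- RtoC_minus. now rewrite E1. }
  assert (N4 : RtoC (exp w0) <> 0) by (intros E; apply RtoC_inj in E; lra).
  rewrite RtoC_minus, E2.
  replace (P * RtoC (exp w0) - 1)%C with ((P - 1) * RtoC (exp w0) + (RtoC (exp w0) - 1))%C by ring.
  rewrite E2. field. repeat split; assumption.
Qed.

(** On the circle, except at [t = 0], the exponent has real part below [w0]. The bound for
    [|exp w - 1|] then reduces the claim to a comparison of distances to the zero. *)
Let rel_occ_lt (s t m : R) : 0 < s -> Rabs t <= PI -> t <> 0 -> 0 < m ->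
  Cmod (contour s t + RtoC k) <= (1 + k) * m -> Cmod (rel_occ vth s (RtoC L0) t) < m.
Proof.
  intros Hs Ht H0 Hm Hle. rewrite rel_occ_alt. set (w := (RtoC L0 * (contour s t + RtoC k))%C).
  assert (He : 0 < exp w0 - 1) by (generalize (exp_ineq1 w0 ltac:(lra)); lra).
  rewrite Cmod_div, (Cmod_RtoC_pos (exp w0 - 1)) by (try (intros E; apply RtoC_inj in E); lra).
  destruct (classic (w = 0)) as [Ew|Ew].
  - rewrite Ew, Cexp_0. replace (1 - 1)%C with (RtoC 0) by ring. rewrite Cmod_0. unfold Rdiv. lra.
  - apply Rlt_div_l; [lra|].
    apply Rlt_le_trans with (Cmod w * ((exp w0 - 1) / w0)).
    + apply Cmod_Cexp_minus_1_lt; [|exact w0_pos | exact Ew].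
      unfold w. rewrite re_scal_l, re_plus, Re_contour, re_RtoC. unfold w0.
      apply Rmult_lt_compat_l; [exact HL0|]. generalize (cos_lt_1 t Ht H0). nra.
    + replace (m * (exp w0 - 1)) with (w0 * m * ((exp w0 - 1) / w0)) by (field; lra).
      apply Rmult_le_compat_r; [apply Rle_mult_inv_pos; lra|].
      unfold w, w0. rewrite Cmod_mult, Cmod_RtoC_pos, Rmult_assoc by lra.
      apply Rmult_le_compat_l; lra.
Qed.

Lemma rel_occ_lt_circle (t : R) : Rabs t <= PI -> t <> 0 ->
  Cmod (rel_occ vth 1 (RtoC L0) t) < exp (ln (Cmod (contour 1 t)) / vth).
Proof.
  intros Ht H0. rewrite exp_contour_1. apply rel_occ_lt; try assumption; try lra.
  rewrite contour_1. eapply Rle_trans; [apply Cmod_triangle|]. rewrite Cmod_cis, Cmod_RtoC_pos; lra.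
Qed.

(* [contour ((1 + k) / (2 + k))] is the circle of Apollonius [|x + k| = (1 + k) |x|]. *)
Lemma rel_occ_lt_apollonius (t : R) : 1 <= vth -> Rabs t <= PI -> t <> 0 ->
  let s := (1 + k) / (2 + k) in
  Cmod (rel_occ vth s (RtoC L0) t) < exp (ln (Cmod (contour s t)) / vth).
Proof.
  intros Hv1 Ht H0 s.
  assert (Hs : 1 / 2 < s <= 1).
  { unfold s. split; [apply (proj1 (Rlt_div_r (1 / 2) (1 + k) (2 + k) ltac:(lra))); lra|].
    apply (proj2 (Rle_div_l (1 + k) 1 (2 + k) ltac:(lra))). lra. }
  assert (Hg := Cmod_contour_ge s Hs t). assert (Hl := Cmod_contour_le s Hs t).
  (* Here [vth >= 1] enters: as the contour lies in the unit disc, its modulus is at most its power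
     [1 / vth]. *)
  apply Rlt_le_trans with (Cmod (contour s t)).
  - apply rel_occ_lt; try assumption; try lra.
    apply Rsqr_incr_0_var; [|apply Rmult_le_pos; lra]. unfold Rsqr.
    replace ((1 + k) * Cmod (contour s t) * ((1 + k) * Cmod (contour s t)))
      with ((1 + k) * (1 + k) * (Cmod (contour s t) * Cmod (contour s t))) by ring.
    rewrite !Cmod_sqr, re_plus, Re_contour, re_RtoC.
    assert (EI : Im (contour s t) = s * sin t) by (unfold contour; rewrite cis_alt; unfold Im; simpl; ring).
    assert (EI2 : Im (contour s t + RtoC k) = s * sin t) by (rewrite <- EI; unfold Im; simpl; ring).
    rewrite EI, EI2.
    assert (Esc : sin t * sin t = 1 - cos t * cos t) by (generalize (sin2_cos2 t); unfold Rsqr; lra).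
    assert (Ek : s * (2 + k) = 1 + k) by (unfold s; field; lra).
    set (c := cos t) in *.
    replace (s * sin t * (s * sin t)) with (s * s * (1 - c * c)) by (rewrite <- Esc; ring).
    (* On this circle equality holds: the difference has the factor [s (2 + k) - (1 + k)], which is
       0 by the choice of [s]. *)
    right.
    replace ((1 + k) * (1 + k) * ((1 + s * (c - 1)) * (1 + s * (c - 1)) + s * s * (1 - c * c))) with
     ((1 + s * (c - 1) + k) * (1 + s * (c - 1) + k) + s * s * (1 - c * c)
      + 2 * k * s * (1 - c) * (s * (2 + k) - (1 + k))) by ring.
    rewrite Ek. ring.
  - rewrite <- (exp_ln (Cmod (contour s t))) at 1 by lra. apply exp_le.
    assert (Hln : ln (Cmod (contour s t)) <= 0) by (rewrite <- ln_1; apply ln_le; lra).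
    apply (proj1 (Rle_div_r _ _ _ Hv)). nra.
Qed.

End Modulus.

(** * Where the principal power of [occ] is defined *)

(** The imaginary part of [occ] is [E exp (Re x) sin (Im x)]; in the strip [|Im x| < PI] it vanishes
    on the real axis only. *)
Lemma occ_slit (E : R) (x : C) : 0 < E -> Rabs (Im x) < PI ->
  (Im x = 0 -> 0 < 1 - E + E * exp (Re x)) -> slit (occ (RtoC E) x).
Proof.
  intros HE Hx H0. assert (HPI := PI_RGT_0).
  assert (EI : Im (occ (RtoC E) x) = E * exp (Re x) * sin (Im x)).
  { unfold occ, Cexp, Re, Im. simpl. ring. }
  assert (ER : Re (occ (RtoC E) x) = 1 - E + E * (exp (Re x) * cos (Im x))).
  { unfold occ, Cexp, Re, Im. simpl. ring. }
  pose proof (exp_pos (Re x)) as He.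
  destruct (Req_dec (Im x) 0) as [Ex|Ex].
  - apply slit_Re. rewrite ER, Ex, cos_0, Rmult_1_r. now apply H0.
  - apply slit_Im. rewrite EI.
    assert (Hs : sin (Im x) <> 0).
    { destruct (Rdichotomy _ _ Ex) as [h|h].
      - rewrite Rabs_left in Hx by lra. apply Rlt_not_eq, sin_lt_0_var; lra.
      - rewrite Rabs_right in Hx by lra. apply Rgt_not_eq, sin_gt_0; lra. }
    apply Rmult_integral_contrapositive_currified; [|exact Hs]. nra.
Qed.

Section RealSaddle.
Variables (vth E L0 : R).
Hypotheses (HE : 0 < E) (HL0 : 0 < L0) (Hv : 1 <= vth).
Hypothesis Hsaddle : E * ((vth * L0 - 1) * exp L0) = 1 - E.

Lemma occ_slit_convex (u t : R) : 1 <= vth * L0 -> 0 <= u <= 1 ->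
  slit (occ (RtoC E) (RtoC u * (RtoC L0 * contour 1 t))).
Proof.
  intros HvL Hu. rewrite contour_1. assert (HPI := PI2_1).
  set (x := (RtoC u * (RtoC L0 * cis t))%C).
  assert (Hx : Cmod x <= L0).
  { unfold x. rewrite !Cmod_mult, Cmod_cis, !Cmod_RtoC_pos by lra. nra. }
  pose proof (exp_pos L0) as HeL. 
  assert (HE1 : 0 <= 1 - E).
  { rewrite <- Hsaddle. apply Rmult_le_pos; [lra | apply Rmult_le_pos; lra]. }
  (* For [L0 < PI] the disc lies in the strip. Otherwise [vth L0 - 1 > 1], so [E |exp x|] is smaller
     than [1 - E] and [occ] stays in the right half-plane. *)
  destruct (Rlt_dec L0 PI) as [Hlt|Hge].
  - apply occ_slit; [exact HE | |].
    + generalize (Rabs_Im_le_Cmod x); lra.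
    + intros _. assert (0 < E * exp (Re x)) by (apply Rmult_lt_0_compat; [exact HE | apply exp_pos]). lra.
  - apply slit_Re.
    assert (EO : occ (RtoC E) x = (RtoC (1 - E) + RtoC E * Cexp x)%C) by (unfold occ; rewrite RtoC_minus; ring).
    rewrite EO, re_plus, re_RtoC.
    assert (H1 : Cmod (RtoC E * Cexp x) <= E * exp L0).
    { rewrite Cmod_mult, Cmod_RtoC_pos, Cmod_Cexp by lra. apply Rmult_le_compat_l; [lra|].
      apply exp_le. generalize (Re_le_Cmod x); lra. }
    assert (H2 : E * exp L0 < 1 - E).
    { rewrite <- Hsaddle. apply Rmult_lt_compat_l; [exact HE|].
      assert (1 * L0 <= vth * L0) by (apply Rmult_le_compat_r; lra).
      rewrite <- (Rmult_1_l (exp L0)) at 1. apply Rmult_lt_compat_r; lra. }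
    generalize (re_le_Cmod (RtoC E * Cexp x)) (Rabs_le_between (Re (RtoC E * Cexp x)) (Cmod (RtoC E * Cexp x))). lra.
Qed.

(** As [vth >= 1], the disc has points of modulus at most [L0 < 1] and lies in the strip. Its
    leftmost point is [L0 (1 - 2 s) = - L0 k / (2 + k)], to the right of the zero [- k L0]. *)
Lemma occ_slit_apollonius (u t : R) : vth * L0 < 1 -> 0 <= u <= 1 ->
  let k := - (L0 + ln (1 - vth * L0)) / L0 in 0 < k ->
  slit (occ (RtoC E) (RtoC u * (RtoC L0 * contour ((1 + k) / (2 + k)) t))).
Proof.
  intros HvL Hu k Hk. set (s := (1 + k) / (2 + k)). assert (HPI := PI2_1).
  assert (Hs : 1 / 2 < s <= 1).
  { unfold s. split; [apply (proj1 (Rlt_div_r (1 / 2) (1 + k) (2 + k) ltac:(lra))); lra|].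
    apply (proj2 (Rle_div_l (1 + k) 1 (2 + k) ltac:(lra))). lra. }
  set (x := (RtoC u * (RtoC L0 * contour s t))%C).
  assert (Hx : Cmod x <= L0).
  { unfold x. rewrite !Cmod_mult, !Cmod_RtoC_pos by lra.
    generalize (Cmod_contour_le s Hs t) (Cmod_ge_0 (contour s t)). intros.
    assert (L0 * Cmod (contour s t) <= L0 * 1) by (apply Rmult_le_compat_l; lra).
    assert (0 <= L0 * Cmod (contour s t)) by (apply Rmult_le_pos; lra). nra. }
  assert (HL1 : L0 < 1) by nra.
  apply occ_slit; [exact HE | |].
  - generalize (Rabs_Im_le_Cmod x); lra.
  - intros _.
    assert (HRx : - (k * L0) < Re x).
    { unfold x. rewrite !re_scal_l, Re_contour.
      assert (Hc : - (k / (2 + k)) <= 1 + s * (cos t - 1)).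
      { replace (- (k / (2 + k))) with (1 - 2 * s) by (unfold s; field; lra). generalize (COS_bound t). nra. }
      assert (Hk2 : k / (2 + k) < k).
      { apply Rlt_div_l; [lra|]. nra. }
      assert (Hk3 : 0 < k / (2 + k)) by (apply Rdiv_lt_0_compat; lra).
      assert (u * (L0 * - (k / (2 + k))) <= u * (L0 * (1 + s * (cos t - 1)))).
      { apply Rmult_le_compat_l; [lra|]. apply Rmult_le_compat_l; lra. }
      assert (u * (L0 * (k / (2 + k))) <= 1 * (L0 * (k / (2 + k)))).
      { apply Rmult_le_compat_r; [|lra]. apply Rmult_le_pos; lra. }
      assert (L0 * (k / (2 + k)) < L0 * k) by (apply Rmult_lt_compat_l; lra).
      lra. }
    assert (Hexp : exp (- (k * L0)) = (1 - vth * L0) * exp L0).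
    { unfold k. replace (- (- (L0 + ln (1 - vth * L0)) / L0 * L0)) with (ln (1 - vth * L0) + L0) by (field; lra).
      rewrite exp_plus, exp_ln by lra. reflexivity. }
    apply exp_increasing in HRx. rewrite Hexp in HRx. apply Rmult_lt_compat_l with (r := E) in HRx; [|exact HE]. lra.
Qed.

End RealSaddle.

(** * The saddle point [L3] *)

Section Saddle.
Variable vth : R.
Hypothesis Hv : 0 < vth.

Let Hv0 : RtoC vth <> 0.
Proof. intros E; apply RtoC_inj in E; lra. Qed.

Lemma L3_equation (z : C) : C_minus_ray (- exp (-1)) (W_arg vth z) ->
  ((RtoC vth * L3 vth z - 1) * Cexp (L3 vth z))%C = (Cexp (- z) - 1)%C.
Proof.
  intros Hz. pose proof (proj1 (proj2 LambertW0_spec) _ Hz) as E.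
  unfold L3. set (w := LambertW0 (W_arg vth z)) in *. unfold W_arg in E.
  rewrite <- RtoC_inv, Cexp_plus, Cexp_RtoC by lra.
  assert (Ee : (RtoC (exp (- / vth)) * RtoC (exp (/ vth)))%C = 1).
  { rewrite <- RtoC_mult, <- exp_plus. replace (- / vth + / vth) with 0 by ring. now rewrite exp_0. }
  rewrite RtoC_inv by lra.
  replace ((RtoC vth * (/ RtoC vth + w) - 1) * (RtoC (exp (/ vth)) * Cexp w))%C
    with (RtoC vth * RtoC (exp (/ vth)) * (w * Cexp w))%C by (field; exact Hv0).
  rewrite E.
  replace (RtoC vth * RtoC (exp (/ vth)) * (/ RtoC vth * (Cexp (- z) - 1) * RtoC (exp (- / vth))))%C
    with ((Cexp (- z) - 1) * (RtoC (exp (- / vth)) * RtoC (exp (/ vth))))%C by (field; exact Hv0).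
  rewrite Ee. ring.
Qed.

(** The argument of [W0] exceeds the value of [w exp w] at [- 1 / vth]. For [vth > 1] monotonicity
    gives [W0 > - 1 / vth], that is, [L0 > 0]; for [vth <= 1] this follows from [W0 > -1], which in
    all cases is the positivity of [L0 + 1 - 1 / vth]. *)
Lemma L3_real (x : R) : exists L0 : R,
  C_minus_ray (- exp (-1)) (W_arg vth (RtoC x)) /\ L3 vth (RtoC x) = RtoC L0 /\
  0 < L0 /\ 0 < L0 + 1 - / vth /\ (vth * L0 - 1) * exp L0 = exp (- x) - 1.
Proof.
  set (r := / vth * (exp (- x) - 1) * exp (- / vth)).
  assert (Er : W_arg vth (RtoC x) = RtoC r).
  { unfold W_arg, r. rewrite <- RtoC_opp, Cexp_RtoC, !RtoC_mult, RtoC_minus, RtoC_inv by lra. reflexivity. }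
  pose proof (Rinv_0_lt_compat _ Hv) as Hiv. pose proof (exp_pos (- x)) as Hex. pose proof (exp_pos (- / vth)) as Hev.
  assert (Hr1 : - / vth * exp (- / vth) < r).
  { unfold r. assert (0 < / vth * exp (- x) * exp (- / vth)) by (apply Rmult_lt_0_compat; [apply Rmult_lt_0_compat|]; assumption). lra. }
  assert (Hr2 : - exp (-1) < r).
  { eapply Rle_lt_trans; [|exact Hr1].
    assert (/ vth * exp (- / vth) <= exp (-1)); [|lra].
    replace (-1) with ((- / vth) + (/ vth - 1)) by ring. rewrite exp_plus, Rmult_comm.
    apply Rmult_le_compat_l; [lra|]. generalize (exp_ineq1_le (/ vth - 1)). lra. }
  assert (Hm : C_minus_ray (- exp (-1)) (RtoC r)) by (intros [_ H]; simpl in H; lra).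
  destruct (W0_range_surj _ Hm) as [w [Hw Ew]].
  assert (HIw : Im w = 0) by (apply (W0_range_sign w Hw); rewrite Ew; reflexivity).
  assert (Hw1 : -1 < Re w) by now apply Hw.
  rewrite (Im_0_RtoC w HIw), wexp_RtoC in Ew. apply RtoC_inj in Ew.
  assert (EL : L3 vth (RtoC x) = RtoC (/ vth + Re w)).
  { unfold L3. rewrite Er, <- Ew, (proj2 (proj2 LambertW0_spec)) by exact Hw1.
    rewrite RtoC_plus, RtoC_inv by lra. reflexivity. }
  exists (/ vth + Re w). rewrite Er. split; [exact Hm|]. split; [exact EL|]. split; [|split].
  - destruct (Rle_dec 1 (/ vth)) as [h|h]; [lra|]. apply Rnot_le_lt. intros Hle.
    destruct (Rle_lt_or_eq_dec (Re w) (- / vth) ltac:(lra)) as [h'|h'].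
    + generalize (real_wexp_increasing (Re w) (- / vth) Hw1 h'). lra.
    + rewrite h' in Ew. lra.
  - lra.
  - assert (Hm' : C_minus_ray (- exp (-1)) (W_arg vth (RtoC x))) by now rewrite Er.
    apply L3_equation in Hm'. rewrite EL in Hm'. apply RtoC_inj.
    rewrite RtoC_mult, !RtoC_minus, RtoC_mult, <- !Cexp_RtoC, RtoC_opp. exact Hm'.
Qed.

Lemma locally_Cmod (z : C) (P : C -> Prop) (d : R) : 0 < d ->
  (forall y, Cmod (y - z) < d -> P y) -> locally (T := C_UniformSpace) z P.
Proof.
  intros Hd H. exists (mkposreal (d / 2) ltac:(lra)). intros y Hy. apply H.
  apply C_NormedModule_mixin_compat2 in Hy. eapply Rlt_le_trans; [exact Hy|]. simpl.
  assert (sqrt 2 <= 2). { rewrite <- (sqrt_Rsqr 2) at 2 by lra. apply sqrt_le_1_alt. unfold Rsqr; lra. }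
  nra.
Qed.

Lemma ccont_W_arg (z : C) : ccont (U := C_UniformSpace) (W_arg vth) z.
Proof.
  unfold W_arg. apply ccont_mult; [|apply ccont_const]. apply ccont_mult; [apply ccont_const|].
  apply ccont_minus; [|apply ccont_const].
  apply (ccont_Cexp (U := C_UniformSpace) (fun z => - z)%C), ccont_opp, ccont_id.
Qed.

Lemma L3_cont (z : C) : C_minus_ray (- exp (-1)) (W_arg vth z) -> ccont (U := C_UniformSpace) (L3 vth) z.
Proof.
  intros Hz. apply ccont_intro. intros e He.
  destruct (LambertW0_continuous _ e Hz He) as [d [Hd H]].
  eapply filter_imp; [|apply (ccont_near (W_arg vth) z d Hd (ccont_W_arg z))].
  intros y Hy. specialize (H _ Hy). unfold L3.
  replace (/ RtoC vth + LambertW0 (W_arg vth y) - (/ RtoC vth + LambertW0 (W_arg vth z)))%C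
    with (LambertW0 (W_arg vth y) - LambertW0 (W_arg vth z))%C by ring. exact H.
Qed.

Lemma W_arg_real_near (x : R) : C_minus_ray (- exp (-1)) (W_arg vth (RtoC x)) ->
  locally (T := C_UniformSpace) (RtoC x) (fun z => C_minus_ray (- exp (-1)) (W_arg vth z)).
Proof.
  intros Hx.
  assert (EI : Im (W_arg vth (RtoC x)) = 0).
  { unfold W_arg. rewrite <- RtoC_inv, <- RtoC_opp, Cexp_RtoC, <- RtoC_minus, <- !RtoC_mult by lra. reflexivity. }
  assert (ER : 0 < Re (W_arg vth (RtoC x)) + exp (-1)).
  { apply Rnot_le_lt. intros h. apply Hx. split; [exact EI | lra]. }
  eapply filter_imp; [|apply (locally_pos (U := C_UniformSpace) (fun z => Re (W_arg vth z) + exp (-1)))].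
  - intros z Hz [_ h]. lra.
  - apply (continuous_plus (V := R_NormedModule) (fun z : C_UniformSpace => Re (W_arg vth z)) (fun _ => exp (-1))).
    + exact (proj1 (ccont_W_arg _)).
    + apply continuous_const.
  - exact ER.
Qed.

(* [f(L) = vth L exp (z + L)] for [f = occ (exp z)] and [L = L3 vth z]. *)
Lemma occ_L3 (z : C) (s t : R) : C_minus_ray (- exp (-1)) (W_arg vth z) -> L3 vth z <> 0 ->
  occ (Cexp z) (L3 vth z * contour s t) =
  (RtoC vth * L3 vth z * Cexp (z + L3 vth z) * rel_occ vth s (L3 vth z) t)%C.
Proof.
  intros Hz HL. pose proof (L3_equation z Hz) as E. rewrite Cexp_opp in E. pose proof (Cexp_neq_0 z) as H0.
  set (L := L3 vth z) in *. unfold occ, rel_occ, contour.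
  replace (L * (1 + RtoC s * (cis t - 1)))%C with (L + L * (RtoC s * (cis t - 1)))%C by ring.
  rewrite !Cexp_plus. set (P := Cexp (L * (RtoC s * (cis t - 1)))).
  set (y := Cexp z) in *. set (e := Cexp L) in *.
  assert (E2 : (y * e)%C = (1 - y + y * (1 - / y) + y * (RtoC vth * L * e - (RtoC vth * L - 1) * e))%C) by (field; exact H0).
  replace (RtoC vth * L * (y * e) * (1 + / (RtoC vth * L) * (P - 1)))%C with
    (y * ((RtoC vth * L - 1) * e) + y * e * P)%C by (field; split; assumption).
  rewrite E. field. exact H0.
Qed.

End Saddle.

(** * Reduction of the ratio to a normalised integral *)

Lemma SS_mgf_stirling (n : nat) (theta : R) (z : C) : (1 <= n)%nat -> theta <> 0 ->
  SS_mgf n theta z = (stirling_poly n theta (Cexp z) / RtoC (theta ^ n))%C.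
Proof.
  intros Hn Ht.
  assert (Htn : theta ^ n <> 0) by now apply pow_nonzero.
  assert (Htn' : RtoC (theta ^ n) <> 0) by (intros E; apply RtoC_inj in E; contradiction).
  unfold SS_mgf, SS_expect, stirling_poly, sum_n.
  rewrite (sum_Sn_m (G := C_AbelianMonoid) _ 0 n) by lia.
  assert (E0 : stirling2 n 0 = 0%nat) by (destruct n; [lia | reflexivity]).
  rewrite E0. simpl (INR 0). rewrite Rmult_0_l, Cmult_0_l, (plus_zero_l (G := C_AbelianMonoid)).
  unfold Cdiv. rewrite Cmult_comm.
  change (sum_n_m (fun k => SS_pmf n theta k * Cexp (z * INR k)%C)%C 1 n =
   mult (K := C_Ring) (/ RtoC (theta ^ n))%C (sum_n_m (G := C_Ring) (fun k => (INR (stirling2 n k) * falling theta k)%R * Cexp z ^ k)%C 1 n)).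
  rewrite <- (sum_n_m_mult_l (K := C_Ring)).
  apply (sum_n_m_ext (G := C_AbelianMonoid)). intros k.
  rewrite (Cmult_comm z), Cexp_pow. unfold SS_pmf. rewrite RtoC_div by exact Htn.
  change (mult (K := C_Ring) ?a ?b) with (Cmult a b).
  unfold Cdiv. cring.
Qed.

(** By Stirling's formula it is asymptotic to [sqrt (n / (2 PI))]; below it is controlled through
    [kappa_reference] instead. *)
Definition kappa (n : nat) : R := INR (fact n) / (2 * PI) * exp (INR n) / INR n ^ n.

(** A logarithm of [f(L)], in general not the principal one, made of the terms of [phi3]. *)
Definition log_occ (vth : R) (z : C) : C := (RtoC (ln vth) + Clog (L3 vth z) + z + L3 vth z)%C.

Lemma Cexp_log_occ (vth : R) (z : C) : 0 < vth -> L3 vth z <> 0 ->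
  Cexp (log_occ vth z) = (RtoC vth * L3 vth z * Cexp (z + L3 vth z))%C.
Proof.
  intros Hv HL. unfold log_occ.
  replace (RtoC (ln vth) + Clog (L3 vth z) + z + L3 vth z)%C with
    (RtoC (ln vth) + Clog (L3 vth z) + (z + L3 vth z))%C by ring.
  rewrite (Cexp_plus (_ + _)), (Cexp_plus (RtoC _)), Cexp_RtoC, exp_ln, Cexp_Clog by assumption. reflexivity.
Qed.

(** From [vth * log_occ = phi3 + ln vth + 1 + Clog L3]: the powers of [vth] and of [L3] cancel, and
    [exp n] goes into [kappa]. *)
Lemma ratio_formula (vth : R) (z J : C) (n : nat) : 0 < vth -> (1 <= n)%nat -> L3 vth z <> 0 ->
  stirling_poly n (vth * INR n) (Cexp z) =
    (RtoC (INR (fact n) / (2 * PI)) / L3 vth z ^ n * (Cexp (RtoC (vth * INR n) * log_occ vth z) * J))%C ->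
  ratio3 vth n z = (RtoC (kappa n) * J)%C.
Proof.
  intros Hv Hn HL E.
  assert (HnR : 0 < INR n) by (apply lt_0_INR; lia).
  unfold ratio3. rewrite SS_mgf_stirling, E by (try assumption; apply Rgt_not_eq; nra).
  assert (EX : Cexp (RtoC (vth * INR n) * log_occ vth z) =
    (Cexp (RtoC (INR n) * phi3 vth z) * (RtoC (vth ^ n) * RtoC (exp (INR n)) * L3 vth z ^ n))%C).
  { rewrite <- (Cexp_Clog (L3 vth z) HL).
    replace (RtoC (vth ^ n)) with (Cexp (RtoC (INR n) * RtoC (ln vth))).
    2:{ rewrite Cexp_pow, Cexp_RtoC, exp_ln, RtoC_pow by exact Hv. reflexivity. }
    rewrite <- Cexp_RtoC, <- Cexp_pow, <- !Cexp_plus. f_equal.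
    unfold phi3, log_occ. rewrite !RtoC_mult, !RtoC_minus. ring. }
  rewrite EX. unfold kappa.
  pose proof (Cexp_neq_0 (RtoC (INR n) * phi3 vth z)) as H1.
  pose proof (Cpow_nz _ n HL) as H2.
  assert (H3 : RtoC (vth ^ n) <> 0) by (intros E0; apply RtoC_inj in E0; generalize (pow_lt vth n Hv); lra).
  assert (H4 : RtoC (INR n ^ n) <> 0) by (intros E0; apply RtoC_inj in E0; generalize (pow_lt (INR n) n HnR); lra).
  rewrite Rpow_mult_distr, RtoC_mult.
  rewrite (RtoC_div _ (INR n ^ n)), (RtoC_mult _ (exp (INR n))) by (generalize (pow_lt (INR n) n HnR); lra).
  field. repeat split; assumption.
Qed.

Lemma radicand3_alt (vth : R) (z : C) : 0 < vth -> (L3 vth z + 1 - / RtoC vth)%C <> 0 ->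
  radicand3 vth z = (/ (L3 vth z + 1 - / RtoC vth))%C /\ (RtoC vth * L3 vth z + RtoC vth - 1)%C <> 0.
Proof.
  intros Hv Ha. assert (Hv0 : RtoC vth <> 0) by (intros E; apply RtoC_inj in E; lra).
  assert (E : (RtoC vth * L3 vth z + RtoC vth - 1)%C = (RtoC vth * (L3 vth z + 1 - / RtoC vth))%C) by (field; exact Hv0).
  assert (Hn : (RtoC vth * L3 vth z + RtoC vth - 1)%C <> 0) by (rewrite E; now apply Cmult_neq_0).
  split; [|exact Hn]. unfold radicand3. rewrite E. clear E Hn.
  generalize dependent (L3 vth z + 1 - / RtoC vth)%C. intros a Ha. field. split; assumption.
Qed.

(** * The integral representation near a real point *)

Definition power_like (vth s : R) (L : C) (n : nat) (t0 : R) (U : R -> C) : Prop :=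
  ccont_on U (- PI) PI /\
  (forall t r, Rabs t <= PI -> Cmod (rel_occ vth s L t) <= exp r -> Cmod (U t) <= exp (vth * INR n * r)) /\
  (forall t, Rabs t <= t0 -> U t = Cexp (RtoC (vth * INR n) * Clog (rel_occ vth s L t))).

Definition saddle_integral (s : R) (n : nat) (U : R -> C) : C :=
  CInt (fun t => U t / contour s t ^ n * weight s t)%C (- PI) PI.

Lemma rel_occ_cont (vth s : R) (L : C) (t : R) : ccont (rel_occ vth s L) t.
Proof.
  unfold rel_occ. apply ccont_plus; [apply ccont_const|]. apply ccont_mult; [apply ccont_const|].
  apply ccont_minus; [|apply ccont_const]. apply ccont_Cexp, ccont_mult; [apply ccont_const|].
  apply ccont_mult; [apply ccont_const|]. apply ccont_minus; [apply cis_cont | apply ccont_const].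
Qed.

Lemma power_like_nat (vth s : R) (L : C) (n m : nat) (t0 : R) : vth * INR n = INR m ->
  (forall t, Rabs t <= t0 -> rel_occ vth s L t <> 0) ->
  power_like vth s L n t0 (fun t => rel_occ vth s L t ^ m)%C.
Proof.
  intros Em H0. split; [|split].
  - intros t _. apply ccont_pow, rel_occ_cont.
  - intros t r _ Hr. rewrite Em, exp_INR_mult, Cmod_pow. apply pow_incr. split; [apply Cmod_ge_0 | exact Hr].
  - intros t Ht. rewrite Em, Cexp_pow, Cexp_Clog by now apply H0. reflexivity.
Qed.

Lemma representation_nat (vth s : R) (z : C) (n m : nat) : 0 < vth -> 1 / 2 < s <= 1 ->
  (1 <= n)%nat -> vth * INR n = INR m ->
  C_minus_ray (- exp (-1)) (W_arg vth z) -> L3 vth z <> 0 ->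
  ratio3 vth n z = (RtoC (kappa n) * saddle_integral s n (fun t => rel_occ vth s (L3 vth z) t ^ m))%C.
Proof.
  intros Hv Hs Hn Em Hz HL. apply ratio_formula; try assumption.
  rewrite Em, (cauchy_nat s (Cexp z) (L3 vth z) n Hs HL m), Cexp_pow. f_equal. unfold saddle_integral.
  rewrite <- (CInt_scal _ _ PI_opp_le).
  - apply CInt_ext; [apply PI_opp_le|]. intros t _.
    rewrite (occ_L3 vth Hv z s t Hz HL), Cpow_mult_l, <- (Cexp_log_occ vth z Hv HL). unfold Cdiv. ring.
  - intros t _. apply ccont_mult; [|now apply weight_cont].
    apply ccont_div; [apply ccont_pow, rel_occ_cont | apply ccont_pow, contour_cont | now apply Cpow_nz, contour_neq_0].
Qed.

Section RealExponent.
Variables (vth s t0 : R) (z : C) (n : nat).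
Hypotheses (Hv : 0 < vth) (Hs : 1 / 2 < s <= 1) (Hn : (1 <= n)%nat).
Hypotheses (Hz : C_minus_ray (- exp (-1)) (W_arg vth z)) (HL : L3 vth z <> 0).

Let q t := occ (Cexp z) (L3 vth z * contour s t).
Let U t := Cexp (RtoC (vth * INR n) * (Clog (q t) - log_occ vth z)).

Lemma representation_real (e : R) : 0 < e ->
  (forall u t, - e < u < 1 + e -> - PI - e < t < PI + e -> slit (occ (Cexp z) (RtoC u * (L3 vth z * contour s t)))) ->
  ratio3 vth n z = (RtoC (kappa n) * saddle_integral s n U)%C.
Proof.
  intros He Hslit. apply ratio_formula; try assumption.
  rewrite (cauchy_real s (Cexp z) (L3 vth z) n Hs HL _ e He Hslit). f_equal. unfold saddle_integral.
  rewrite <- (CInt_scal _ _ PI_opp_le).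
  - apply CInt_ext; [apply PI_opp_le|]. intros t _. fold (q t). unfold U.
    replace (RtoC (vth * INR n) * Clog (q t))%C with
      (RtoC (vth * INR n) * log_occ vth z + RtoC (vth * INR n) * (Clog (q t) - log_occ vth z))%C by ring.
    rewrite Cexp_plus. unfold Cdiv. ring.
  - intros t Ht. apply ccont_mult; [|now apply weight_cont].
    apply ccont_div; [|apply ccont_pow, contour_cont | now apply Cpow_nz, contour_neq_0].
    unfold U. apply ccont_Cexp, ccont_mult; [apply ccont_const|]. apply ccont_minus; [|apply ccont_const].
    apply ccont_Clog.
    + unfold q. apply ccont_occ, ccont_mult; [apply ccont_const | apply contour_cont].
    + unfold q. rewrite <- (Cmult_1_l (L3 vth z * contour s t)). apply Hslit; lra.
Qed.

(** The modulus of [U] is right for any logarithm of [f(L)]. The branch is right where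
    [Clog (q t) - log_occ] has imaginary part within [(-PI, PI]]; near [t = 0] each of the two
    contributes less than [PI / 2]. *)
Lemma power_like_real :
  (forall t, Rabs t <= PI -> slit (q t)) ->
  (forall t, Rabs t <= t0 -> 0 < Re (q t)) -> Rabs (Im (log_occ vth z)) < PI / 2 ->
  power_like vth s (L3 vth z) n t0 U.
Proof.
  intros Hslit Hre Him.
  assert (HnR : 0 < INR n) by (apply lt_0_INR; lia).
  assert (Hrel : forall t, slit (q t) -> rel_occ vth s (L3 vth z) t = Cexp (Clog (q t) - log_occ vth z)).
  { intros t Ht. unfold Cminus. rewrite Cexp_plus, Cexp_opp, Cexp_Clog by now apply slit_neq_0.
    unfold q. rewrite (occ_L3 vth Hv z s t Hz HL), <- (Cexp_log_occ vth z Hv HL).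
    field. apply Cexp_neq_0. }
  split; [|split].
  - intros t Ht. unfold U. apply ccont_Cexp, ccont_mult; [apply ccont_const|]. apply ccont_minus; [|apply ccont_const].
    apply ccont_Clog; [unfold q; apply ccont_occ, ccont_mult; [apply ccont_const | apply contour_cont]|].
    apply Hslit, Rabs_le_between; lra.
  - intros t r Ht Hr. rewrite (Hrel t (Hslit t Ht)), Cmod_Cexp in Hr.
    unfold U. rewrite Cmod_Cexp, re_scal_l. apply exp_le. apply Rmult_le_compat_l; [nra|].
    apply Rnot_lt_le. intros h. apply exp_increasing in h. lra.
  - intros t Ht. specialize (Hre t Ht). unfold U. do 2 f_equal.
    rewrite (Hrel t (slit_Re _ Hre)), Clog_Cexp; [reflexivity|].
    apply Rabs_lt_between in Him. pose proof (Carg_Re_pos_bound _ Hre) as Hc.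
    change (Im (Clog (q t) - log_occ vth z)) with (Carg (q t) + - Im (log_occ vth z)). lra.
Qed.

End RealExponent.

Lemma locally_slit {U : UniformSpace} (f : U -> C) (u : U) :
  ccont f u -> slit (f u) -> locally u (fun v => slit (f v)).
Proof.
  intros [H1 H2] Hs. destruct (slit_cases _ Hs) as [h|[h|h]].
  - eapply filter_imp; [|exact (locally_pos _ _ H1 h)]. intros v Hv. now apply slit_Re.
  - eapply filter_imp; [|exact (locally_pos _ _ H2 h)]. intros v Hv. apply slit_Im. lra.
  - eapply filter_imp; [|exact (locally_neg _ _ H2 h)]. intros v Hv. apply slit_Im. lra.
Qed.

Lemma rel_occ_neq_0_near (vth s L0 : R) : 0 < vth -> 0 < L0 ->
  exists e, 0 < e /\ forall L t, Cmod (L - RtoC L0) < e -> Rabs t < e -> rel_occ vth s L t <> 0.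
Proof.
  intros Hv HL.
  assert (HL0 : RtoC L0 <> 0) by (intros E; apply RtoC_inj in E; lra).
  destruct (locally_triple _ _ _ _ (ccont_near _ _ 1 Rlt_0_1 (ccont_rel_occ vth s (RtoC L0) 0 0 Hv HL0))) as [e [He H]].
  exists e. split; [exact He|]. intros L t H1 H2 E. 
  specialize (H L 0 t H1). rewrite Rminus_0_r, Rabs_R0, Rminus_0_r in H. specialize (H He H2). simpl in H.
  assert (E1 : rel_occ vth s (RtoC L0) 0 = 1).
  { unfold rel_occ. rewrite cis_0. replace (RtoC L0 * (RtoC s * (1 - 1)))%C with (RtoC 0) by ring.
    rewrite Cexp_0. ring. }
  rewrite E, E1 in H. replace (0 - 1)%C with (- (1))%C in H by ring. rewrite Cmod_opp, Cmod_1 in H. lra.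
Qed.

(** What the choice of a circle has to provide near the real point [x]. The threshold [N] is for
    [vth < 1], where non-integral [vth n] is excluded for large [n] only. *)
Definition saddle_data (vth x L0 s t0 : R) : Prop :=
  1 / 2 < s <= 1 /\ 0 < t0 /\
  (forall t, Rabs t <= PI -> t <> 0 -> Cmod (rel_occ vth s (RtoC L0) t) < exp (ln (Cmod (contour s t)) / vth)) /\
  exists d N, 0 < d /\ forall z n, Cmod (z - RtoC x) < d -> (N <= n)%nat -> (1 <= n)%nat ->
    SS_defined n (vth * INR n) ->
    exists U, power_like vth s (L3 vth z) n t0 U /\
      ratio3 vth n z = (RtoC (kappa n) * saddle_integral s n U)%C.

Section LocalRepresentation.
Variables (vth x L0 : R).
Hypotheses (Hv : 0 < vth) (HL0 : 0 < L0).
Hypothesis Hray : C_minus_ray (- exp (-1)) (W_arg vth (RtoC x)).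
Hypothesis EL : L3 vth (RtoC x) = RtoC L0.
Hypothesis Hsaddle : (vth * L0 - 1) * exp L0 = exp (- x) - 1.

Let HLc : ccont (U := C_UniformSpace) (L3 vth) (RtoC x) := L3_cont vth (RtoC x) Hray.

Let L3_near (e : R) : 0 < e -> locally (T := C_UniformSpace) (RtoC x) (fun z => Cmod (L3 vth z - RtoC L0) < e).
Proof. intros He. rewrite <- EL. now apply ccont_near. Qed.

Let L3_neq_0_near : locally (T := C_UniformSpace) (RtoC x) (fun z => L3 vth z <> 0).
Proof.
  refine (filter_imp _ _ _ (L3_near L0 HL0)). intros z Hz E. rewrite E in Hz.
  replace (0 - RtoC L0)%C with (- RtoC L0)%C in Hz by ring. rewrite Cmod_opp, Cmod_RtoC_pos in Hz; lra.
Qed.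

Lemma saddle_data_nat (s : R) : vth < 1 -> 1 / 2 < s <= 1 ->
  (forall t, Rabs t <= PI -> t <> 0 -> Cmod (rel_occ vth s (RtoC L0) t) < exp (ln (Cmod (contour s t)) / vth)) ->
  exists t0, saddle_data vth x L0 s t0.
Proof.
  intros Hv1 Hs Hmod. destruct (rel_occ_neq_0_near vth s L0 Hv HL0) as [e [He Hrel]].
  exists (e / 2). split; [exact Hs|]. split; [lra|]. split; [exact Hmod|].
  destruct (locally_C_Cmod _ _ (filter_and _ _ (L3_near e He) (filter_and _ _ L3_neq_0_near (W_arg_real_near vth Hv x Hray))))
    as [d [Hd H]].
  (* The condition [vth n > n - 1] means [n < 1 / (1 - vth)]; beyond that, [vth n] has to be an
     integer. *)
  destruct (nfloor_ex (/ (1 - vth))) as [N HN]; [apply Rlt_le, Rinv_0_lt_compat; lra|].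
  exists d, (S N). split; [exact Hd|]. intros z n Hz HNn Hn Hdef.
  destruct (H z Hz) as (H1 & H2 & H3).
  assert (Hm : exists m : nat, vth * INR n = INR m).
  { destruct Hdef as [_ [[m [_ Em]]|Hgt]]; [exists m; exact Em|]. exfalso.
    assert (INR (S N) <= INR n) by now apply le_INR. rewrite S_INR in H0.
    assert (/ (1 - vth) * (1 - vth) < INR n * (1 - vth)) by (apply Rmult_lt_compat_r; lra).
    rewrite Rinv_l in H4 by lra. lra. }
  destruct Hm as [m Em].
  exists (fun t => rel_occ vth s (L3 vth z) t ^ m)%C. split.
  - apply power_like_nat; [exact Em|]. intros t Ht. apply Hrel; lra.
  - now apply representation_nat.
Qed.

Let triple : UniformSpace := prod_UniformSpace C_UniformSpace (prod_UniformSpace R_UniformSpace R_UniformSpace).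

Let path s (p : triple) : C :=
  occ (Cexp (fst p)) (RtoC (fst (snd p)) * (L3 vth (fst p) * contour s (snd (snd p))))%C.

Let path_cont s u t : ccont (path s) (RtoC x, (u, t)).
Proof.
  assert (C1 : ccont (U := triple) (fun p => fst p) (RtoC x, (u, t))).
  { apply (ccont_comp (V := C_UniformSpace) fst (fun z => z)); [apply continuous_fst | apply ccont_id]. }
  assert (C2 : ccont (U := triple) (fun p => L3 vth (fst p)) (RtoC x, (u, t))).
  { apply (ccont_comp (V := C_UniformSpace) fst (L3 vth)); [apply continuous_fst | exact HLc]. }
  assert (C3 : ccont (U := triple) (fun p => contour s (snd (snd p))) (RtoC x, (u, t))).
  { apply (ccont_comp (V := R_UniformSpace) (fun p : triple => snd (snd p)) (contour s)); [|apply contour_cont].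
    apply (continuous_comp snd snd); apply continuous_snd. }
  unfold path, occ. apply ccont_plus; [apply ccont_const|]. apply ccont_mult; [now apply ccont_Cexp|].
  apply ccont_minus; [|apply ccont_const]. apply ccont_Cexp, ccont_mult.
  - apply ccont_RtoC. apply (continuous_comp snd fst); [apply continuous_snd | apply continuous_fst].
  - now apply ccont_mult.
Qed.

(** All requirements on the branches are open conditions that hold at [z = x]; the one on the swept
    region extends to nearby [z] by compactness of the parameter rectangle. *)
Lemma saddle_data_real (s : R) : 1 / 2 < s <= 1 ->
  (forall t, Rabs t <= PI -> t <> 0 -> Cmod (rel_occ vth s (RtoC L0) t) < exp (ln (Cmod (contour s t)) / vth)) ->
  (forall u t, 0 <= u <= 1 -> slit (occ (RtoC (exp x)) (RtoC u * (RtoC L0 * contour s t)))) ->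
  exists t0, saddle_data vth x L0 s t0.
Proof.
  intros Hs Hmod Hslit. assert (HPI := PI2_1).
  destruct (tube_lemma 0 1 (- PI) PI (RtoC x) (fun _ z u t => slit (path s (z, (u, t))))) as [e [He Htube]].
  { lra. } { apply PI_opp_le. } { trivial. }
  { intros u t Hu Ht.
    assert (Hp : slit (path s (RtoC x, (u, t)))).
    { change (slit (occ (Cexp (RtoC x)) (RtoC u * (L3 vth (RtoC x) * contour s t)))).
      rewrite EL, Cexp_RtoC. now apply Hslit. }
    exact (locally_triple _ _ _ _ (locally_slit _ _ (path_cont s u t) Hp)). }
  assert (Hpos : 0 < Re (path s (RtoC x, (1, 0)))).
  { change (0 < Re (occ (Cexp (RtoC x)) (RtoC 1 * (L3 vth (RtoC x) * contour s 0)))).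
    rewrite EL, Cexp_RtoC, contour_0.
    replace (RtoC 1 * (RtoC L0 * 1))%C with (RtoC L0) by ring. unfold occ. rewrite Cexp_RtoC, <- RtoC_minus, <- RtoC_mult, <- RtoC_plus, re_RtoC.
    rewrite exp_Ropp in Hsaddle. pose proof (exp_pos x). pose proof (exp_pos L0).
    assert (E : exp x * ((vth * L0 - 1) * exp L0) = 1 - exp x) by (rewrite Hsaddle; field; lra).
    assert (0 < exp x * (vth * L0 * exp L0)).
    { apply Rmult_lt_0_compat; [assumption|]. apply Rmult_lt_0_compat; [nra | assumption]. }
    lra. }
  destruct (locally_triple _ _ _ _ (locally_pos (U := triple) (fun p => Re (path s p)) _ (proj1 (path_cont s 1 0)) Hpos)) as [e' [He' Hre]].
  assert (Hlog : locally (T := C_UniformSpace) (RtoC x) (fun z => Rabs (Im (log_occ vth z)) < PI / 2)).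
  { assert (Hc : ccont (U := C_UniformSpace) (log_occ vth) (RtoC x)).
    { unfold log_occ. apply ccont_plus; [apply ccont_plus; [apply ccont_plus; [apply ccont_const|]|]|].
      - apply ccont_Clog; [exact HLc|]. rewrite EL. apply slit_Re. exact HL0.
      - apply ccont_id.
      - exact HLc. }
    refine (filter_imp _ _ _ (ccont_near _ _ 1 Rlt_0_1 Hc)). intros z Hz.
    assert (E0 : Im (log_occ vth (RtoC x)) = 0).
    { unfold log_occ. rewrite EL, Clog_RtoC by exact HL0. unfold Im; simpl. ring. }
    pose proof (Rabs_Im_le_Cmod (log_occ vth z - log_occ vth (RtoC x))) as HI.
    replace (Im (log_occ vth z - log_occ vth (RtoC x))) with (Im (log_occ vth z)) in HI
      by (change (Im (log_occ vth z) = Im (log_occ vth z) + - Im (log_occ vth (RtoC x))); rewrite E0; ring).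
    lra. }
  exists (e' / 2). split; [exact Hs|]. split; [lra|]. split; [exact Hmod|].
  destruct (locally_C_Cmod _ _ (filter_and _ _ Hlog (filter_and _ _ L3_neq_0_near (W_arg_real_near vth Hv x Hray))))
    as [d [Hd H]].
  exists (Rmin d (Rmin e e')), 0%nat. split; [repeat apply Rmin_pos; assumption|].
  intros z n Hz _ Hn _.
  generalize (Rmin_l d (Rmin e e')) (Rmin_r d (Rmin e e')) (Rmin_l e e') (Rmin_r e e'). intros.
  destruct (H z ltac:(lra)) as (H5 & H6 & H7).
  assert (Hsl : forall u t, - e < u < 1 + e -> - PI - e < t < PI + e -> slit (occ (Cexp z) (RtoC u * (L3 vth z * contour s t)))).
  { intros u t Hu Ht. apply (Htube z u t); lra. }
  eexists. split; [|exact (representation_real vth s z n Hv Hs Hn H6 e He Hsl)].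
  apply power_like_real; try assumption.
  - intros t Ht. apply Rabs_le_between in Ht. rewrite <- (Cmult_1_l (L3 vth z * contour s t)). apply Hsl; lra.
  - intros t Ht. specialize (Hre z 1 t ltac:(lra)). rewrite Rminus_diag, Rabs_R0, Rminus_0_r in Hre.
    specialize (Hre He' ltac:(lra)). change (0 < Re (occ (Cexp z) (RtoC 1 * (L3 vth z * contour s t)))) in Hre. now rewrite Cmult_1_l in Hre.
Qed.

End LocalRepresentation.

Lemma local_representation (vth x L0 : R) : 0 < vth -> 0 < L0 ->
  C_minus_ray (- exp (-1)) (W_arg vth (RtoC x)) -> L3 vth (RtoC x) = RtoC L0 ->
  (vth * L0 - 1) * exp L0 = exp (- x) - 1 ->
  exists s t0, saddle_data vth x L0 s t0.
Proof.
  intros Hv HL0 Hray EL Hsaddle.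
  pose proof (exp_pos x) as Hx. pose proof (exp_pos L0) as HeL.
  assert (HE : exp x * ((vth * L0 - 1) * exp L0) = 1 - exp x).
  { rewrite Hsaddle, exp_Ropp. field. lra. }
  set (k := - (L0 + ln (1 - vth * L0)) / L0).
  (* By the saddle point equation [(1 - vth L0) exp L0 = 1 - exp (- x) < 1]. *)
  assert (Hk : vth * L0 < 1 -> 0 < k).
  { intros H. unfold k. apply Rdiv_lt_0_compat; [|exact HL0].
    assert (ln (1 - vth * L0) < - L0); [|lra].
    rewrite <- (ln_exp (- L0)). apply ln_increasing; [lra|].
    rewrite exp_Ropp. apply Rmult_lt_reg_r with (exp L0); [exact HeL|]. rewrite Rinv_l by lra.
    pose proof (exp_pos (- x)). lra. }
  destruct (Rle_dec 1 vth) as [Hv1|Hv1]; destruct (Rle_dec 1 (vth * L0)) as [HvL|HvL].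
  - exists 1. apply saddle_data_real; try assumption; try lra.
    + intros t Ht H0. now apply rel_occ_lt_convex.
    + intros u t Hu. now apply (occ_slit_convex vth).
  - specialize (Hk ltac:(lra)). exists ((1 + k) / (2 + k)). apply saddle_data_real; try assumption.
    + split; [apply (proj1 (Rlt_div_r (1 / 2) (1 + k) (2 + k) ltac:(lra))); lra|].
      apply (proj2 (Rle_div_l (1 + k) 1 (2 + k) ltac:(lra))). lra.
    + intros t Ht H0. apply rel_occ_lt_apollonius; try assumption; lra.
    + intros u t Hu. apply (occ_slit_apollonius vth); try assumption; lra.
  - exists 1. apply saddle_data_nat; try assumption; try lra.
    intros t Ht H0. now apply rel_occ_lt_convex.
  - exists 1. apply saddle_data_nat; try assumption; try lra.
    intros t Ht H0. apply rel_occ_lt_circle; try assumption; try lra. apply Hk; lra.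
Qed.

(** * Normalisation *)

(** At [y = 1] the recurrence loses its second term. *)
Lemma stirling_poly_1 (n : nat) (theta : R) : stirling_poly n theta 1 = RtoC (theta ^ n).
Proof.
  induction n as [|n IH].
  - unfold stirling_poly. rewrite sum_n_C_0. simpl. rewrite RtoC_mult. cring.
  - rewrite stirling_poly_S, IH. simpl. rewrite RtoC_mult. ring.
Qed.

(* At [z = 0] and [vth = 1] the expectation is 1, which replaces Stirling's formula
   for the constant [kappa n]. *)
Lemma kappa_reference (n : nat) : (1 <= n)%nat ->
  (RtoC (kappa n) * saddle_integral 1 n (fun t => rel_occ 1 1 1 t ^ n))%C = 1.
Proof.
  intros Hn. assert (HnR : 0 < INR n) by (apply lt_0_INR; lia).
  assert (H11 : 1 / 2 < 1 <= 1) by lra.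
  assert (H10 : RtoC 1 <> 0) by (intros E; apply RtoC_inj in E; lra).
  pose proof (cauchy_nat 1 1 1 n H11 H10 n) as E.
  rewrite stirling_poly_1, Cpow_1_l in E.
  assert (EI : CInt (fun t => occ 1 (1 * contour 1 t) ^ n / contour 1 t ^ n * weight 1 t)%C (- PI) PI =
    (RtoC (exp (INR n)) * saddle_integral 1 n (fun t => rel_occ 1 1 1 t ^ n))%C).
  { unfold saddle_integral. rewrite <- (CInt_scal _ _ PI_opp_le).
    - apply CInt_ext; [apply PI_opp_le|]. intros t _.
      replace (occ 1 (1 * contour 1 t)) with (Cexp 1 * rel_occ 1 1 1 t)%C.
      + rewrite Cpow_mult_l, <- Cexp_pow, Cmult_1_r, Cexp_RtoC. unfold Cdiv. ring.
      + unfold occ, rel_occ. replace (1 * contour 1 t)%C with (1 + 1 * (1 * (cis t - 1)))%C by (unfold contour; ring).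
        rewrite Cexp_plus. field.
    - intros t _. apply ccont_mult; [|now apply weight_cont].
      apply ccont_div; [apply ccont_pow, rel_occ_cont | apply ccont_pow, contour_cont | now apply Cpow_nz, contour_neq_0]. }
  rewrite EI in E. set (J := saddle_integral _ _ _) in *.
  assert (Hp : 0 < INR n ^ n) by now apply pow_lt.
  assert (H4 : RtoC (INR n ^ n) <> 0) by (intros E0; apply RtoC_inj in E0; lra).
  unfold kappa. rewrite (RtoC_div _ (INR n ^ n)), (RtoC_mult _ (exp (INR n))) by lra.
  replace (RtoC (INR (fact n) / (2 * PI)) * RtoC (exp (INR n)) / RtoC (INR n ^ n) * J)%C with
    ((RtoC (INR (fact n) / (2 * PI)) / 1 * (RtoC (exp (INR n)) * J)) / RtoC (INR n ^ n))%C
    by (field; repeat split; assumption).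
  rewrite <- E. field. exact H4.
Qed.

(** Here [vth = 1] and [L = 1], so that [L + 1 - 1 / vth = 1] and the square root drops out. *)
Lemma reference_asymptotics : exists M, forall n, (1 <= n)%nat ->
  Cmod (saddle_integral 1 n (fun t => rel_occ 1 1 1 t ^ n)%C - CInt (gaussian 1 n) (- PI) PI)
    <= M / (INR n * sqrt (INR n)).
Proof.
  destruct (rel_occ_neq_0_near 1 1 1 ltac:(lra) ltac:(lra)) as [e [He Hrel]].
  destruct (saddle_asymptotics 1 1 1 (e / 2)) as (eta & M & Heta & H); try lra.
  { intros t Ht H0. apply rel_occ_lt_convex; try assumption; lra. }
  assert (E11 : Cmod (RtoC 1 - RtoC 1) = 0) by (replace (RtoC 1 - RtoC 1)%C with (RtoC 0) by ring; apply Cmod_0).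
  exists M. intros n Hn.
  destruct (power_like_nat 1 1 1 n n (e / 2)) as (P1 & P2 & P3).
  { ring. } { intros t Ht. apply Hrel; [rewrite E11; exact He | lra]. }
  specialize (H 1 n (fun t => rel_occ 1 1 1 t ^ n)%C ltac:(rewrite E11; exact Heta) Hn P1 P2 P3).
  replace (/ (1 + 1 - / 1))%C with (RtoC 1) in H by (field; intros E; apply RtoC_inj in E; lra).
  rewrite Csqrt_RtoC, sqrt_1, Cmult_1_l in H by lra. exact H.
Qed.

(** As [kappa n * I0 = 1] for the reference integral [I0], the ratio is [I / I0]. Both are compared
    with the same Gaussian integral [g]: [I] with [q g] and [I0] with [g], up to [O(n^(-3/2))].
    Division by [I0], of order at least [n^(-1/2)], leaves [O(1/n)]. *)
Lemma local_theorem (vth x : R) : 0 < vth -> exists d M N, 0 < d /\ forall z, Cmod (z - RtoC x) < d ->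
  defined3 vth z /\ forall n : nat, (N <= n)%nat -> SS_defined n (vth * INR n) ->
    Cmod (ratio3 vth n z - Csqrt (radicand3 vth z)) <= M / INR n.
Proof.
  intros Hv. destruct (L3_real vth Hv x) as (L0 & Hray & EL & HL0 & Ha0 & Hsaddle).
  destruct (local_representation vth x L0 Hv HL0 Hray EL Hsaddle) as (s & t0 & Hs & Ht0 & Hmod & d1 & N1 & Hd1 & Hrep).
  destruct (saddle_asymptotics vth s L0 t0 Hv Hs HL0 Ha0 Ht0 Hmod) as (eta & M1 & Heta & Hasy).
  destruct reference_asymptotics as [M0 Href].
  set (a0 := L0 + 1 - / vth) in *.
  set (e := Rmin eta (Rmin L0 (a0 / 2))).
  assert (He : 0 < e) by (repeat apply Rmin_pos; lra).
  assert (HLnear : locally (T := C_UniformSpace) (RtoC x) (fun z => Cmod (L3 vth z - RtoC L0) < e)).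
  { rewrite <- EL. apply ccont_near; [exact He | now apply L3_cont]. }
  destruct (locally_C_Cmod _ _ (filter_and _ _ HLnear (W_arg_real_near vth Hv x Hray))) as [d2 [Hd2 Hnear]].
  (* For [n] at least this large the error of [I0] is at most half the lower bound of [g]. *)
  destruct (nfloor_ex (2 * Rmax 0 M0)) as [N0 HN0]; [generalize (Rmax_l 0 M0); lra|].
  (* A bound for [|q|], from [|q|^2 <= 2 / a0] and [r <= 1 + r^2]. *)
  set (S := 1 + 2 / a0).
  exists (Rmin d1 d2), (2 * (M1 + S * Rmax 0 M0)), (N1 + N0 + 1)%nat.
  split; [now apply Rmin_pos|]. intros z Hz.
  assert (Hz1 : Cmod (z - RtoC x) < d1) by (eapply Rlt_le_trans; [exact Hz | apply Rmin_l]).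
  assert (Hz2 : Cmod (z - RtoC x) < d2) by (eapply Rlt_le_trans; [exact Hz | apply Rmin_r]).
  destruct (Hnear z Hz2) as [HLz Hrayz].
  assert (HL1 : Cmod (L3 vth z - RtoC L0) < eta) by (eapply Rlt_le_trans; [exact HLz | apply Rmin_l]).
  assert (HL2 : Cmod (L3 vth z - RtoC L0) < L0) by (eapply Rlt_le_trans; [exact HLz | eapply Rle_trans; [apply Rmin_r | apply Rmin_l]]).
  assert (HL3 : Cmod (L3 vth z - RtoC L0) < a0 / 2) by (eapply Rlt_le_trans; [exact HLz | eapply Rle_trans; [apply Rmin_r | apply Rmin_r]]).
  set (L := L3 vth z) in *. set (a := (L + 1 - / RtoC vth)%C).
  assert (HR : Rabs (Re L - L0) <= Cmod (L - RtoC L0)) by exact (re_le_Cmod (L - RtoC L0)).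
  assert (HRL := proj1 (Rabs_le_between _ _) HR).
  assert (Hinvv : RtoC (/ vth) = (/ RtoC vth)%C) by (apply RtoC_inv; lra).
  assert (Ha : a0 / 2 < Re a).
  { unfold a. rewrite <- Hinvv. change (a0 / 2 < Re L + 1 + - / vth). unfold a0 in *. lra. }
  assert (Ha0' : a <> 0) by (apply slit_neq_0, slit_Re; lra).
  destruct (radicand3_alt vth z Hv Ha0') as [Erad Hden]. fold L in Erad, Hden. fold a in Erad.
  assert (Hma : a0 / 2 < Cmod a) by (generalize (Re_le_Cmod a); lra).
  split.
  - split; [exact Hrayz|]. split; [apply slit_Re; fold L; lra|]. split; [exact Hden|].
    rewrite Erad. apply slit_Re. rewrite Cinv_alt.
    change (0 < Re a / (Re a * Re a + Im a * Im a)).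
    apply Rdiv_lt_0_compat; [lra|]. generalize (Rle_0_sqr (Im a)); unfold Rsqr. nra.
  - intros n Hn Hdef.
    assert (Hn1 : (1 <= n)%nat) by lia.
    destruct (Hrep z n Hz1 ltac:(lia) Hn1 Hdef) as (U & (P1 & P2 & P3) & Eratio).
    specialize (Hasy L n U HL1 Hn1 P1 P2 P3). specialize (Href n Hn1).
    pose proof (kappa_reference n Hn1) as Ekappa.
    pose proof (gaussian_integral_lower n Hn1) as Hlow.
    fold (saddle_integral s n U) in Hasy. fold a in Hasy.
    rewrite Eratio, Erad.
    set (I := saddle_integral s n U) in *. set (I0 := saddle_integral 1 n _) in *.
    set (g := CInt (gaussian 1 n) (- PI) PI) in *. set (q := Csqrt (/ a)) in *.
    assert (HnR : 1 <= INR n) by (change 1 with (INR 1); now apply le_INR).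
    set (N := INR n) in *.
    pose proof (sqrt_lt_R0 N ltac:(lra)) as Hsq. pose proof (sqrt_sqrt N ltac:(lra)) as Hsq2.
    assert (HM0 : M0 <= Rmax 0 M0) by apply Rmax_r. assert (HM0' : 0 <= Rmax 0 M0) by apply Rmax_l.
    set (m := Rmax 0 M0) in *.
    assert (HNs : 0 < N * sqrt N) by (apply Rmult_lt_0_compat; lra).
    assert (Href' : Cmod (I0 - g) <= m / (N * sqrt N)).
    { eapply Rle_trans; [exact Href|]. apply Rmult_le_compat_r; [apply Rlt_le, Rinv_0_lt_compat, HNs | exact HM0]. }
    assert (Hq : Cmod q <= S).
    { assert (Eq : Cmod q * Cmod q <= 2 / a0).
      { rewrite <- Cmod_mult. unfold q. rewrite Csqrt_sqr.
        - rewrite Cmod_inv by exact Ha0'. replace (2 / a0) with (/ (a0 / 2)) by (field; lra).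
          apply Rinv_le_contravar; lra.
        - intros E0. apply Cmod_gt_0 in Ha0'. assert (Z : Cmod (/ a) = 0) by (rewrite E0; apply Cmod_0).
          rewrite Cmod_inv in Z by (now apply Cmod_gt_0). apply Rinv_0_lt_compat in Ha0'. lra. }
      unfold S. pose proof (Cmod_ge_0 q). nra. }
    assert (HS : 0 <= S) by (generalize (Cmod_ge_0 q); lra).
    assert (HNm : 2 * m <= N).
    { assert (INR N0 + 1 <= N) by (rewrite <- S_INR; apply le_INR; lia). lra. }
    assert (HI0 : 1 / (2 * sqrt N) <= Cmod I0).
    { assert (Cmod g - Cmod (g - I0) <= Cmod I0).
      { generalize (Cmod_triangle (g - I0) I0). replace (g - I0 + I0)%C with g by ring. lra. }
      rewrite Cmod_minus_sym in H.
      assert (m / (N * sqrt N) <= 1 / (2 * sqrt N)).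
      { apply (proj2 (Rle_div_l _ _ _ HNs)). replace (1 / (2 * sqrt N) * (N * sqrt N)) with (N / 2) by (field; lra). lra. }
      replace (1 / (2 * sqrt N)) with (1 / sqrt N - 1 / (2 * sqrt N)) by (field; lra). lra. }
    assert (HI0pos : 0 < Cmod I0).
    { eapply Rlt_le_trans; [|exact HI0]. apply Rdiv_lt_0_compat; lra. }
    assert (HI0n : I0 <> 0) by now apply Cmod_gt_0.
    replace (RtoC (kappa n) * I - q)%C with ((I - q * I0) / I0)%C.
    2:{ replace (RtoC (kappa n)) with (RtoC (kappa n) * I0 / I0)%C by (field; exact HI0n). rewrite Ekappa. field. exact HI0n. }
    rewrite Cmod_div by exact HI0n. apply (proj2 (Rle_div_l _ _ _ HI0pos)).
    assert (Hnum : Cmod (I - q * I0) <= (M1 + S * m) / (N * sqrt N)).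
    { replace (I - q * I0)%C with ((I - q * g) + - (q * (I0 - g)))%C by ring.
      unfold Rdiv. rewrite Rmult_plus_distr_r. apply Cmod_triangle_le; [exact Hasy|].
      rewrite Cmod_opp, Cmod_mult, Rmult_assoc. apply Rmult_le_compat; try apply Cmod_ge_0; [exact Hq | exact Href']. }
    assert (HMS : 0 <= M1 + S * m).
    { apply Rnot_lt_le. intros h. assert ((M1 + S * m) / (N * sqrt N) < 0).
      { unfold Rdiv. rewrite <- (Rmult_0_l (/ (N * sqrt N))). apply Rmult_lt_compat_r; [now apply Rinv_0_lt_compat | exact h]. }
      generalize (Cmod_ge_0 (I - q * I0)). lra. }
    eapply Rle_trans; [exact Hnum|].
    apply Rle_trans with (2 * (M1 + S * m) / N * (1 / (2 * sqrt N))).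
    + right. field. lra.
    + apply Rmult_le_compat_l; [|exact HI0]. apply Rle_mult_inv_pos; lra.
Qed.

Theorem theorem2p3 (vth : R) (hvth : 0 < vth) :
  exists D3 : C -> Prop,
    open D3 /\
    (forall x : R, D3 (RtoC x)) /\
    (forall z : C, D3 z -> defined3 vth z) /\
    (forall z : C, D3 z ->
       filterlim (fun n : nat => ratio3 vth n z)
         (within (fun n : nat => SS_defined n (vth * INR n)) eventually)
         (locally (Csqrt (radicand3 vth z)))) /\
    (forall K : C -> Prop, compact_C K -> (forall z, K z -> D3 z) ->
       exists (M : R) (N : nat), forall n : nat,
         (N <= n)%nat -> SS_defined n (vth * INR n) ->
         forall z : C, K z ->
           Cmod (ratio3 vth n z - Csqrt (radicand3 vth z)) <= M / INR n).
Proof.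
  (* Each disc carries the constants valid on it, so that a finite subcover of a compact set yields
     a finite maximum. *)
  pose (good := fun (p : (R * R) * (R * nat)) => 
    let '((x, d), (M, N)) := p in 0 < d /\ forall z, Cmod (z - RtoC x) < d ->
    defined3 vth z /\ forall n : nat, (N <= n)%nat -> SS_defined n (vth * INR n) ->
    Cmod (ratio3 vth n z - Csqrt (radicand3 vth z)) <= M / INR n).
  pose (disc := fun (p : (R * R) * (R * nat)) (z : C) => Cmod (z - RtoC (fst (fst p))) < snd (fst p)).
  assert (Hopen : forall p, open (T := C_UniformSpace) (disc p)).
  { intros [[x d] [M N]] z Hz. unfold disc in *. simpl in *.
    apply (locally_Cmod z _ (d - Cmod (z - RtoC x))); [lra|].
    intros y Hy. replace (y - RtoC x)%C with ((y - z) + (z - RtoC x))%C by ring.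
    eapply Rle_lt_trans; [apply Cmod_triangle|]. lra. }
  exists (fun z => exists p, good p /\ disc p z). split; [|split; [|split; [|split]]].
  - intros z [p [Hp Hz]]. refine (filter_imp _ _ _ (Hopen p z Hz)).
    intros y Hy. exists p. now split.
  - intros x. destruct (local_theorem vth x hvth) as (d & M & N & Hd & H).
    exists ((x, d), (M, N)). split; [now split|]. unfold disc. simpl.
    replace (RtoC x - RtoC x)%C with (RtoC 0) by ring. now rewrite Cmod_0.
  - intros z [[[x d] [M N]] [[Hd H] Hz]]. now apply H.
  - intros z [[[x d] [M N]] [[Hd H] Hz]] P [eps HP].
    destruct (H z Hz) as [_ Hn].
    destruct (nfloor_ex (Rmax 0 M / eps)) as [n0 Hn0].
    { apply Rle_mult_inv_pos; [apply Rmax_l | apply cond_pos]. }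
    exists (N + n0 + 1)%nat. intros n Hn1 Hdef. apply HP.
    apply C_NormedModule_mixin_compat1. specialize (Hn n ltac:(lia) Hdef).
    eapply Rle_lt_trans; [exact Hn|]. pose proof (cond_pos eps) as He.
    assert (Hn2 : INR n0 + 1 <= INR n) by (rewrite <- S_INR; apply le_INR; lia).
    assert (Hn3 : 0 < INR n) by (generalize (pos_INR n0); lra).
    apply (proj2 (Rlt_div_l _ _ _ Hn3)).
    assert (Hm : Rmax 0 M < eps * INR n).
    { rewrite Rmult_comm. apply (proj1 (Rlt_div_l _ _ _ He)). lra. }
    generalize (Rmax_r 0 M). lra.
  - intros K HK HKD.
    destruct (HK {p | good p} (fun i => disc (proj1_sig i))) as [l Hl].
    + intros i. apply Hopen.
    + intros z Hz. destruct (HKD z Hz) as [p [Hp Hd]]. now exists (exist _ p Hp).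
    + assert (Hbound : exists (M : R) (N : nat), forall i, List.In i l ->
         fst (snd (proj1_sig i)) <= M /\ (snd (snd (proj1_sig i)) <= N)%nat).
      { clear Hl. induction l as [|i l [M [N IH]]].
        - exists 0, 0%nat. intros i [].
        - exists (Rmax (fst (snd (proj1_sig i))) M), (Nat.max (snd (snd (proj1_sig i))) N).
          intros j [<-|Hj].
          + split; [apply Rmax_l | apply Nat.le_max_l].
          + destruct (IH j Hj). split; [eapply Rle_trans; [eassumption | apply Rmax_r] | lia]. }
      (* The 1 in the maximum ensures [n > 0], hence that [M / n] is monotone in [M]. *)
      destruct Hbound as (M & N & Hb). exists M, (Nat.max 1 N). intros n Hn Hdef z Hz.
      destruct (Hl z Hz) as ([[[x d] [M' N']] Hp] & Hi & Hd).
      destruct (Hb _ Hi) as [B1 B2]. simpl in B1, B2. destruct Hp as [Hd0 Hp].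
      destruct (Hp z Hd) as [_ Hp']. eapply Rle_trans; [apply Hp'; [lia | exact Hdef]|].
      apply Rmult_le_compat_r; [|exact B1]. apply Rlt_le, Rinv_0_lt_compat, lt_0_INR. lia.
Qed.
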